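(* Let $0<q<1$, $K>0$, $A>0$ be fixed with respect to $N$, and let $\lambda=\min\left\{\frac12q,\ \frac2d(1-q)\right\}$. Suppose conditions (a'), (b), (c), (d), (M) and (T) of the context hold. Then the excess risk of the adaptive $k$NN regressor (defined in the context) satisfies, as $N\to\infty$, $$R-R^*=\begin{cases}\mathcal{O}\left(N^{-\min\{\beta,2\lambda\}}\right) & \text{if } \beta\neq2\lambda,\\ \mathcal{O}\left(N^{-\beta}\ln N\right) & \text{if } \beta=2\lambda.\end{cases}$$ As a result, the optimal $q$ (giving the best rate in this bound) is $q^*=4/(d+4)$, with corresponding $\lambda=2/(d+4)$; thus, except in the special case $\beta=4/(d+4)$, the optimal convergence rate is $$R-R^*=\mathcal{O}\left(N^{-\min\left\{\beta,\frac{4}{d+4}\right\}}\right).$$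
   Context: Regression setting. $\mathbf{X}\in\mathbb{R}^d$ has probability density $f$, and $Y=\eta(\mathbf{X})+\epsilon\in\mathbb{R}$ with $\mathbb{E}[\epsilon|\mathbf{X}=\mathbf{x}]=0$ for all $\mathbf{x}$. A regressor $g$ is built from $N$ i.i.d. training samples $(\mathbf{X}_i,Y_i)$ with the law of $(\mathbf{X},Y)$, independent of the test pair. Its risk is $R=\mathbb{E}[(g(\mathbf{X})-Y)^2]$, the Bayes risk is $R^*=\mathbb{E}[\epsilon^2]$, and the excess risk is $R-R^*=\mathbb{E}[(g(\mathbf{X})-\eta(\mathbf{X}))^2]$ (expectation over training samples and test point). Let $\|\cdot\|$ be any fixed norm on $\mathbb{R}^d$. $B(\mathbf{x},r)$ is the ball with center $\mathbf{x}$ and radius $r$ in this norm, $V(\cdot)$ denotes volume, and $\mathrm{P}(B(\mathbf{x},r))$ is the probability mass of $B(\mathbf{x},r)$ under the law of $\mathbf{X}$ ($\mathrm{P}^q$ is its $q$-th power). Adaptive $k$NN regressor with parameters $K,A,q$: for a test point $\mathbf{x}$ put $n=\sum_{i=1}^N\mathbf{1}(\mathbf{X}_i\in B(\mathbf{x},A))$ and $k=\lfloor Kn^q\rfloor+1$; then $g(\mathbf{x})=\frac1k\sum_{i=1}^kY^{(i)}$, where $Y^{(i)}$ is the target value of the $i$-th nearest neighbor of $\mathbf{x}$ among $\mathbf{X}_1,\dots,\mathbf{X}_N$ with respect to $\|\cdot\|$. Conditions: there are finite constants $C_a,C_b,C_c,C_b',M$, a constant $C_d>0$, and $\beta>0$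 such that (a') $\operatorname{Var}[Y|\mathbf{X}=\mathbf{x}]\le C_a$ for all $\mathbf{x}$; (b) for all $t>0$, $\mathrm{P}(f(\mathbf{X})\le t)\le C_bt^\beta$; (c) for every $r>0$ and every $\mathbf{x}$ in the support of $f$, $|\eta(B(\mathbf{x},r))-\eta(\mathbf{x})|\le C_cr^2$, where $\eta(B(\mathbf{x},r)):=\mathbb{E}[Y|\mathbf{X}\in B(\mathbf{x},r)]$; (d) there is $D>0$ such that $\mathrm{P}(B(\mathbf{x},r))\ge C_df(\mathbf{x})V(B(\mathbf{x},r))$ for all $\mathbf{x}$ and all $0<r<D$; (M) $|\eta(\mathbf{x})|\le M$ for all $\mathbf{x}$; (T) for any $t>0$, $\mathrm{P}\left(\dfrac{f(\mathbf{X})}{\mathrm{P}^q(B(\mathbf{X},A))}<t^{1-q}\right)\le C_b't^\beta$ (with the same $q$ and $A$ as in the adaptive regressor). $\mathcal{O}$ is with respect to $N\to\infty$, with constants not depending on $N$. *)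

(* Defs.v *)
From HB Require Import structures.
From mathcomp Require Import all_boot all_order all_algebra.
From mathcomp Require Import all_classical all_reals all_analysis.
Set Implicit Arguments.
Unset Strict Implicit.
Unset Printing Implicit Defensive.
Import Order.TTheory GRing.Theory Num.Theory.
Import numFieldNormedType.Exports.
Local Open Scope classical_set_scope.
Local Open Scope ring_scope.

(* The sigma-algebra on row vectors generated by the coordinates; on 'rV[R]_d
   it is the Borel sigma-algebra of R^d. *)
Section rV_measurable.
Context {d : measure_display} {T : measurableType d}.
Variable n : nat.

Let coor : 'I_n -> 'rV[T]_n -> T := fun i v => v ord0 i.

Let rV_set0 : g_sigma_preimage coor set0.
Proof. exact: sigma_algebra0. Qed.

Let rV_setC A : g_sigma_preimage coor A -> g_sigma_preimage coor (~` A).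
Proof. exact: sigma_algebraC. Qed.

Let rV_bigcup (F : (set _)^nat) : (forall i, g_sigma_preimage coor (F i)) ->
  g_sigma_preimage coor (\bigcup_i (F i)).
Proof. exact: sigma_algebra_bigcup. Qed.

HB.instance Definition _ := @isMeasurable.Build (measure_tuple_display d)
  'rV[T]_n (g_sigma_preimage coor) rV_set0 rV_setC rV_bigcup.

End rV_measurable.

Lemma measurable_coor (d : measure_display) (T : measurableType d) n
  (i : 'I_n) : measurable_fun [set: 'rV[T]_n] (fun v => v ord0 i).
Proof.
move=> _ Y mY; rewrite setTI; apply: sub_sigma_algebra => /=.
rewrite -bigcup_seq/=; exists i => /=; first by rewrite mem_index_enum.
by exists Y => //; rewrite setTI.
Qed.

Lemma measurable_fun_rV (d1 d2 : measure_display) (T1 : measurableType d1)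
    (T2 : measurableType d2) n (f : T1 -> 'rV[T2]_n) :
  (forall i, measurable_fun [set: T1] (fun x => f x ord0 i)) ->
  measurable_fun [set: T1] f.
Proof.
move=> mf; apply: (@measurability _ _ _ _ _ _
  (\big[setU/set0]_(i < n)
     preimage_set_system setT (fun v : 'rV[T2]_n => v ord0 i) measurable)) => //.
move=> _ [A + <-]; rewrite -bigcup_seq => -[i _ [B mB <-]].
by rewrite setTI; exact: mf.
Qed.

Section lebesgue_rV.
Context {R : realType}.

Definition rV_cons n (p : 'rV[R]_n * R) : 'rV[R]_n.+1 :=
  row_mx (const_mx p.2 : 'rV_1) p.1.

Lemma rV_cons0 n (v : 'rV[R]_n) (x : R) : rV_cons (v, x) ord0 ord0 = x.
Proof.
by rewrite /rV_cons mxE; case: splitP => // j _; rewrite mxE.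
Qed.

Lemma rV_cons_lift n (v : 'rV[R]_n) (x : R) (i : 'I_n) :
  rV_cons (v, x) ord0 (lift ord0 i) = v ord0 i.
Proof.
rewrite /rV_cons mxE; case: splitP => [[[]]//|j [ij]] /=.
by congr (v _ _); apply/val_inj.
Qed.

Lemma measurable_rV_cons n : measurable_fun [set: 'rV[R]_n * R] (@rV_cons n).
Proof.
apply: measurable_fun_rV => i; rewrite /rV_cons.
under eq_fun do rewrite mxE.
case: splitP => j _.
  by under eq_fun do rewrite mxE; exact: measurable_snd.
apply: (@measurableT_comp _ _ _ _ _ _ (fun v : 'rV[R]_n => v ord0 j)).
  exact: measurable_coor.
exact: measurable_fst.
Qed.

Section lebesgue_rV_cons.
Local Open Scope ereal_scope.
Variables (n : nat) (mu : {measure set 'rV[R]_n -> \bar R}).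

Definition lebesgue_rV_cons : set 'rV[R]_n.+1 -> \bar R :=
  pushforward (mu \x lebesgue_measure) (@rV_cons n).

Let pushforward_mu : {measure set 'rV[R]_n.+1 -> \bar R} :=
  measure_function_pushforward__canonical__measure_function_Measure
    (mu \x lebesgue_measure) (@measurable_rV_cons n).

Let lebesgue_rV_cons0 : lebesgue_rV_cons set0 = 0.
Proof. exact: (measure0 pushforward_mu). Qed.

Let lebesgue_rV_cons_ge0 A : 0 <= lebesgue_rV_cons A.
Proof. exact: (measure_ge0 pushforward_mu). Qed.

Let lebesgue_rV_cons_additive : semi_sigma_additive lebesgue_rV_cons.
Proof. exact: (@measure_semi_sigma_additive _ _ _ pushforward_mu). Qed.

HB.instance Definition _ := isMeasure.Build _ _ _ lebesgue_rV_cons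
  lebesgue_rV_cons0 lebesgue_rV_cons_ge0 lebesgue_rV_cons_additive.

End lebesgue_rV_cons.

(* Lebesgue measure (volume) on R^n, as the n-fold product of the Lebesgue
   measure on R. *)
Fixpoint lebesgue_rV n : {measure set 'rV[R]_n -> \bar R} :=
  if n is m.+1 then lebesgue_rV_cons (lebesgue_rV m)
  else dirac (0 : 'rV[R]_0).

Lemma lebesgue_rV_box n (A : 'I_n -> set R) :
  (forall i, measurable (A i)) ->
  lebesgue_rV n [set v | forall i, A i (v ord0 i)] =
  (\prod_(i < n) lebesgue_measure (A i))%E.
Proof.
elim: n A => [|n IH] A mA.
  rewrite big_ord0 /= diracE mem_set//= => -[].
  by [].
rewrite big_ord_recl /= /lebesgue_rV_cons /pushforward.
set B := [set v : 'rV[R]_n | forall i, A (lift ord0 i) (v ord0 i)].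
have mB : measurable B.
  rewrite (_ : B = \bigcap_(i in [set: 'I_n])
      ((fun v : 'rV[R]_n => v ord0 i) @^-1` A (lift ord0 i))).
    apply: fin_bigcap_measurable => // i _.
    by rewrite -[X in measurable X]setTI; exact: measurable_coor.
  by apply/seteqP; split => [v Bv i _|v Bv i]; exact: Bv.
rewrite (_ : _ @^-1` _ = B `*` A ord0); last first.
  apply/seteqP; split => -[v x] /=.
    move=> Avx; split => [i|]; first by rewrite -(rV_cons_lift v x); exact: Avx.
    by rewrite -(rV_cons0 v x); exact: Avx.
  move=> [Bv Ax] i; case: (unliftP ord0 i) => [j|] ->.
    by rewrite rV_cons_lift; exact: Bv.
  by rewrite rV_cons0.
have IHB := IH (fun i => A (lift ord0 i)) (fun i => mA _).
rewrite product_measure1E//; last exact: mA.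
by rewrite muleC; congr (_ * _)%E; exact: IHB.
Qed.

End lebesgue_rV.

Section norm.
Context {R : realType} {d : nat}.

Record is_norm (nm : 'rV[R]_d -> R) : Prop := IsNorm {
  is_norm_triangle : forall x y, nm (x + y) <= nm x + nm y ;
  is_norm_homogeneous : forall a x, nm (a *: x) = `|a| * nm x ;
  is_norm_definite : forall x, nm x = 0 -> x = 0 }.

(* The closed ball; the spheres of a norm are Lebesgue-null, so for a law with a
   density the open ball has the same mass and the same volume. *)
Definition nball (nm : 'rV[R]_d -> R) (x : 'rV[R]_d) (r : R) : set 'rV[R]_d :=
  [set u | nm (u - x) <= r].

End norm.

Section probability_notions.
Context {dO : measure_display} {Om : measurableType dO} {R : realType}.
Variable P : probability Om R.

Definition mutual_independence {d' : measure_display} {T : measurableType d'}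
    {I : eqType} (Z : I -> Om -> T) : Prop :=
  forall (s : seq I) (A : I -> set T), uniq s ->
    (forall i, measurable (A i)) ->
    P (\bigcap_(i in [set` s]) (Z i @^-1` A i)) =
    (\prod_(i <- s) P (Z i @^-1` A i))%E.

Definition same_law {d' : measure_display} {T : measurableType d'}
    (Z1 Z2 : Om -> T) : Prop :=
  forall A, measurable A -> P (Z1 @^-1` A) = P (Z2 @^-1` A).

(* h is a version of x |-> E[Z | X = x]. Such a version is determined up to a
   null set of the law of X, so a condition on E[Z | X = x] "for all x" is a
   condition on the values of some version. *)
Definition is_condexp {d' : measure_display} {T : measurableType d'}
    (X : Om -> T) (Z : Om -> R) (h : T -> R) : Prop :=
  [/\ measurable_fun [set: T] h,
      P.-integrable [set: Om] (EFin \o Z),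
      P.-integrable [set: Om] (EFin \o (h \o X)) &
      forall A, measurable A ->
        \int[P]_(w in X @^-1` A) (Z w)%:E = \int[P]_(w in X @^-1` A) (h (X w))%:E]%E.

(* v is a version of x |-> Var[Z | X = x]. *)
Definition is_condvar {d' : measure_display} {T : measurableType d'}
    (X : Om -> T) (Z : Om -> R) (v : T -> R) : Prop :=
  exists2 m : T -> R, is_condexp X Z m &
    is_condexp X (fun w => (Z w - m (X w)) ^+ 2) v.

(* E[Z | E] for an event E of positive probability. *)
Definition event_condexp (Z : Om -> R) (E : set Om) : R :=
  fine (\int[P]_(w in E) (Z w)%:E)%E / fine (P E).

Definition is_density {n : nat} (X : Om -> 'rV[R]_n) (f : 'rV[R]_n -> R) : Prop :=
  [/\ measurable_fun [set: 'rV[R]_n] f, (forall x, 0 <= f x)%R &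
      forall A, measurable A ->
        P (X @^-1` A) = \int[lebesgue_rV n]_(x in A) (f x)%:E]%E.

End probability_notions.

Section adaptive_kNN.
Context {R : realType} {d : nat}.
Variable nm : 'rV[R]_d -> R.

Definition ball_count (xs : nat -> 'rV[R]_d) (N : nat) (x : 'rV[R]_d) (A : R) : nat :=
  (\sum_(i < N) (xs i \in nball nm x A))%N.

Definition adaptive_k (K A q : R) (xs : nat -> 'rV[R]_d) (N : nat)
    (x : 'rV[R]_d) : nat :=
  (Num.truncn (K * (ball_count xs N x A)%:R `^ q)).+1.

(* The indices 0, ..., N-1 by increasing distance of the sample to x; the sort is
   stable, so ties are broken by the smallest index. *)
Definition nn_order (xs : nat -> 'rV[R]_d) (N : nat) (x : 'rV[R]_d) : seq nat :=
  sort (fun i j => nm (xs i - x) <= nm (xs j - x)) (iota 0 N).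

(* For fixed K and q < 1 one has adaptive_k <= N as soon as N is large; the
   default value 0 of nth is only reached for the finitely many other N. *)
Definition adaptive_knn (K A q : R) (xs : nat -> 'rV[R]_d) (ys : nat -> R)
    (N : nat) (x : 'rV[R]_d) : R :=
  let k := adaptive_k K A q xs N x in
  k%:R^-1 * \sum_(i < k) ys (nth 0%N (nn_order xs N x) i).

End adaptive_kNN.

Section risk.
Context {dO : measure_display} {Om : measurableType dO} {R : realType}.
Variables (P : probability Om R) (d : nat) (nm : 'rV[R]_d -> R).

Definition knn_risk (K A q : R) (X : Om -> 'rV[R]_d) (Y : Om -> R)
    (Xs : nat -> Om -> 'rV[R]_d) (Ys : nat -> Om -> R) (N : nat) : \bar R :=
  'E_P[fun w =>
    ((adaptive_knn nm K A q (Xs ^~ w) (Ys ^~ w) N (X w) - Y w) ^+ 2)%R]%E.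

Definition bayes_risk (eps : Om -> R) : \bar R := 'E_P[fun w => (eps w ^+ 2)%R]%E.

Definition excess_risk (K A q : R) (X : Om -> 'rV[R]_d) (Y eps : Om -> R)
    (Xs : nat -> Om -> 'rV[R]_d) (Ys : nat -> Om -> R) (N : nat) : \bar R :=
  (knn_risk K A q X Y Xs Ys N - bayes_risk eps)%E.

End risk.

Section conditions.
Context {dO : measure_display} {Om : measurableType dO} {R : realType}.
Variables (P : probability Om R) (d : nat) (nm : 'rV[R]_d -> R).
Variables (X : Om -> 'rV[R]_d) (Y : Om -> R).
Variables (f eta : 'rV[R]_d -> R) (beta : R).

Local Notation mass x r := (P (X @^-1` nball nm x r)).

Definition cond_variance : Prop :=
  exists Ca : R, exists2 v, is_condvar P X Y v & forall x, v x <= Ca.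

Definition cond_tail : Prop :=
  exists Cb : R, forall t : R, 0 < t ->
    (P [set w | (f (X w) <= t)%R] <= (Cb * t `^ beta)%:E)%E.

(* The support of the density is taken as the set where it is nonzero. *)
Definition cond_smooth : Prop :=
  exists Cc : R, forall (r : R) x, 0 < r -> f x != 0 ->
    `|event_condexp P Y (X @^-1` nball nm x r) - eta x| <= Cc * r ^+ 2.

Definition cond_mass : Prop :=
  exists2 Cd : R, 0 < Cd & exists2 D : R, 0 < D &
    forall x (r : R), 0 < r < D ->
      ((Cd * f x)%:E * lebesgue_rV d (nball nm x r) <= mass x r)%E.

Definition cond_bounded : Prop := exists M : R, forall x, `|eta x| <= M.

Definition cond_ratio_tail (A q : R) : Prop :=
  exists Cb' : R, forall t : R, 0 < t ->
    (P [set w | (f (X w) / fine (mass (X w) A) `^ q < t `^ (1 - q))%R]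
       <= (Cb' * t `^ beta)%:E)%E.

End conditions.

Section rates.
Context {R : realType}.

Definition knn_lambda (d : nat) (q : R) : R :=
  Num.min (2^-1 * q) (2 / d%:R * (1 - q)).

Definition knn_rate (d : nat) (beta q : R) (N : nat) : R :=
  if beta == 2 * knn_lambda d q then N%:R `^ (- beta) * ln N%:R
  else N%:R `^ (- Num.min beta (2 * knn_lambda d q)).

Definition optimal_q (d : nat) : R := 4 / (d%:R + 4).

(* Finiteness is part of the claim, since fine maps infinite values to 0. *)
Definition eventually_bigO (u : nat -> \bar R) (v : nat -> R) : Prop :=
  (\forall N \near \oo, u N \is a fin_num) /\
  (fine \o u : nat -> R^o) =O_\oo (v : nat -> R^o).

End rates.

(* Main.v *)
(** For a fixed test point x put e(x) = E[(g(x) - eta(x))^2]. Given the (k+1)-st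
    neighbour of x, at distance rho, the k nearest samples are independent draws
    from the ball of radius rho. Centred at the mean of Y over that ball, their
    responses are orthogonal, so that e(x) is bounded by O(E[1/k]) plus the squared
    bias O(rho^4). With p = P(B(x, A)), Chebyshev's inequality shows that k is of
    order (Np)^q and that rho is at most r0 with r0^d of order (Np)^q / (N f(x)),
    up to an event of probability O((Np)^(-q)). This gives
    e(x) = O((N f(x))^(-q) + (N^(1-q) f(x) / p^q)^(-4/d)), and also e(x) = O(1).
    The two terms are integrated over x by a dyadic decomposition, using the tail
    conditions on f(X) and on f(X) / P^q(B(X, A)) respectively. *)

Require Import Defs.
From HB Require Import structures.
From mathcomp Require Import all_boot all_order all_algebra.
From mathcomp Require Import all_classical all_reals all_analysis.
From mathcomp Require Import measurable_realfun ring lra.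
Set Implicit Arguments.
Unset Strict Implicit.
Unset Printing Implicit Defensive.
Import Order.TTheory GRing.Theory Num.Theory.
Import numFieldNormedType.Exports.
Local Open Scope classical_set_scope.
Local Open Scope ring_scope.

(** * Integrals with weights *)

(** No conditional law is constructed. Conditioning on the (k+1)-st neighbour becomes a sum over all
    indices j of the indicator [hit] that j is this neighbour, and independence enters by redrawing
    one observation at a time. The obstacle is that k is random. It depends on the sample only
    through the number of points in B(x, A), however; if l precedes some j at distance at most r0 <=
    A, then l lies in B(x, A), wherever it is redrawn subject to that. So k and the rank of j do not
    move, and two centred responses are orthogonal. Centring at the ball mean, not at eta(x), is
    forced by condition (c), which controls ball means only. Ties are broken by the index instead of
    being discarded as a null event, so that open and closed balls occur side by side. Chebyshev's
    inequality is strong enough because 1/(Np) <= (Np)^(-q) when Np >= 1 and q < 1. Since p is at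
    least a multiple of f(x), the variance decays with exponent q in N f(x); the squared bias has
    exponent 4(1-q)/d once its argument is raised to the power 1/(1-q). The smaller of the two
    exponents is 2 lambda. *)

Section measure_theory.
Context {R : realType}.

Lemma measurable_fun_countable (d1 d2 : measure_display) (T1 : measurableType d1)
    (T2 : measurableType d2) (C : countType) (c : T1 -> C) (h : C -> T2) :
  (forall a, measurable [set t | c t = a]) -> measurable_fun [set: T1] (h \o c).
Proof.
move=> mc _ B _; rewrite setTI.
rewrite (_ : _ @^-1` _ = \bigcup_(a in [set a | B (h a)]) [set t | c t = a]).
  by rewrite bigcup_mkcond; apply: countable_bigcupT_measurable => [|a];
    [exact: countableP|case: ifP].
by apply/seteqP; split => [t Bt|t [a Ba /= ca]]; [exists (c t)|rewrite /= ca].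
Qed.

Section domination.
Import HBNNSimple.
Context {dO dT : measure_display} {Om : measurableType dO} {T : measurableType dT}.
Variables (mu : {measure set Om -> \bar R}) (X : Om -> T).
Hypothesis mX : measurable_fun [set: Om] X.
Local Open Scope ereal_scope.

Let mE (V : Om -> R) : measurable_fun setT V -> measurable_fun setT (EFin \o V).
Proof. by move=> mV; apply/measurable_EFinP. Qed.

Let meas_comp (h : T -> \bar R) : measurable_fun setT h ->
  measurable_fun setT (h \o X).
Proof. by move=> mh; exact: measurableT_comp. Qed.

Let integral_approx (U : Om -> R) (h : T -> \bar R)
    (mh : measurable_fun setT h) (h0 : forall x, 0 <= h x) :
  measurable_fun setT U -> (forall w, (0 <= U w)%R) ->
  \int[mu]_w (h (X w) * (U w)%:E) =
  limn (fun n => \int[mu]_w ((nnsfun_approx measurableT mh n (X w))%:E * (U w)%:E)).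
Proof.
move=> mU U0; rewrite -monotone_convergence//=.
- apply: eq_integral => w _; apply/esym/cvg_lim => //.
  apply: cvgeZr => //.
  exact: (@cvg_nnsfun_approx _ _ _ _ measurableT _ mh).
- move=> n; apply: emeasurable_funM; last exact: mE.
  apply: (meas_comp (h := EFin \o nnsfun_approx measurableT mh n)).
  exact/measurable_EFinP.
- by move=> n w _; rewrite mule_ge0// lee_fin.
- move=> w _ m n mn; apply: lee_wpmul2r; first by rewrite lee_fin.
  by rewrite lee_fin; have /lefP := nd_nnsfun_approx measurableT mh mn; exact.
Qed.

Let integral_sfun (U : Om -> R) (s : {nnsfun T >-> R}) :
  measurable_fun setT U -> (forall w, (0 <= U w)%R) ->
  \int[mu]_w ((s (X w))%:E * (U w)%:E) =
  \sum_(y \in range s) (y%:E * \int[mu]_(w in X @^-1` (s @^-1` [set y])) (U w)%:E).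
Proof.
move=> mU U0.
have ms y : measurable (X @^-1` (s @^-1` [set y])).
  by rewrite -[X in measurable X]setTI; exact: mX.
have m1 y : measurable_fun setT (fun w => (\1_(s @^-1` [set y]) (X w))%:E : \bar R).
  apply: (meas_comp (h := fun x => (\1_(s @^-1` [set y]) x)%:E)).
  exact/measurable_EFinP/measurable_indic.
transitivity (\int[mu]_w
    \sum_(y \in range s) (y%:E * ((\1_(s @^-1` [set y]) (X w))%:E * (U w)%:E))).
  apply: eq_integral => w _; rewrite (fimfunE s (X w)).
  rewrite -fsumEFin// ge0_mule_fsuml.
    apply: eq_fsbigr => y ys; rewrite EFinM muleA//.
  move=> y; rewrite EFinM /indic /=.
  case: (boolP (X w \in s @^-1` [set y])) => /=.
    by rewrite inE/= => <-; rewrite mule1 lee_fin.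
  by rewrite mule0.
rewrite ge0_integral_fsum//=; first last.
- move=> y w _; rewrite /indic.
  case: (boolP (X w \in s @^-1` [set y])) => /=.
    by rewrite inE/= => <-; rewrite mul1e mule_ge0// lee_fin.
  by rewrite mul0e mule0.
- by move=> y; apply: emeasurable_funM => //; apply: emeasurable_funM => //; exact: mE.
apply: eq_fsbigr => y /set_mem[x _ <-].
rewrite ge0_integralZl//=; first last.
- by rewrite lee_fin.
- by move=> w _; rewrite mule_ge0// lee_fin.
- by apply: emeasurable_funM => //; exact: mE.
congr (_ * _).
rewrite [RHS]integral_mkcond; apply: eq_integral => w _.
rewrite patchE /indic /=.
rewrite [w \in _](_ : _ = (X w \in s @^-1` [set s x])).
  by case: ifP => _; rewrite ?mul1e ?mul0e.
by apply/idP/idP; rewrite !inE.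
Qed.

(** The hypothesis on events of X is an inequality between conditional means given X in integrated
    form. It holds for indicator weights, hence for simple functions of X, and monotone convergence
    along [nnsfun_approx] extends it to every nonnegative weight. *)
Lemma ge0_le_integral_weight (U W : Om -> R) (h : T -> \bar R) :
  measurable_fun setT U -> (forall w, (0 <= U w)%R) ->
  measurable_fun setT W -> (forall w, (0 <= W w)%R) ->
  (forall A, measurable A ->
    \int[mu]_(w in X @^-1` A) (U w)%:E <= \int[mu]_(w in X @^-1` A) (W w)%:E) ->
  measurable_fun setT h -> (forall x, 0 <= h x) ->
  \int[mu]_w (h (X w) * (U w)%:E) <= \int[mu]_w (h (X w) * (W w)%:E).
Proof.
move=> mU U0 mW W0 UW mh h0; rewrite !(integral_approx mh h0)//.
have nd (V : Om -> R) : measurable_fun setT V -> (forall w, (0 <= V w)%R) ->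
    cvgn (fun n => \int[mu]_w ((nnsfun_approx measurableT mh n (X w))%:E * (V w)%:E)).
  move=> mV V0; apply: ereal_nondecreasing_is_cvgn => m n mn.
  have mf k : measurable_fun setT (fun w => (nnsfun_approx measurableT mh k (X w))%:E * (V w)%:E).
    apply: emeasurable_funM; last exact: mE.
    apply: (meas_comp (h := EFin \o nnsfun_approx measurableT mh k)).
    exact/measurable_EFinP.
  apply: ge0_le_integral => //.
  - by move=> w _; rewrite mule_ge0// lee_fin.
  - move=> w _ /=; apply: lee_wpmul2r; first by rewrite lee_fin.
    by rewrite lee_fin; have /lefP := nd_nnsfun_approx measurableT mh mn; exact.
apply: lee_lim; [exact: nd|exact: nd|].
apply: nearW => n; rewrite !integral_sfun//.
apply: lee_fsum => // y /= [x _ <-].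
apply: lee_wpmul2l; first by rewrite lee_fin.
exact: UW.
Qed.

Lemma integral_weight (U W : Om -> R) (h : T -> \bar R) :
  measurable_fun setT U -> (forall w, (0 <= U w)%R) ->
  measurable_fun setT W -> (forall w, (0 <= W w)%R) ->
  (forall A, measurable A ->
    \int[mu]_(w in X @^-1` A) (U w)%:E = \int[mu]_(w in X @^-1` A) (W w)%:E) ->
  measurable_fun setT h -> (forall x, 0 <= h x) ->
  \int[mu]_w (h (X w) * (U w)%:E) = \int[mu]_w (h (X w) * (W w)%:E).
Proof.
move=> mU U0 mW W0 UW mh h0; apply/le_anti/andP; split;
  by apply: ge0_le_integral_weight => // A mA; rewrite UW.
Qed.

End domination.
End measure_theory.

(** * Independence *)

Section rows.
Context {d : measure_display} {T : measurableType d} (n : nat).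

Definition row_boxes : set (set 'rV[T]_n) :=
  [set C | exists2 B : 'I_n -> set T, (forall i, measurable (B i)) &
           C = [set v : 'rV[T]_n | forall i, B i (v ord0 i)]].

Lemma setI_closed_row_boxes : setI_closed row_boxes.
Proof.
move=> _ _ [B mB ->] [C mC ->]; exists (fun i => B i `&` C i).
  by move=> i; exact: measurableI.
apply/seteqP; split => [v [Bv Cv] i|v BCv]; first by split.
by split=> i; have [] := BCv i.
Qed.

Lemma measurable_row_box (B : 'I_n -> set T) : (forall i, measurable (B i)) ->
  measurable [set v : 'rV[T]_n | forall i, B i (v ord0 i)].
Proof.
move=> mB; rewrite (_ : mkset _ = \bigcap_(i in [set: 'I_n])
    ((fun v : 'rV[T]_n => v ord0 i) @^-1` B i)).
  apply: fin_bigcap_measurable => // i _.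
  by rewrite -[X in measurable X]setTI; exact: measurable_coor.
by apply/seteqP; split => [v Bv i _|v Bv i]; exact: Bv.
Qed.

Lemma measurable_row_boxes : @measurable _ 'rV[T]_n = <<s row_boxes >>.
Proof.
apply/seteqP; split.
  apply: smallest_sub; first exact: smallest_sigma_algebra.
  move=> C; rewrite -bigcup_seq => -[i /= _ [B mB <-]]; rewrite setTI.
  apply: sub_gen_smallest; exists (fun j => if j == i then B else setT).
    by move=> j; case: ifP.
  apply/seteqP; split => [v /= Bv j|v /= /(_ i)]; first by case: eqP => [->|].
  by rewrite eqxx.
apply: smallest_sub; first exact: (@sigma_algebra_measurable _ 'rV[T]_n).
by move=> _ [B mB ->]; exact: measurable_row_box.
Qed.

End rows.

Section independence.
Context {dO : measure_display} {Om : measurableType dO} {R : realType}.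
Variable P : probability Om R.

Definition indep_pair {d1 d2 : measure_display} {T1 : measurableType d1}
    {T2 : measurableType d2} (V : Om -> T1) (U : Om -> T2) : Prop :=
  forall A C, measurable A -> measurable C ->
    P (V @^-1` A `&` U @^-1` C) = (P (V @^-1` A) * P (U @^-1` C))%E.

(** For fixed A both sides are finite measures of the event on D: the law of D restricted to V in A,
    and the law of D scaled by the probability of V in A. They agree on boxes, a pi-system that
    generates the sigma-algebra of rows. *)
Lemma indep_pair_row (d1 d2 : measure_display) (T1 : measurableType d1)
    (T2 : measurableType d2) n (V : Om -> T1) (D : Om -> 'rV[T2]_n) :
  measurable_fun [set: Om] V -> measurable_fun [set: Om] D ->
  (forall A (B : 'I_n -> set T2), measurable A -> (forall i, measurable (B i)) ->
    P (V @^-1` A `&` D @^-1` [set v : 'rV[T2]_n | forall i, B i (v ord0 i)]) =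
    (P (V @^-1` A) * P (D @^-1` [set v : 'rV[T2]_n | forall i, B i (v ord0 i)]))%E) ->
  indep_pair V D.
Proof.
move=> mV mD VD A C mA mC.
have mVA : measurable (V @^-1` A) by rewrite -[X in measurable X]setTI; exact: mV.
pose m1 := measure_function_pushforward__canonical__measure_function_Measure
  (mrestr P mVA) mD.
have a0 : 0 <= fine (P (V @^-1` A)) by rewrite fine_ge0.
pose m2 := mscale (NngNum a0)
  (measure_function_pushforward__canonical__measure_function_Measure P mD).
have m2E S : m2 S = (P (V @^-1` A) * P (D @^-1` S))%E.
  rewrite /m2 /mscale /= fineK ?fin_num_measure//.
rewrite -m2E setIC.
apply: (@measure_unique _ _ _ (@row_boxes _ T2 n) (fun=> setT) _ _ _ _ m1 m2) => //.
- exact: measurable_row_boxes.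
- exact: setI_closed_row_boxes.
- by move=> _; exists (fun=> setT) => //; apply/seteqP; split.
- by apply/seteqP; split => // x _; exists 0%N.
- by move=> S [B mB ->]; rewrite [RHS]m2E -VD// setIC.
- move=> _; apply: (@le_lt_trans _ _ (P setT)); last by rewrite probability_setT ltry.
  by apply: le_measure; rewrite ?inE// preimage_setT setTI.
Qed.

Section pair.
Context {d1 d2 : measure_display} {T1 : measurableType d1} {T2 : measurableType d2}.
Variables (V : Om -> T1) (U : Om -> T2).
Hypotheses (mV : measurable_fun [set: Om] V) (mU : measurable_fun [set: Om] U).
Hypothesis VU : indep_pair V U.

Let rV : {RV P >-> T1} := HB.pack V (isMeasurableFun.Build _ _ _ _ V mV).
Let rU : {RV P >-> T2} := HB.pack U (isMeasurableFun.Build _ _ _ _ U mU).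
Let mUV : measurable_fun [set: Om] (fun w => (U w, V w)).
Proof. exact: measurable_fun_pair. Qed.

Let lawUV : {measure set (T2 * T1) -> \bar R} :=
  measure_function_pushforward__canonical__measure_function_Measure P mUV.

Let lawUV_E (f : T2 * T1 -> \bar R) :
  (\int[lawUV]_z f z = \int[distribution P rU \x distribution P rV]_z f z)%E.
Proof.
apply: eq_measure_integral => A mA _; apply/esym.
apply: product_measure_unique => // B C mB mC.
rewrite muleC; apply: etrans (VU mC mB); rewrite /lawUV /= /pushforward.
by rewrite setIC.
Qed.

Local Open Scope ereal_scope.

(** Tonelli's theorem for the joint law, which independence makes a product. The inner integral runs
    over a second point w' of the same sample space, so redrawing V requires no larger space. *)
Lemma ge0_integral_indep_pair (phi : T2 * T1 -> \bar R) :
  measurable_fun setT phi -> (forall z, 0 <= phi z) ->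
  \int[P]_w phi (U w, V w) = \int[P]_w \int[P]_w' phi (U w, V w').
Proof.
move=> mphi phi0.
transitivity (\int[lawUV]_z phi z); first by rewrite ge0_integral_pushforward.
rewrite lawUV_E fubini_tonelli1//.
rewrite (@ge0_integral_distribution _ _ _ _ _ P rU)//=; first last.
- by move=> u; exact: integral_ge0.
- exact: measurable_fun_fubini_tonelli_F.
apply: eq_integral => w _; rewrite /fubini_F.
rewrite (@ge0_integral_distribution _ _ _ _ _ P rV)//=.
exact: measurableT_comp mphi (measurable_pair1 _).
Qed.

Lemma integral_indep_pair (phi : T2 * T1 -> \bar R) :
  measurable_fun setT phi -> P.-integrable setT (fun w => phi (U w, V w)) ->
  (forall u, P.-integrable setT (fun w => phi (u, V w))) ->
  \int[P]_w phi (U w, V w) = \int[P]_w \int[P]_w' phi (U w, V w').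
Proof.
move=> mphi iphi iphi1.
have iphi2 : (distribution P rU \x distribution P rV).-integrable setT phi.
  apply/integrableP; split => //; rewrite -lawUV_E ge0_integral_pushforward//=.
    by have /integrableP[] := iphi.
  exact: measurableT_comp.
transitivity (\int[lawUV]_z phi z); first by rewrite integral_pushforward.
rewrite lawUV_E -integral12_prod_meas1//.
rewrite (@integral_distribution _ _ _ _ _ P rU)//=; first last.
- have : (distribution P rU).-integrable setT (fubini_F (distribution P rV) phi).
    exact: integrable_fubini_F.
  move=> /integrableP[mG]; rewrite ge0_integral_distribution//=; last first.
    exact: measurableT_comp.
  by move=> ?; apply/integrableP; split => //; exact: measurableT_comp.
- exact: (measurable_fubini_F iphi2).
apply: eq_integral => w _; rewrite /fubini_F /=.
rewrite (@integral_distribution _ _ _ _ _ P rV)//=.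
  exact: measurableT_comp mphi (measurable_pair1 _).
exact: iphi1.
Qed.

End pair.
End independence.

(** * Norms and balls *)

Section norms.
Context {R : realType} {d : nat}.
Variable nm : 'rV[R]_d -> R.
Hypothesis nm_norm : is_norm nm.

Let nmD x y : nm (x + y) <= nm x + nm y.
Proof. exact: is_norm_triangle. Qed.

Let nmZ a x : nm (a *: x) = `|a| * nm x.
Proof. exact: is_norm_homogeneous. Qed.

Lemma is_norm0 : nm 0 = 0.
Proof. by rewrite -(scale0r (0 : 'rV[R]_d)) nmZ normr0 mul0r. Qed.

Lemma is_norm_ge0 x : 0 <= nm x.
Proof.
have := nmD x (- x); rewrite subrr is_norm0 -scaleN1r nmZ normrN1 mul1r.
by rewrite -mulr2n pmulrn_lge0.
Qed.

Lemma is_normB x y : nm x <= nm y + nm (x - y).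
Proof. by rewrite -{1}(subrK y x) addrC; exact: nmD. Qed.

(* The summand 1 only ensures positivity. *)
Definition norm_box_const : R := 1 + \sum_(i < d) nm (delta_mx ord0 i).

Lemma norm_box_const_gt0 : 0 < norm_box_const.
Proof. by rewrite ltr_pwDl// sumr_ge0// => i _; exact: is_norm_ge0. Qed.

Lemma is_norm_le_box (u : 'rV[R]_d) s : 0 <= s ->
  (forall i, `|u ord0 i| <= s) -> nm u <= norm_box_const * s.
Proof.
move=> s0 us; rewrite {1}(row_sum_delta u).
apply: (@le_trans _ _ (\sum_(i < d) nm (delta_mx ord0 i) * s)).
  elim/big_ind2 : _ => [|x1 x2 y1 y2 x12 y12|i _].
  - by rewrite is_norm0.
  - by apply: le_trans (nmD _ _) _; exact: lerD.
  - by rewrite nmZ mulrC ler_wpM2l// is_norm_ge0.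
by rewrite -mulr_suml ler_wpM2r// lerDr.
Qed.

(** The set where nm < r is a countable union of rational cubes: those whose centre p and half-side
    s satisfy nm p + C s < r. By [is_norm_le_box] they stay inside the set, and by density they
    cover it. *)
Lemma measurable_is_norm : measurable_fun [set: 'rV[R]_d] nm.
Proof.
apply: (measurability _ (RGenInftyO.measurableE R)) => //.
move=> _ [_ [r ->] <-]; rewrite setTI.
pose C := norm_box_const.
pose box (p : 'rV[rat]_d * rat) := [set u : 'rV[R]_d | forall i,
  [set t : R | `|t - ratr (p.1 ord0 i)| < ratr p.2] (u ord0 i)].
rewrite (_ : _ @^-1` _ = \bigcup_(p in [set p : 'rV[rat]_d * rat |
    0 < p.2 /\ nm (map_mx ratr p.1) + C * ratr p.2 < r]) box p).
  rewrite bigcup_mkcond; apply: countable_bigcupT_measurable => [|p].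
    exact: countableP.
  case: ifP => // _; apply: (measurable_row_box (B := fun i =>
    [set t : R | `|t - ratr (p.1 ord0 i)| < ratr p.2])) => i.
  rewrite (_ : mkset _ = ball (ratr (p.1 ord0 i) : R) (ratr p.2)).
    exact: measurable_ball.
  by apply/seteqP; split => t /=; rewrite /ball /= distrC.
have C0 : 0 < C := norm_box_const_gt0.
apply/seteqP; split => [u /= |u [[p s] /= [s0 ps] ups]].
  rewrite in_itv /= => ur.
  (* Half of the slack pays for moving from u to a rational centre, half for the extent of the cube
     around it. *)
  have e0 : 0 < (r - nm u) / (2 * C) by rewrite divr_gt0 ?subr_gt0// mulr_gt0.
  have [s] := rat_in_itvoo e0; rewrite in_itv/= => /andP[s0 se].
  have /choice[p pE] i : exists p : rat, `|u ord0 i - ratr p| < ratr s.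
    have : u ord0 i - ratr s < u ord0 i + ratr s by lra.
    move=> /rat_in_itvoo[p]; rewrite in_itv/= => /andP[p1 p2]; exists p.
    by rewrite ltr_distlC p1 p2.
  exists (\row_i p i, s) => /=; last by move=> i /=; rewrite mxE; exact: pE.
  split; first by rewrite -(@ltr_rat R) rmorph0.
  have : nm (map_mx ratr (\row_i p i)) <= nm u + C * ratr s.
    apply: le_trans (is_normB _ u) _; rewrite lerD2l.
    apply: is_norm_le_box; first exact: ltW.
    by move=> i; rewrite !mxE distrC ltW.
  have : 2 * C * ratr s < r - nm u by rewrite mulrC -ltr_pdivlMr// mulr_gt0.
  by lra.
rewrite in_itv/=; apply: le_lt_trans ps.
apply: le_trans (is_normB _ (map_mx ratr p)) _; rewrite lerD2l.
apply: is_norm_le_box; first by rewrite ler0q ltW.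
by move=> i; rewrite !mxE; exact/ltW/ups.
Qed.

Lemma measurable_fun_dist (dT : measure_display) (T : measurableType dT)
    (u v : T -> 'rV[R]_d) : measurable_fun setT u -> measurable_fun setT v ->
  measurable_fun setT (fun t => nm (u t - v t)).
Proof.
move=> mu mv; apply: (measurableT_comp measurable_is_norm).
apply: measurable_fun_rV => i; under eq_fun do rewrite !mxE.
by apply: measurable_funB; apply: (measurableT_comp (measurable_coor i)).
Qed.

Lemma measurable_nball x r : measurable (nball nm x r).
Proof.
have mnx : measurable_fun [set: 'rV[R]_d] (fun u => nm (u - x)).
  by apply: (measurable_fun_dist (u := id)); [exact: measurable_id|exact: measurable_cst].
have := measurable_fun_le measurableT mnx (measurable_cst (D := setT) r).
by rewrite setTI.
Qed.

(** The ball contains the cube of half-side r / [norm_box_const]. Volumes enter the rate only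
    through condition (d), as a lower bound of order r^d. *)
Lemma lebesgue_nball_ge x r : 0 < r ->
  (((2 * (r / norm_box_const)) ^+ d)%:E <= lebesgue_rV d (nball nm x r))%E.
Proof.
move=> r0; set s := r / _.
have s0 : 0 < s by rewrite divr_gt0// norm_box_const_gt0.
pose I i := `[x ord0 i - s, x ord0 i + s]%classic.
have mI i : measurable (I i) by exact: measurable_itv.
apply: (@le_trans _ _ (lebesgue_rV d [set v | forall i, I i (v ord0 i)])).
  rewrite lebesgue_rV_box//.
  rewrite (eq_bigr (fun=> (2 * s)%:E)).
    by rewrite prodEFin prodr_const card_ord.
  move=> i _; rewrite lebesgue_measure_itv/= lte_fin.
  rewrite ifT; last by lra.
  by rewrite -EFinB; congr EFin; ring.
apply: le_measure; rewrite ?inE.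
- exact: measurable_row_box.
- exact: measurable_nball.
- move=> v /= Iv; rewrite /nball /=.
  rewrite [leRHS](_ : r = norm_box_const * s).
    apply: is_norm_le_box; first exact: ltW.
    by move=> i; have := Iv i; rewrite /I /= in_itv/= !mxE ler_distl.
  by rewrite /s mulrC divfK// gt_eqF// norm_box_const_gt0.
Qed.

End norms.

(** * Neighbour ranks *)

Section ranks.
Context {R : realType}.

(* Ties are broken by the index, as in the stable sort of [nn_order]. *)
Definition before (a b : R) (i j : nat) : bool :=
  (a <= b) && ((b <= a) ==> (i < j)%N).

Lemma before_irr a i : before a a i i = false.
Proof. by rewrite /before lexx/= ltnn. Qed.

Lemma before_le a b i j : before a b i j -> a <= b.
Proof. by case/andP. Qed.

Lemma before_lt a b i j : a < b -> before a b i j.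
Proof. by move=> ab; rewrite /before ltW//= leNgt ab. Qed.

Lemma before_trans (a b c : R) i j k :
  before a b i j -> before b c j k -> before a c i k.
Proof.
rewrite /before => /andP[ab /implyP ij] /andP[bc /implyP jk].
rewrite (le_trans ab bc)/=; apply/implyP => ca.
by apply: (ltn_trans (ij _) (jk _)); [exact: le_trans ca|exact: le_trans ab].
Qed.

(** Ranks start at 0: [nrank delta j = k] makes j the (k+1)-st neighbour, the first one left out of
    the average over k. *)
Definition nrank N (delta : 'I_N -> R) (j : 'I_N) : nat :=
  (\sum_(i < N) before (delta i) (delta j) i j)%N.

Section sort.
Variables (N : nat) (delta : nat -> R).
Let s := sort (fun i j => delta i <= delta j) (iota 0 N).

Let rk (j : nat) : nat := count (fun i => before (delta i) (delta j) i j) s.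

Let size_s : size s = N. Proof. by rewrite size_sort size_iota. Qed.

Let s_perm : perm_eq s (iota 0 N). Proof. by rewrite perm_sort. Qed.

Let s_sorted : sorted (fun i j => before (delta i) (delta j) i j) s.
Proof.
apply: (@sort_stable _ (fun i j => delta i <= delta j) ltn).
- by move=> i j; exact: le_total.
- exact: ltn_trans.
- exact: iota_ltn_sorted.
Qed.

(** The sorted list is strictly increasing for the total order [before], so the entry at place i is
    preceded by the i entries on its left and by none on its right. *)
Let rk_nth i : (i < N)%N -> rk (nth 0%N s i) = i.
Proof.
move=> iN.
have tr : transitive (fun i j => before (delta i) (delta j) i j).
  by move=> j1 j2 j3; exact: before_trans.
have srt a b : (a < b)%N -> (b < N)%N ->
    before (delta (nth 0%N s a)) (delta (nth 0%N s b)) (nth 0%N s a) (nth 0%N s b).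
  move=> ab bN; apply: (sorted_ltn_nth tr 0%N s_sorted) => //; rewrite inE size_s//.
  exact: ltn_trans bN.
rewrite /rk -[X in count _ X](cat_take_drop i) count_cat.
rewrite (_ : count _ (take i s) = i); last first.
  rewrite -[RHS](_ : size (take i s) = i); last by rewrite size_take size_s iN.
  apply/eqP; rewrite -all_count; apply/(all_nthP 0%N) => a.
  by rewrite size_take size_s iN => ai; rewrite nth_take//; exact: srt.
rewrite (_ : count _ _ = 0%N) ?addn0//.
apply/eqP; rewrite eqn0Ngt -has_count; apply/negP => /(has_nthP 0%N)[a].
rewrite size_drop size_s nth_drop => aN bef.
have [a0|a0] := posnP a; first by move: bef; rewrite a0 addn0 before_irr.
have := srt i (i + a)%N; rewrite -{1}[i]addn0 ltn_add2l => /(_ a0).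
rewrite -ltn_subRL => /(_ aN) bef'.
by have := before_trans bef' bef; rewrite before_irr.
Qed.

Let rkE (j : 'I_N) : rk j = nrank (fun i : 'I_N => delta i) j.
Proof.
rewrite /rk /nrank (permP s_perm) -sum1_count big_mkcond/=.
rewrite -[N in iota 0 N]subn0 -/(index_iota 0 N) big_mkord.
by apply: eq_bigr => i _; case: before.
Qed.

(** Replaces positions in the sorted list by rank indicators of the individual samples: a sum over a
    fixed index set is what redrawing a single sample requires. *)
Lemma sum_nearest k (F : nat -> R) : (k <= N)%N ->
  \sum_(i < k) F (nth 0%N s i) =
  \sum_(l < N) (nrank (fun i : 'I_N => delta i) l < k)%N%:R * F l.
Proof.
move=> kN.
transitivity (\sum_(l <- s) (rk l < k)%N%:R * F l).
  rewrite (big_nth 0%N) size_s big_mkord (big_ord_widen N (fun i => F (nth 0%N s i)))//.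
  rewrite big_mkcond; apply: eq_bigr => i _; rewrite rk_nth//.
  by case: ifP => _; rewrite ?mul1r ?mul0r.
rewrite (perm_big _ s_perm)/= -[N in iota 0 N]subn0 -/(index_iota 0 N) big_mkord.
by apply: eq_bigr => i _; rewrite rkE.
Qed.

Lemma nrank_ex k : (k < N)%N ->
  exists j : 'I_N, nrank (fun i : 'I_N => delta i) j = k.
Proof.
move=> kN; have jN : (nth 0%N s k < N)%N.
  have : nth 0%N s k \in s by rewrite mem_nth// size_s.
  by rewrite (perm_mem s_perm) mem_iota.
by exists (Ordinal jN); rewrite -rkE/= rk_nth.
Qed.

End sort.

Lemma card_nrank_lt N (delta : 'I_N -> R) k : (k <= N)%N ->
  \sum_(l < N) (nrank delta l < k)%N%:R = k%:R :> R.
Proof.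
move=> kN; pose dl n := if insub n is Some i then delta i else 0.
have dlE : delta = (fun i : 'I_N => dl i) by apply/funext => i; rewrite /dl valK.
have := @sum_nearest N dl k (fun=> 1) kN; rewrite -dlE.
rewrite sumr_const card_ord => ->.
by apply: eq_bigr => i _; rewrite mulr1.
Qed.

Lemma nrank_exists N (delta : 'I_N -> R) k : (k < N)%N ->
  exists j, nrank delta j = k.
Proof.
move=> kN; pose dl n := if insub n is Some i then delta i else 0.
have dlE : delta = (fun i : 'I_N => dl i) by apply/funext => i; rewrite /dl valK.
by have := nrank_ex dl kN; rewrite -dlE.
Qed.

End ranks.

(** * Ranks and numbers of samples within a radius *)

Section rank_combinatorics.
Context {R : realType} (N : nat).
Implicit Types (delta : 'I_N -> R) (r : R).

Definition count_within delta r : nat := (\sum_(i < N) (delta i <= r)%R)%N.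

(** For fixed j this shows that l precedes j exactly when its position lies in a ball around the
    test point, closed if l < j and open otherwise. *)
Lemma beforeE (a b : R) i j : before a b i j = (a < b ?<= if (i < j)%N).
Proof.
rewrite /before /Order.lteif; case: ifP => _; first by rewrite implybT andbT.
by rewrite implybF -ltNge lt_def; case: (ltgtP a b).
Qed.

Lemma nrank_lt delta l j :
  (nrank delta l < nrank delta j)%N = before (delta l) (delta j) l j.
Proof.
have sub i' j' : before (delta i') (delta j') i' j' ->
    (nrank delta i' < nrank delta j')%N.
  move=> bij; rewrite /nrank (bigD1 i')//= [in ltnRHS](bigD1 i')//= before_irr bij.
  rewrite add0n add1n ltnS; apply: leq_sum => i _.
  by case: (boolP (before (delta i) (delta i') i i')) => // /before_trans /(_ bij) ->.
apply/idP/idP => [|/sub//]; apply: contraTT => nb; rewrite -leqNgt.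
have [<-//|lj] := eqVneq l j.
apply/ltnW/sub; move: nb; rewrite !beforeE /Order.lteif.
case: (ltngtP l j) => [ljn|jln|ljn]; last by rewrite (val_inj ljn) eqxx in lj.
- by rewrite -ltNge.
- by rewrite -leNgt.
Qed.

Lemma nrank_inj delta : injective (nrank delta).
Proof.
move=> i j ij; apply/eqP; apply: contraT => nij.
have := nrank_lt delta i j; have := nrank_lt delta j i.
rewrite ij ltnn !beforeE /Order.lteif.
case: (ltngtP i j) => [ijn|jin|ijn]; last by rewrite (val_inj ijn) eqxx in nij.
- by move=> /esym/negbT; rewrite -leNgt => ->.
- by move=> + /esym/negbT; rewrite -leNgt => + ji; rewrite ji.
Qed.

Lemma count_within_le delta r : (count_within delta r <= N)%N.
Proof.
rewrite -[leqRHS]card_ord -sum1_card; apply: leq_sum => i _.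
by case: (_ <= _).
Qed.

(** Were the sample of rank k farther than r, every sample within r would precede it, and there
    would be at most k of them. *)
Lemma nrank_count_within delta r k : (k < count_within delta r)%N ->
  exists2 j, nrank delta j = k & delta j <= r.
Proof.
move=> kr; have kN := leq_trans kr (count_within_le delta r).
have [j jk] := nrank_exists delta kN; exists j => //.
rewrite leNgt; apply/negP => rj; move: kr; rewrite -jk ltnNge.
move=> /negP; apply; apply: leq_sum => i _.
by case: (leP (delta i) r) => // ir; rewrite before_lt// (le_lt_trans ir).
Qed.

Lemma sum_before delta j :
  \sum_(l < N) (before (delta l) (delta j) l j)%:R = (nrank delta j)%:R :> R.
Proof. by rewrite /nrank natr_sum. Qed.

Section measurability.
Context {dS : measure_display} {S : measurableType dS}.
Variable delta : 'I_N -> S -> R.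
Hypothesis mdelta : forall i, measurable_fun [set: S] (delta i).

Lemma measurable_fun_natr_bool (b : S -> bool) : measurable_fun [set: S] b ->
  measurable_fun [set: S] (fun s => (b s)%:R : R).
Proof.
move=> mb; rewrite (_ : (fun s => _) = \1_[set s | b s]).
  apply: measurable_indic; rewrite -[X in measurable X]setTI.
  exact: (mb measurableT [set true]).
by apply/funext => s; rewrite /indic /=; case: (boolP (b s)) => bs;
  [rewrite mem_set|rewrite memNset//; exact/negP].
Qed.

Lemma measurable_count_eq (b : 'I_N -> S -> bool) (n : nat) :
  (forall i, measurable_fun [set: S] (b i)) ->
  measurable [set s | (\sum_(i < N) b i s)%N = n].
Proof.
move=> mb; have mg : measurable_fun [set: S] (fun s => \sum_(i < N) (b i s)%:R : R).
  by apply: measurable_sum => i; exact: measurable_fun_natr_bool.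
have := mg measurableT [set n%:R] (measurable_set1 _); rewrite setTI.
rewrite (_ : _ @^-1` _ = [set s | (\sum_(i < N) b i s)%N = n])//.
apply/seteqP; split => s /=; rewrite -natr_sum; first by move/eqP; rewrite eqr_nat => /eqP.
by move=> ->.
Qed.

Lemma measurable_before l j :
  measurable_fun [set: S] (fun s => before (delta l s) (delta j s) l j).
Proof.
under eq_fun do rewrite beforeE /Order.lteif.
by case: (l < j)%N; [exact: measurable_fun_ler|exact: measurable_fun_ltr].
Qed.

(** Ranks and counts take values in a countable type, so h may be arbitrary; this covers k, its
    inverse and every indicator built from ranks. *)
Lemma measurable_ranks {dT : measure_display} {T : measurableType dT}
    (h : nat -> nat -> nat -> nat -> T) l j r r' :
  measurable_fun [set: S] (fun s => let D := delta ^~ s in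
    h (nrank D l) (nrank D j) (count_within D r) (count_within D r')).
Proof.
pose c s := let D := delta ^~ s in
  (nrank D l, nrank D j, count_within D r, count_within D r').
apply: (measurable_fun_countable (c := c)
  (fun a => h a.1.1.1 a.1.1.2 a.1.2 a.2)) => -[[[a1 a2] a3] a4].
have mr i a : measurable [set s | nrank (delta ^~ s) i = a].
  by apply: measurable_count_eq => i'; exact: measurable_before.
have mw a t : measurable [set s | count_within (delta ^~ s) t = a].
  by apply: measurable_count_eq => i'; exact: measurable_fun_ler.
rewrite (_ : mkset _ = [set s | nrank (delta ^~ s) l = a1] `&`
   [set s | nrank (delta ^~ s) j = a2] `&` [set s | count_within (delta ^~ s) r = a3]
   `&` [set s | count_within (delta ^~ s) r' = a4]).
  by apply: measurableI; [apply: measurableI; [exact: measurableI|]|].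
apply/seteqP; split => s /=; first by rewrite /c => -[-> -> -> ->].
by rewrite /c => -[[[-> ->] ->] ->].
Qed.

Lemma measurable_count_within {dT : measure_display} {T : measurableType dT}
    (h : nat -> nat -> T) r r' :
  measurable_fun [set: S] (fun s => let D := delta ^~ s in
    h (count_within D r) (count_within D r')).
Proof.
pose c s := let D := delta ^~ s in (count_within D r, count_within D r').
apply: (measurable_fun_countable (c := c) (fun a => h a.1 a.2)) => -[a3 a4].
have mw a t : measurable [set s | count_within (delta ^~ s) t = a].
  by apply: measurable_count_eq => i'; exact: measurable_fun_ler.
rewrite (_ : mkset _ = [set s | count_within (delta ^~ s) r = a3]
   `&` [set s | count_within (delta ^~ s) r' = a4]); first exact: measurableI.
apply/seteqP; split => s /=; first by rewrite /c => -[-> ->].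
by rewrite /c => -[-> ->].
Qed.

End measurability.

End rank_combinatorics.

(** * Rates *)

Section dyadic.
Context {R : realType}.
Implicit Types (a beta z : R).

Lemma two_powR a j : ((2 : R) ^+ j) `^ a = (2 `^ a) ^+ j.
Proof.
elim: j => [|j IH]; first by rewrite !expr0 powR1.
by rewrite !exprS powRM ?exprn_ge0// IH.
Qed.

(** If 2^j <= z < 2^(j+1), the term j alone is (2^j)^(-a) >= z^(-a); if z < 1, the term j = 0 is 1;
    if z >= 2^J, the last summand suffices. The minimum with 1 is affordable because the risk at
    each point is bounded. *)
Lemma dyadic_ge a z J : 0 <= a -> 0 < z ->
  Num.min 1 (z `^ (- a)) <=
  \sum_(j < J) (2 `^ (- a)) ^+ j * (z < 2 ^+ j.+1)%R%:R + (2 `^ (- a)) ^+ J.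
Proof.
move=> a0 z0; set t := 2 `^ (- a); have t0 : 0 <= t by exact: powR_ge0.
elim: J => [|J IH]; first by rewrite big_ord0 add0r expr0 ge_min lexx.
have [zJ|Jz] := ltP z (2 ^+ J.+1).
  rewrite big_ord_recr/= zJ mulr1.
  by apply: (le_trans IH); rewrite lerDl exprn_ge0.
apply: (@le_trans _ _ (t ^+ J.+1)); last first.
  by rewrite lerDr; apply: sumr_ge0 => j _; rewrite mulr_ge0// exprn_ge0.
rewrite ge_min; apply/orP; right; rewrite /t -two_powR !powRN.
rewrite lef_pV2 ?posrE ?powR_gt0 ?exprn_gt0//.
by apply: ge0_ler_powR; rewrite ?nnegrE ?exprn_ge0// ltW.
Qed.

(* Up to a factor, what the tail P(f(X) <= t) <= C t^beta gives for the mean of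
   min(1, (N f(X))^(-a)) through [dyadic_ge], the dyadic sum being cut at N. *)
Definition dyadic_rate a beta (N : nat) : R :=
  N%:R `^ (- beta) * \sum_(j < trunc_log 2 N) (2 `^ beta * 2 `^ (- a)) ^+ j
  + (2 `^ (- a)) ^+ trunc_log 2 N.

(** Allows both error terms, whose exponents differ, to be estimated with the smaller exponent 2
    lambda. *)
Lemma ler_dyadic_rate a a' beta N : a' <= a ->
  dyadic_rate a beta N <= dyadic_rate a' beta N.
Proof.
move=> aa'; have h : 2 `^ (- a) <= 2 `^ (- a') :> R by rewrite ler_powR// ?lerN2// ler1n.
apply: lerD; last by rewrite lerXn2r ?nnegrE ?powR_ge0.
rewrite ler_wpM2l ?powR_ge0//; apply: ler_sum => j _.
by rewrite lerXn2r ?nnegrE ?mulr_ge0 ?powR_ge0// ler_wpM2l ?powR_ge0.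
Qed.

(** With J = [trunc_log 2 N] one has N < 2^(J+1), hence the factor 2^a. *)
Let dyadic_tail a N : 0 < a -> (0 < N)%N ->
  (2 `^ (- a)) ^+ trunc_log 2 N <= 2 `^ a * N%:R `^ (- a) :> R.
Proof.
move=> a0 N0; rewrite -two_powR !powRN.
have J0 : 0 < (2 : R) ^+ trunc_log 2 N by rewrite exprn_gt0.
rewrite ler_pdivlMr ?powR_gt0 ?ltr0n// mulrC ler_pdivrMr ?powR_gt0//.
rewrite -powRM// ?exprn_ge0//; apply: ge0_ler_powR; rewrite ?nnegrE ?mulr_ge0//.
- exact: ltW.
- by rewrite -exprS -natrX ler_nat ltnW// trunc_log_ltn.
Qed.

Let two_powR_gt1 z : 0 < z -> 1 < 2 `^ z :> R.
Proof.
move=> z0; have := @gt0_ltr_powR R z z0 1 2; rewrite !nnegrE powR1 => -> //; exact: ltr1n.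
Qed.

Let geometric (r : R) n : r != 1 -> \sum_(j < n) r ^+ j = (1 - r ^+ n) / (1 - r).
Proof.
move=> r1; have r1' : 1 - r != 0 by rewrite subr_eq0 eq_sym.
apply: (mulIf r1'); rewrite divfK//.
elim: n => [|n IH]; first by rewrite big_ord0 expr0 subrr mul0r.
by rewrite big_ord_recr/= mulrDl IH exprS; ring.
Qed.

(** The sum is geometric with ratio 2^(beta - a). Ratio 1 gives about log N equal terms; a smaller
    ratio gives a bounded sum and leaves N^(-beta); a larger ratio gives a sum of the order of
    N^(beta - a) and leaves N^(-a). *)
Lemma dyadic_rate_bound a beta : 0 < a -> 0 < beta ->
  exists2 C : R, 0 < C & forall N, (2 < N)%N -> dyadic_rate a beta N <=
    C * (if beta == a then N%:R `^ (- beta) * ln N%:R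
         else N%:R `^ (- Num.min beta a)).
Proof.
move=> a0 b0.
have NE (N : nat) : (2 < N)%N -> N%:R `^ (- beta) * N%:R `^ beta = 1 :> R.
  move=> N2; have N0 : (0 < N)%N by exact: ltn_trans N2.
  by rewrite -powRD ?addNr ?powRr0// pnatr_eq0 -lt0n N0 implybT.
have [<-|] := eqVneq beta a.
  have r1 : 2 `^ beta * 2 `^ (- beta) = 1 :> R.
    by rewrite -powRD ?subrr ?powRr0 ?pnatr_eq0 ?implybT.
  have l2 : 0 < ln 2 :> R by rewrite ln_gt0// ltr1n.
  (* [trunc_log 2 N] is at most ln N / ln 2, and the tail constant 2^beta is at most 2^beta ln N /
     ln 2. *)
  exists ((1 + 2 `^ beta) / ln 2); first by rewrite divr_gt0// ltr_pwDl// powR_ge0.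
  move=> N N2; have N0 : (0 < N)%N by exact: ltn_trans N2.
  have lnN : (trunc_log 2 N)%:R * ln 2 <= ln N%:R :> R.
    rewrite mulr_natl -lnXn// ler_ln ?posrE ?exprn_gt0 ?ltr0n//.
    by rewrite -natrX ler_nat trunc_logP.
  have lnN2 : ln 2 <= ln N%:R :> R by rewrite ler_ln ?posrE ?ltr0n// ler_nat ltnW.
  rewrite /dyadic_rate r1; under eq_bigr do rewrite expr1n.
  rewrite sumr_const card_ord.
  apply: (le_trans (lerD (lexx _) (dyadic_tail b0 N0))).
  have t0 : 0 <= N%:R `^ (- beta) :> R by exact: powR_ge0.
  have t1 : 0 <= 2 `^ beta :> R by exact: powR_ge0.
  rewrite [leLHS](_ : _ = N%:R `^ (- beta) * ((trunc_log 2 N)%:R + 2 `^ beta)); last by ring.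
  rewrite [leRHS](_ : _ = N%:R `^ (- beta) * (((1 + 2 `^ beta) * ln N%:R) / ln 2)); last by ring.
  by rewrite ler_wpM2l// ler_pdivlMr//; nra.
set r := 2 `^ beta * 2 `^ (- a).
have rE : r = 2 `^ (beta - a) :> R by rewrite /r -powRD ?pnatr_eq0 ?implybT.
have r0 : 0 <= r by rewrite rE powR_ge0.
move=> ba; have [blta|altb] := ltP beta a.
  have r1 : r < 1.
    by rewrite rE -opprB powRN invf_lt1 ?powR_gt0// two_powR_gt1// subr_gt0.
  have r1' : 0 < (1 - r)^-1 by rewrite invr_gt0 subr_gt0.
  exists ((1 - r)^-1 + 2 `^ a); first by rewrite ltr_pwDl// powR_ge0.
  move=> N N2; have N0 : (0 < N)%N by exact: ltn_trans N2.
  rewrite /dyadic_rate -/r geometric ?lt_eqF//.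
  apply: (le_trans (lerD (lexx _) (dyadic_tail a0 N0))).
  rewrite [leRHS]mulrDl; apply: lerD.
    rewrite [leRHS]mulrC ler_wpM2l ?powR_ge0// -[leRHS]mul1r ler_wpM2r ?(ltW r1')//.
    by rewrite lerBlDr lerDl exprn_ge0.
  by rewrite ler_wpM2l ?powR_ge0// ler_powR ?ler1n// lerN2 ltW.
have {altb ba} altb : a < beta by rewrite lt_neqAle eq_sym ba.
have r1 : 1 < r.
  by rewrite rE two_powR_gt1// subr_gt0.
have r1' : 0 < (r - 1)^-1 by rewrite invr_gt0 subr_gt0.
exists ((r - 1)^-1 + 2 `^ a); first by rewrite ltr_pwDl// powR_ge0.
move=> N N2; have N0 : (0 < N)%N by exact: ltn_trans N2.
rewrite /dyadic_rate -/r geometric ?gt_eqF//.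
apply: (le_trans (lerD (lexx _) (dyadic_tail a0 N0))).
rewrite [leRHS]mulrDl; apply: lerD => //.
rewrite -(opprB _ 1) -(opprB r 1) invrN mulrNN mulrA [leRHS]mulrC ler_wpM2r ?(ltW r1')//.
rewrite -(@ler_pM2r _ (N%:R `^ beta)) ?powR_gt0 ?ltr0n//.
rewrite mulrAC NE// mul1r -powRD; last by rewrite pnatr_eq0 -lt0n N0 implybT.
apply: (@le_trans _ _ (r ^+ trunc_log 2 N)); first by rewrite lerBlDr lerDl.
rewrite rE -two_powR addrC; apply: ge0_ler_powR; rewrite ?nnegrE ?exprn_ge0//.
  by rewrite addrC subr_ge0 ltW.
by rewrite -natrX ler_nat trunc_logP.
Qed.

End dyadic.

(** * Optimal choice of q *)

Section optimal_rate.
Context {R : realType}.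
Implicit Types (q beta : R).

Lemma optimal_q_bounds d : (0 < d)%N -> 0 < (optimal_q d : R) < 1.
Proof.
move=> d0; have d0' : 0 < d%:R :> R by rewrite ltr0n.
by rewrite /optimal_q divr_gt0 ?ltr_pdivrMr ?addr_gt0//; lra.
Qed.

Lemma knn_lambda_optimal d : (0 < d)%N ->
  knn_lambda d (optimal_q d) = 2 / (d%:R + 4) :> R.
Proof.
move=> d0; have d0' : 0 < d%:R :> R by rewrite ltr0n.
have d4 : d%:R + 4 != 0 :> R by rewrite gt_eqF// addr_gt0.
have dn0 : d%:R != 0 :> R by rewrite gt_eqF.
rewrite /knn_lambda /optimal_q (_ : 2 / d%:R * _ = 2 / (d%:R + 4)); last by field; rewrite d4 dn0.
by rewrite (_ : 2^-1 * _ = 2 / (d%:R + 4)) ?minxx//; field.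
Qed.

(** One argument of the minimum increases with q, the other decreases, and they cross at
    [optimal_q]; on either side one of them is below the common value. *)
Lemma knn_lambda_leif d q : (0 < d)%N ->
  knn_lambda d q <= knn_lambda d (optimal_q d) ?= iff (q == optimal_q d).
Proof.
move=> d0; have d0' : 0 < d%:R :> R by rewrite ltr0n.
have d40 : 0 < d%:R + 4 :> R by rewrite addr_gt0.
have d4 : d%:R + 4 != 0 :> R by rewrite gt_eqF// addr_gt0.
have dn0 : d%:R != 0 :> R by rewrite gt_eqF.
have [->|qq] := eqVneq q (optimal_q d); first by split; rewrite ?eqxx.
suff h : knn_lambda d q < knn_lambda d (optimal_q d).
  by split; [exact: ltW|exact: lt_eqF].
rewrite knn_lambda_optimal// /knn_lambda gt_min.
move: qq; rewrite neq_lt => /orP[qlt|qgt]; apply/orP; [left|right].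
  rewrite (_ : 2 / (d%:R + 4) = 2^-1 * optimal_q d); last by rewrite /optimal_q; field.
  by rewrite ltr_pM2l// invr_gt0.
rewrite (_ : 2 / (d%:R + 4) = 2 / d%:R * (1 - optimal_q d)).
  by rewrite ltr_pM2l ?divr_gt0// ltrD2l ltrN2.
by rewrite /optimal_q; field; rewrite d4 dn0.
Qed.

Lemma knn_lambda_gt0 d q : (0 < d)%N -> 0 < q < 1 -> 0 < knn_lambda d q.
Proof.
move=> d0 /andP[q0 q1]; rewrite /knn_lambda lt_min mulr_gt0 ?invr_gt0//=.
by rewrite mulr_gt0 ?divr_gt0 ?ltr0n ?subr_gt0.
Qed.

Lemma knn_rate_ge0 d beta q N : 0 <= knn_rate d beta q N.
Proof.
rewrite /knn_rate; case: ifP => _; last exact: powR_ge0.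
case: N => [|N]; first by rewrite ln0// mulr0.
by rewrite mulr_ge0 ?powR_ge0// ln_ge0// ler1n.
Qed.

Lemma bigO_of_le (u v : nat -> R) (C : R) (N0 : nat) :
  (forall N, (N0 <= N)%N -> 0 <= u N <= C * v N) ->
  (u : nat -> R^o) =O_\oo (v : nat -> R^o).
Proof.
move=> uv; apply/eqO_exP; exists (`|C| + 1); first by rewrite ltr_wpDl.
near=> N; have /uv/andP[u0 uCv] : (N0 <= N)%N by near: N; exact: nbhs_infty_ge.
rewrite /= ger0_norm//; apply: (le_trans uCv); apply: (le_trans (ler_norm _)).
by rewrite normrM ler_wpM2r// lerDl.
Unshelve. all: by end_near.
Qed.

Lemma eventually_bigO_of_le (u : nat -> \bar R) (v r : nat -> R) (C : R) (N0 : nat) :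
  (forall N, (N0 <= N)%N -> u N = (r N)%:E) ->
  (forall N, (N0 <= N)%N -> 0 <= r N <= C * v N) -> eventually_bigO u v.
Proof.
move=> ur rv; split.
  near=> N; rewrite ur//; near: N; exact: nbhs_infty_ge.
by apply: (@bigO_of_le _ _ C N0) => N N0N; rewrite /= ur//; exact: rv.
Unshelve. all: by end_near.
Qed.

Let ln_le_powR z (N : nat) : 0 < z -> (0 < N)%N -> ln N%:R <= z^-1 * N%:R `^ z :> R.
Proof.
move=> z0 N0; rewrite mulrC ler_pdivlMr// mulrC -ln_powR.
by apply/ltW/ln_sublinear; rewrite powR_gt0// ltr0n.
Qed.

(** The delicate case is beta = 2 lambda at [optimal_q], where the optimal choice pays a logarithm.
    For any other q the exponent is smaller by some e > 0, and ln N <= N^e / e absorbs the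
    logarithm. *)
Lemma knn_rate_optimal d beta q : (0 < d)%N -> 0 < q < 1 ->
  (knn_rate d beta (optimal_q d) : nat -> R^o) =O_\oo (knn_rate d beta q : nat -> R^o).
Proof.
move=> d0 q01; have [lle leq] := knn_lambda_leif q d0.
suff [C hC] : exists C, forall N, (2 < N)%N ->
    knn_rate d beta (optimal_q d) N <= C * knn_rate d beta q N.
  apply: (@bigO_of_le _ _ C 3) => N N2.
  by rewrite knn_rate_ge0 hC.
have l2 : 0 < ln 2 :> R by rewrite ln_gt0// ltr1n.
have [->|qq] := eqVneq q (optimal_q d); first by exists 1 => N _; rewrite mul1r.
have llt : knn_lambda d q < knn_lambda d (optimal_q d).
  by rewrite lt_neqAle leq qq lle.
rewrite /knn_rate; have [b1|b1] := eqVneq beta (2 * knn_lambda d (optimal_q d)).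
  have b2 : 2 * knn_lambda d q < beta by rewrite b1 ltr_pM2l.
  rewrite gt_eqF// min_r ?(ltW b2)//; set e := beta - 2 * knn_lambda d q.
  have e0 : 0 < e by rewrite subr_gt0.
  exists e^-1 => N N2; have N0 : (0 < N)%N by exact: ltn_trans N2.
  rewrite (_ : - (2 * _) = - beta + e); last by rewrite /e; ring.
  rewrite powRD ?pnatr_eq0 -?lt0n ?N0 ?implybT// mulrCA ler_wpM2l ?powR_ge0//.
  exact: ln_le_powR.
have [b2|b2] := eqVneq beta (2 * knn_lambda d q).
  rewrite min_l; last by rewrite {1}b2 ler_pM2l.
  exists (ln 2)^-1 => N N2; have N0 : (0 < N)%N by exact: ltn_trans N2.
  rewrite mulrCA -[leLHS]mulr1 ler_wpM2l ?powR_ge0// mulrC ler_pdivlMr// mul1r.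
  by rewrite ler_ln ?posrE ?ltr0n// ler_nat ltnW.
exists 1 => N N2; have N0 : (0 < N)%N by exact: ltn_trans N2.
rewrite mul1r ler_powR ?ler1n// lerN2 le_min ge_min lexx/= ge_min.
by rewrite ler_pM2l// lle orbT.
Qed.

End optimal_rate.

(** * Moments of the responses *)

Section moments.
Context {dO : measure_display} {Om : measurableType dO} {R : realType}.
Variable P : probability Om R.
Context {dT : measure_display} {T : measurableType dT}.
Variables (X : {RV P >-> T}) (Y eps : {RV P >-> R}) (eta : T -> R).
Hypothesis eta_meas : measurable_fun [set: T] eta.
Hypothesis Y_model : forall w, Y w = eta (X w) + eps w.
Hypothesis eps_centered : is_condexp P X eps (cst 0).
Variable M : R.
Hypothesis eta_bounded : forall x, `|eta x| <= M.

Local Open Scope ereal_scope.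

Lemma RV_preimage_measurable {d'} {T' : measurableType d'} (Z : {RV P >-> T'}) A :
  measurable A -> measurable (Z @^-1` A).
Proof. by move=> mA; rewrite -[X in measurable X]setTI; exact: measurable_funP. Qed.

Lemma measurable_etaX : measurable_fun setT (eta \o X).
Proof. exact: measurableT_comp. Qed.

Lemma integrable_eps : P.-integrable setT (EFin \o eps).
Proof. by have [] := eps_centered. Qed.

Lemma integral_eps A : measurable A -> \int[P]_(w in X @^-1` A) (eps w)%:E = 0.
Proof.
by move=> mA; have [_ _ _ ->//] := eps_centered; rewrite integral0.
Qed.

Lemma bounded_integrable (g : Om -> R) (C : R) : measurable_fun setT g ->
  (forall w, (`|g w| <= C)%R) -> P.-integrable setT (EFin \o g).
Proof.
move=> mg gC; apply: (@le_integrable _ _ _ P setT _ _ (cst C%:E)) => //.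
- exact/measurable_EFinP.
- by move=> w _ /=; rewrite lee_fin (le_trans (gC w))// ler_norm.
- by apply: finite_measure_integrable_cst.
Qed.

Lemma integrable_etaX : P.-integrable setT (EFin \o (eta \o X)).
Proof. by apply: (bounded_integrable measurable_etaX (C := M)) => w /=. Qed.

Lemma integrable_Y : P.-integrable setT (EFin \o Y).
Proof.
rewrite (_ : _ \o _ = (EFin \o (eta \o X)) \+ (EFin \o eps)).
  by apply: integrableD => //; [exact: integrable_etaX|exact: integrable_eps].
by apply/funext => w /=; rewrite Y_model.
Qed.

(** Condition (a') is centred at some version m of the regression function. Both m and eta have the
    integrals of Y over all events of X, so they agree almost everywhere for the law of X, and the
    squared deviation from m(X) is eps^2 almost surely. *)
Lemma eps_second_moment :
  (exists Ca : R, exists2 v, is_condvar P X Y v & forall x, (v x <= Ca)%R) ->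
  exists2 Ca : R, (0 <= Ca)%R &
    P.-integrable setT (fun w => (eps w ^+ 2)%:E) /\
    forall A, measurable A ->
      \int[P]_(w in X @^-1` A) (eps w ^+ 2)%:E <= Ca%:E * P (X @^-1` A).
Proof.
move=> [Ca [v [m [mm iY im mE] [mv iYm iv vE]] vCa]].
have mEeta : ae_eq (distribution P X) setT (EFin \o eta) (EFin \o m).
  apply: integral_ae_eq => //.
  - apply: integrable_pushforward => //; last exact: integrable_etaX.
    exact/measurable_EFinP.
  - exact/measurable_EFinP.
  - move=> E _ mE'; have mXE := RV_preimage_measurable X mE'.
    rewrite !integral_pushforward//; first last.
    + apply: integrableS integrable_etaX => //.
    + exact/measurable_EFinP.
    + apply: integrableS im => //.
    + exact/measurable_EFinP.
    rewrite -[RHS]mE//=.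
    transitivity (\int[P]_(w in X @^-1` E) ((eta (X w))%:E + (eps w)%:E)).
      rewrite integralD//; [by rewrite integral_eps// adde0| |].
      * by apply: integrableS integrable_etaX.
      * by apply: integrableS integrable_eps.
    by apply: eq_integral => w _; rewrite -EFinD Y_model.
have epsE : ae_eq P setT (fun w => ((Y w - m (X w)) ^+ 2)%:E) (fun w => (eps w ^+ 2)%:E).
  move: mEeta => [N [mN N0 subN]]; exists (X @^-1` N); split => //.
    exact: RV_preimage_measurable.
  move=> w /= h; apply: subN => /= h'; apply: h => _.
  have [{}h'] := h' I; congr (_%:E); congr (_ ^+ 2)%R.
  by rewrite Y_model -h' addrAC subrr add0r.
have me2 : measurable_fun setT (fun w => (eps w ^+ 2)%:E).
  by apply/measurable_EFinP; apply: measurable_funX.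
have mYm : measurable_fun setT (fun w => ((Y w - m (X w)) ^+ 2)%:E).
  by apply: measurable_int iYm.
exists (Num.max Ca 0)%R; first by rewrite le_max lexx orbT.
have h A : measurable A ->
    \int[P]_(w in X @^-1` A) (eps w ^+ 2)%:E <= (Num.max Ca 0)%:E * P (X @^-1` A).
  move=> mA; have mXA := RV_preimage_measurable X mA.
  rewrite -(@ae_eq_integral _ _ _ P _ _ (fun w => ((Y w - m (X w)) ^+ 2)%:E))//; first last.
  - exact: ae_eq_subset epsE.
  - exact: measurable_funTS.
  - exact: measurable_funTS.
  rewrite vE// -[leRHS]integral_cst//; apply: le_integral => //.
  - exact: integrableS iv.
  - exact: finite_measure_integrable_cst.
  - by move=> w _ /=; rewrite lee_fin le_max vCa.
split => //; apply/integrableP; split => //.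
under eq_integral do rewrite gee0_abs ?lee_fin ?sqr_ge0//.
have := h setT measurableT; rewrite preimage_setT => /le_lt_trans; apply.
by rewrite probability_setT mule1 ltry.
Qed.

Section bound.
Variable Ca : R.
Hypothesis Ca_ge0 : (0 <= Ca)%R.
Hypothesis ieps2 : P.-integrable setT (fun w => (eps w ^+ 2)%:E).
Hypothesis eps2_le : forall A, measurable A ->
  \int[P]_(w in X @^-1` A) (eps w ^+ 2)%:E <= Ca%:E * P (X @^-1` A).

(** From (Y - c)^2 = (eps + (eta(X) - c))^2 <= 2 eps^2 + 2 (2M)^2 when |c| <= M. *)
Definition dev_const : R := (2 * Ca + 8 * M ^+ 2)%R.

Lemma dev_const_ge0 : (0 <= dev_const)%R.
Proof. by apply: addr_ge0; apply: mulr_ge0 => //; exact: sqr_ge0. Qed.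

Let sqr_dev_le c w : (`|c| <= M)%R ->
  ((Y w - c) ^+ 2 <= 2 * eps w ^+ 2 + 8 * M ^+ 2)%R.
Proof.
move=> cM; rewrite Y_model.
have : (`|eta (X w) - c| <= 2 * M)%R.
  apply: (le_trans (ler_normB _ _)); rewrite mulr2n mulrDl mul1r.
  by rewrite lerD.
set t := (eta (X w) - c)%R => tM.
have t2 : (t ^+ 2 <= (2 * M) ^+ 2)%R by rewrite -real_normK ?num_real// lerXn2r ?nnegrE//
  (le_trans _ tM).
rewrite (_ : eta (X w) + eps w - c = t + eps w)%R; last by rewrite /t; ring.
have := sqr_ge0 (t - eps w)%R; move: t2; rewrite !expr2; nra.
Qed.

Let msqr_dev c : measurable_fun setT (fun w => (Y w - c) ^+ 2)%R.
Proof. by apply: measurable_funX; apply: measurable_funB. Qed.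

Let dom_int A : measurable A -> P.-integrable A
  (fun w => (2 * eps w ^+ 2 + 8 * M ^+ 2)%:E).
Proof.
move=> mA; apply: (@integrableS _ _ _ P setT) => //.
rewrite (_ : (fun _ => _) =
  (fun w => 2%:E * (eps w ^+ 2)%:E) \+ cst (8 * M ^+ 2)%:E); last first.
  by apply/funext => w /=; rewrite EFinD EFinM.
apply: integrableD => //; first exact: integrableZl.
exact: finite_measure_integrable_cst.
Qed.

Lemma integrable_sqr_dev c : (`|c| <= M)%R ->
  P.-integrable setT (fun w => ((Y w - c) ^+ 2)%:E).
Proof.
move=> cM; apply: le_integrable (dom_int measurableT) => //.
  exact/measurable_EFinP.
move=> w _; rewrite lee_fin ger0_norm ?sqr_ge0//.
by rewrite (le_trans (sqr_dev_le w cM))// ler_norm.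
Qed.

Lemma integral_sqr_dev_le c A : (`|c| <= M)%R -> measurable A ->
  \int[P]_(w in X @^-1` A) ((Y w - c) ^+ 2)%:E <= dev_const%:E * P (X @^-1` A).
Proof.
move=> cM mA; have mXA := RV_preimage_measurable X mA.
apply: (@le_trans _ _ (\int[P]_(w in X @^-1` A)
    (2 * eps w ^+ 2 + 8 * M ^+ 2)%:E)).
  apply: le_integral => //.
  - by apply: integrableS (integrable_sqr_dev cM).
  - exact: dom_int.
  - by move=> w _; rewrite lee_fin; exact: sqr_dev_le.
under eq_integral do rewrite EFinD EFinM.
rewrite integralD//; first last.
- exact: finite_measure_integrable_cst.
- by apply: integrableZl => //; apply: integrableS ieps2.
rewrite integralZl//; last by apply: integrableS ieps2.
rewrite integral_cst// /dev_const (EFinD (2 * Ca)) [leRHS]muleDl ?fin_num_measure//.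
apply: leeD => //; rewrite EFinM -muleA; apply: lee_wpmul2l => //.
exact: eps2_le.
Qed.

Lemma integral_weight_sqr_dev (h : T -> R) c : (`|c| <= M)%R ->
  measurable_fun setT h -> (forall x, (0 <= h x)%R) ->
  \int[P]_w (h (X w) * (Y w - c) ^+ 2)%:E <= dev_const%:E * \int[P]_w (h (X w))%:E.
Proof.
move=> cM mh h0.
under eq_integral do rewrite EFinM.
apply: (@le_trans _ _ (\int[P]_w ((h (X w))%:E * (cst dev_const w)%:E))).
  apply: (ge0_le_integral_weight _ (h := EFin \o h)) => //.
  - by move=> w; exact: sqr_ge0.
  - by move=> w; exact: dev_const_ge0.
  - by move=> A mA; have := integral_sqr_dev_le cM mA; rewrite -integral_cst//;
      exact: RV_preimage_measurable.
  - exact/measurable_EFinP.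
under eq_integral do rewrite muleC /=.
rewrite ge0_integralZl//.
- by apply/measurable_EFinP; exact: measurableT_comp.
- by move=> w _; rewrite lee_fin.
- by rewrite lee_fin dev_const_ge0.
Qed.

End bound.

(** Since eps is centred given X, its positive and negative parts have equal integrals over every
    event of X, hence against every nonnegative weight h(X); the bound C makes both integrals
    finite, so they can be subtracted. *)
Let integral_ge0_weight_eps (h : T -> R) (C : R) : measurable_fun setT h ->
  (forall x, (0 <= h x <= C)%R) ->
  \int[P]_w (h (X w) * eps w)%:E = 0.
Proof.
move=> mh hC.
have h0 x : (0 <= h x)%R by have /andP[] := hC x.
pose ep w : R := Num.max (eps w) 0%R; pose en w : R := Num.max (- eps w)%R 0%R.
have epsE w : eps w = (ep w - en w)%R.
  by rewrite /ep /en !maxEle; case: ifPn => h1; case: ifPn => h2; lra.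
have mep : measurable_fun setT ep by apply: measurable_maxr.
have men : measurable_fun setT en.
  by apply: measurable_maxr => //; apply: measurable_funN.
have iep : P.-integrable setT (EFin \o ep).
  apply: le_integrable integrable_eps => //; first exact/measurable_EFinP.
  by move=> w _ /=; rewrite lee_fin /ep; case: (leP (eps w) 0%R) => _; rewrite ?normr0.
have ien : P.-integrable setT (EFin \o en).
  apply: le_integrable integrable_eps => //; first exact/measurable_EFinP.
  by move=> w _ /=; rewrite lee_fin /en; case: (leP (- eps w)%R 0%R) => _;
    rewrite ?normr0 ?normrN.
have hX (e : Om -> R) : measurable_fun setT e -> P.-integrable setT (EFin \o e) ->
    P.-integrable setT (fun w => (h (X w) * e w)%:E).
  move=> me ie; have iC := integrableZl measurableT C ie.
  apply: le_integrable iC => //.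
    by apply/measurable_EFinP/measurable_funM => //; exact: measurableT_comp.
  move=> w _ /=; rewrite lee_fin !normrM ler_wpM2r// ger0_norm//.
  by have /andP[_ hC'] := hC (X w); rewrite (le_trans hC')// ler_norm.
have eE : \int[P]_w (h (X w) * ep w)%:E = \int[P]_w (h (X w) * en w)%:E.
  under eq_integral do rewrite EFinM.
  under [RHS]eq_integral do rewrite EFinM.
  apply: (integral_weight _ (h := EFin \o h)) => //.
  - by move=> w; rewrite /ep le_max lexx orbT.
  - by move=> w; rewrite /en le_max lexx orbT.
  - move=> A mA; have mXA := RV_preimage_measurable X mA.
    have iepA : P.-integrable (X @^-1` A) (EFin \o ep) by apply: integrableS iep.
    have ienA : P.-integrable (X @^-1` A) (EFin \o en) by apply: integrableS ien.
    have iepsA : P.-integrable (X @^-1` A) (EFin \o eps).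
      by apply: integrableS integrable_eps.
    transitivity (\int[P]_(w in X @^-1` A) ((eps w)%:E + (en w)%:E)).
      by apply: eq_integral => w _; rewrite -EFinD epsE subrK.
    by rewrite integralD// integral_eps// add0e.
  - exact/measurable_EFinP.
under eq_integral do rewrite epsE mulrBr EFinB.
rewrite integralB//; [|exact: hX|exact: hX].
by rewrite eE subee// integrable_fin_num//; exact: hX.
Qed.

Lemma integral_weight_eps (h : T -> R) (C : R) : measurable_fun setT h ->
  (forall x, (`|h x| <= C)%R) -> \int[P]_w (h (X w) * eps w)%:E = 0.
Proof.
move=> mh hC.
(* Shifting by C makes the weight nonnegative, and the shift contributes C times the mean of eps,
   which is 0. *)
have C0 x : (0 <= h x + C <= C + C)%R.
  by have := hC x; rewrite ler_norml; lra.
have mhC : measurable_fun setT (fun x => h x + C)%R by apply: measurable_funD.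
have := integral_ge0_weight_eps mhC C0.
under eq_integral do rewrite mulrDl EFinD (EFinM C).
have iC := integrableZl measurableT C integrable_eps.
rewrite integralD//.
  rewrite integralZl//; last exact: integrable_eps.
  have := integral_eps measurableT; rewrite preimage_setT => ->.
  by rewrite mule0 adde0.
apply: le_integrable iC => //.
  by apply/measurable_EFinP/measurable_funM => //; exact: measurableT_comp.
move=> w _ /=; rewrite lee_fin !normrM ler_wpM2r//.
by rewrite (le_trans (hC _))// ler_norm.
Qed.

End moments.

(** * Means over balls *)

Section ball_means.
Context {dO : measure_display} {Om : measurableType dO} {R : realType}.
Variable P : probability Om R.

Lemma cvg_Rintegral_sets (G : Om -> R) (E : nat -> set Om) (E' : set Om) :
  P.-integrable setT (EFin \o G) -> (forall n, measurable (E n)) ->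
  measurable E' -> (forall w, \forall n \near \oo, (w \in E n) = (w \in E')) ->
  \int[P]_(w in E n) G w @[n --> \oo] --> \int[P]_(w in E') G w.
Proof.
move=> iG mE mE' EE'.
have mG : measurable_fun setT G by apply/measurable_EFinP; exact: measurable_int iG.
have [||//|||i1 _ cvgI] := @dominated_convergence _ _ _ P setT measurableT
    (fun n => EFin \o (G \_ (E n))) (EFin \o (G \_ E')) (abse \o (EFin \o G)).
- by move=> n; apply/measurable_EFinP/(measurable_restrict _ (mE n) measurableT);
    exact: measurable_funTS.
- by apply/measurable_EFinP/(measurable_restrict _ mE' measurableT); exact: measurable_funTS.
- apply: aeW => w _; apply: cvg_near_cst; apply: filterS (EE' w) => n En /=.
  by rewrite !patchE En.
- exact: integrable_abse.
- apply: aeW => w n _ /=; rewrite lee_fin patchE; case: ifP => // _.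
  by rewrite normr0.
have RE (F : set Om) : measurable F ->
    \int[P]_(w in F) G w = fine (\int[P]_w (EFin \o (G \_ F)) w)%E.
  by move=> mF; rewrite Rintegral_mkcond.
rewrite RE//; under eq_fun do rewrite RE//.
apply: fine_cvg; rewrite fineK//; first exact: integrable_fin_num.
Qed.

Context {d : nat}.
Variables (nm : 'rV[R]_d -> R) (X : {RV P >-> 'rV[R]_d}) (Y : {RV P >-> R}).
Hypothesis nm_norm : is_norm nm.
Variables (f eta : 'rV[R]_d -> R) (Cc : R) (x : 'rV[R]_d).
Hypothesis condc : forall r : R, 0 < r ->
  `|event_condexp P Y (X @^-1` nball nm x r) - eta x| <= Cc * r ^+ 2.
Hypothesis iY : P.-integrable setT (EFin \o Y).

(* Closed ball if [b], open ball otherwise: ties between distances are broken by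
   the index, so the neighbours preceding a given one range over either kind. *)
Definition xball (b : bool) (r : R) : set 'rV[R]_d :=
  [set u | nm (u - x) < r ?<= if b].

Lemma measurable_xball b r : measurable (xball b r).
Proof.
have mnx : measurable_fun [set: 'rV[R]_d] (fun u => nm (u - x)).
  apply: (measurable_fun_dist nm_norm (u := id)); [exact: measurable_id|exact: measurable_cst].
rewrite -[X in measurable X]setTI; case: b.
  exact: (measurable_fun_le measurableT mnx (measurable_cst r)).
exact: (measurable_fun_ltr mnx (measurable_cst r) measurableT (Y := [set true])).
Qed.

Lemma measurable_pre_xball b r : measurable (X @^-1` xball b r).
Proof.
rewrite -[Z in measurable Z]setTI; apply: measurable_funP => //.
exact: measurable_xball.
Qed.

Let iYe : P.-integrable setT (EFin \o (fun w => Y w - eta x)).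
Proof.
rewrite (_ : _ \o _ = (EFin \o Y) \- cst (eta x)%:E)%E.
  by apply: integrableB => //; exact: finite_measure_integrable_cst.
by apply/funext => w /=; rewrite EFinB.
Qed.

Let closed_ball_mean r : 0 < r ->
  `|\int[P]_(w in X @^-1` xball true r) (Y w - eta x)| <=
    Cc * r ^+ 2 * fine (P (X @^-1` xball true r)).
Proof.
move=> r0; have mE := measurable_pre_xball true r; set E := X @^-1` _ in mE *.
have iYE : P.-integrable E (EFin \o Y) by apply: integrableS iY.
(* On a null ball [event_condexp] divides by 0, but both sides of the claim vanish. *)
have [PE0|PE0] := eqVneq (P E) 0%E.
  rewrite /Rintegral null_set_integral//= ?PE0 ?normr0 ?mulr0//.
  by apply: measurable_funTS; exact: measurable_int iYe.
have p0 : 0 < fine (P E).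
  by rewrite fine_gt0// lt0e PE0 measure_ge0/= -ge0_fin_numE// fin_num_measure.
have -> : \int[P]_(w in E) (Y w - eta x) =
    fine (P E) * (event_condexp P Y E - eta x).
  rewrite RintegralB//; last exact: finite_measure_integrable_cst.
  rewrite Rintegral_cst// mulrBr /event_condexp /Rintegral.
  by rewrite mulrCA divff ?gt_eqF// mulr1 [eta x * _]mulrC.
rewrite normrM gtr0_norm// mulrC ler_wpM2r ?(ltW p0)//.
exact: condc.
Qed.

(** Condition (c) covers closed balls of positive radius. An open ball is the increasing limit of
    closed balls of radii r (1 - 1/(n+2)), the closed ball of radius 0 the decreasing limit of those
    of radii 1/(n+1), and dominated convergence transfers the bound. Radius 0 is included because
    the distance of a neighbour may be 0. *)
Lemma xball_mean b r : 0 <= r ->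
  `|\int[P]_(w in X @^-1` xball b r) (Y w - eta x)| <=
    Cc * r ^+ 2 * fine (P (X @^-1` xball b r)).
Proof.
suff limit (s : nat -> R) : (forall n, 0 < s n) -> s n @[n --> \oo] --> r ->
    (forall u : 'rV[R]_d, \forall n \near \oo,
      (nm (u - x) <= s n) = (nm (u - x) < r ?<= if b)) ->
    `|\int[P]_(w in X @^-1` xball b r) (Y w - eta x)| <=
      Cc * r ^+ 2 * fine (P (X @^-1` xball b r)).
  rewrite le_eqVlt => /predU1P[r0|r0].
    case: b limit => limit; last first.
      rewrite (_ : _ @^-1` _ = set0) ?Rintegral_set0 ?normr0 ?measure0 ?mulr0//.
      apply/seteqP; split => // w /=; rewrite /xball /= -r0.
      by rewrite ltNge is_norm_ge0.
    apply: (limit (fun n => n.+1%:R^-1)) => //.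
      by rewrite -r0; exact: cvg_harmonic.
    move=> u; rewrite -r0 /=; have := is_norm_ge0 nm_norm (u - x).
    rewrite le_eqVlt => /predU1P[<-|u0].
      by apply: nearW => n; rewrite lexx invr_ge0 ler0n.
    near=> n; rewrite [RHS]leNgt u0/= leNgt; apply/negbTE; rewrite negbK.
    near: n; have := @cvg_harmonic R => /cvgrPdist_lt /(_ _ u0).
    apply: filterS => n; rewrite /= sub0r normrN ger0_norm//.
  case: b limit => limit; first exact: closed_ball_mean.
  apply: (limit (fun n => r * (1 - n.+2%:R^-1))).
  - by move=> n; rewrite mulr_gt0// subr_gt0 invf_lt1// ltr1n.
  - rewrite -[Z in _ --> Z]mulr1; apply: cvgM; first exact: cvg_cst.
    rewrite -[Z in _ --> Z]subr0; apply: cvgB; first exact: cvg_cst.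
    by have := @cvg_harmonic R; rewrite -(cvg_shiftn 1)/=; under eq_fun do rewrite addn1.
  - move=> u /=; have [ur|ru] := ltP (nm (u - x)) r.
      have ur0 : 0 < r - nm (u - x) by rewrite subr_gt0.
      near=> n; apply/idP.
      have n2 : r * n.+2%:R^-1 <= r - nm (u - x).
        rewrite ler_pdivrMr// mulrC -ler_pdivrMr//.
        have : r / (r - nm (u - x)) <= n%:R by near: n; exact: nbhs_infty_ger.
        by move=> /le_trans; apply; rewrite ler_nat -addn2 leq_addr.
      by rewrite mulrBr mulr1 lerBrDr -lerBrDl.
    apply: nearW => n; apply/negbTE; rewrite -ltNge.
    apply: lt_le_trans ru; rewrite mulrBr mulr1 gtrBl mulr_gt0//.
move=> s0 sr su.
have nearE w : \forall n \near \oo,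
    (w \in X @^-1` xball true (s n)) = (w \in X @^-1` xball b r).
  apply: filterS (su (X w)) => n h.
  by apply/idP/idP; rewrite !inE/= /xball/= h.
have cF := cvg_Rintegral_sets iYe (fun n => measurable_pre_xball true (s n))
  (measurable_pre_xball b r) nearE.
have i1 : P.-integrable setT (EFin \o cst 1) by exact: finite_measure_integrable_cst.
have RE (F : set Om) : measurable F -> \int[P]_(w in F) cst 1 w = fine (P F).
  by move=> mF; rewrite -[RHS]mul1r -Rintegral_cst.
have cp : fine (P (X @^-1` xball true (s n))) @[n --> \oo] -->
    fine (P (X @^-1` xball b r)).
  rewrite -RE; last exact: measurable_pre_xball.
  rewrite (_ : (fun n => _) = (fun n => \int[P]_(w in X @^-1` xball true (s n)) cst 1 w)).
    apply: (cvg_Rintegral_sets i1 _ _ nearE) => [n|]; exact: measurable_pre_xball.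
  by apply/funext => n; rewrite RE//; exact: measurable_pre_xball.
apply: (ler_cvg_to (cvg_norm cF) (cvgM (cvgM (cvg_cst Cc) (cvgM sr sr)) cp)).
by apply: nearW => n; exact: closed_ball_mean.
Unshelve. all: by end_near.
Qed.

End ball_means.

(** * Resampling one observation *)

Section resampling.
Context {dO : measure_display} {Om : measurableType dO} {R : realType}.
Variable P : probability Om R.
Context {dT : measure_display} {T : measurableType dT}.

(** On boxes the claim reduces to mutual independence of finitely many distinct members of the
    family. The constant t0 fills the coordinates outside S, so that the row keeps its length N when
    an observation is left out. *)
Lemma indep_pair_subfamily (I : eqType) (Z : I -> Om -> T) N (S : pred 'I_N)
    (o : 'I_N -> I) (i0 : I) (t0 : T) :
  mutual_independence P Z -> (forall i, measurable_fun [set: Om] (Z i)) ->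
  {in S &, injective o} -> (forall l, S l -> o l != i0) ->
  indep_pair P (Z i0) (fun w => \row_(l < N) if S l then Z (o l) w else t0).
Proof.
move=> indZ mZ oinj oi0.
have mD : measurable_fun [set: Om]
    (fun w => \row_(l < N) if S l then Z (o l) w else t0).
  apply: measurable_fun_rV => l; under eq_fun do rewrite mxE.
  by case: (S l); [exact: mZ|exact: measurable_cst].
apply: indep_pair_row => // A B mA mB.
set E := _ @^-1` [set v | _].
pose s := [seq o l | l <- index_enum 'I_N & S l].
(* Translates the sides of the box, indexed by coordinates, into events indexed by the family;
   injectivity of o makes the picked coordinate unique. *)
pose F j := if j == i0 then A
  else if [pick l | S l && (o l == j)] is Some l then B l else setT.
have mF j : measurable (F j).
  by rewrite /F; case: eqP => // _; case: pickP.
have Fo l : S l -> F (o l) = B l.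
  move=> Sl; rewrite /F (negbTE (oi0 l Sl)); case: pickP => [l' /andP[Sl' /eqP ol]|].
    by rewrite (oinj l' l).
  by move=> /(_ l); rewrite Sl eqxx.
have uniq_s : uniq s.
  rewrite map_inj_in_uniq ?filter_uniq ?index_enum_uniq// => l l'.
  by rewrite !mem_filter => /andP[Sl _] /andP[Sl' _]; exact: oinj.
have i0s : i0 \notin s.
  by apply/mapP => -[l]; rewrite mem_filter => /andP[/oi0 + _] e; rewrite e eqxx.
(* If the box excludes t0 in a coordinate outside S, its preimage is empty. *)
have [[l [Sl Bl]]|allB] := pselect (exists l, ~~ S l /\ ~ B l t0).
  rewrite (_ : E = set0) ?setI0 ?measure0 ?mule0//.
  by apply/seteqP; split => // w /= /(_ l); rewrite mxE (negbTE Sl).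
have EE : E = \bigcap_(j in [set` s]) (Z j @^-1` F j).
  apply/seteqP; split => [w /= Ew j /= /mapP[l]|w /= Ew l].
    rewrite mem_filter => /andP[Sl _] ->; rewrite Fo//.
    by have := Ew l; rewrite mxE Sl.
  rewrite mxE; case: ifPn => Sl.
    rewrite -Fo//; apply: Ew => /=; apply: map_f.
    by rewrite mem_filter Sl mem_index_enum.
  by apply: contrapT => Bl; apply: allB; exists l.
have F0 : F i0 = A by rewrite /F eqxx.
rewrite EE -[in LHS]F0 -[in RHS]F0 indZ//.
rewrite (_ : _ `&` _ = \bigcap_(j in [set` i0 :: s]) (Z j @^-1` F j)); last first.
  apply/seteqP; split => [w [w0 ws] j /=|w ws].
    by rewrite inE => /predU1P[->//|]; exact: ws.
  split; first by apply: ws; rewrite /= inE eqxx.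
  by move=> j js; apply: ws; rewrite /= inE js orbT.
by rewrite indZ ?big_cons//= i0s.
Qed.

Definition upd_row N (i : 'I_N) (u : 'rV[T]_N) (t : T) : 'rV[T]_N :=
  \row_l if l == i then t else u ord0 l.

Lemma measurable_upd_row N (i : 'I_N) :
  measurable_fun [set: 'rV[T]_N * T] (fun z => upd_row i z.1 z.2).
Proof.
apply: measurable_fun_rV => l; under eq_fun do rewrite mxE.
case: (l == i); first exact: measurable_snd.
by apply: (measurableT_comp (measurable_coor l)); exact: measurable_fst.
Qed.

Variables (V0 : Om -> T) (V : nat -> Om -> T).
Hypothesis mV0 : measurable_fun [set: Om] V0.
Hypothesis mV : forall i, measurable_fun [set: Om] (V i).
Hypothesis lawV : forall i, same_law P (V i) V0.
Hypothesis indV : mutual_independence P (fun o => if o is Some i then V i else V0).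
Variable N : nat.

Definition sample (w : Om) : 'rV[T]_N := \row_(l < N) V l w.

Lemma measurable_sample : measurable_fun [set: Om] sample.
Proof. by apply: measurable_fun_rV => l; under eq_fun do rewrite mxE; exact: mV. Qed.

Let mVo o : measurable_fun [set: Om] (if o is Some i then V i else V0).
Proof. by case: o. Qed.

Lemma indep_test_sample : indep_pair P V0 sample.
Proof.
apply: (indep_pair_subfamily (Z := fun o => if o is Some i then V i else V0)
  (S := xpredT) (o := fun l => Some (val l)) (i0 := None) point) => //.
by move=> l l' _ _ [] /val_inj.
Qed.

Let indep_others (i : 'I_N) t0 :
  indep_pair P (V i) (fun w => upd_row i (sample w) t0).
Proof.
rewrite (_ : (fun w => _) = (fun w => \row_(l < N) if l != i then V l w else t0)).
  apply: (indep_pair_subfamily (Z := fun o => if o is Some i then V i else V0)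
    (S := fun l => l != i) (o := fun l => Some (val l)) (i0 := Some (val i))) => //.
  by move=> l l' _ _ [] /val_inj.
apply/funext => w; apply/rowP => l; rewrite !mxE.
by case: (l == i).
Qed.

Let upd_upd (i : 'I_N) u t t' : upd_row i (upd_row i u t) t' = upd_row i u t'.
Proof. by apply/rowP => l; rewrite !mxE; case: eqP. Qed.

Let upd_sample (i : 'I_N) w : upd_row i (sample w) (V i w) = sample w.
Proof. by apply/rowP => l; rewrite !mxE; case: eqP => // ->. Qed.

Let mupd (i : 'I_N) t0 : measurable_fun [set: Om] (fun w => upd_row i (sample w) t0).
Proof.
apply: (measurableT_comp (measurable_upd_row i) (g := fun w => (sample w, t0))).
by apply: measurable_fun_pair => //; exact: measurable_sample.
Qed.

Local Open Scope ereal_scope.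

Let pushV i := measure_function_pushforward__canonical__measure_function_Measure P (mV i).
Let pushV0 := measure_function_pushforward__canonical__measure_function_Measure P mV0.

Lemma ge0_integral_same_law i (h : T -> \bar R) : measurable_fun setT h ->
  (forall t, 0 <= h t) -> \int[P]_w h (V i w) = \int[P]_w h (V0 w).
Proof.
move=> mh h0.
transitivity (\int[pushV i]_t h t); first by rewrite ge0_integral_pushforward.
transitivity (\int[pushV0]_t h t); last by rewrite ge0_integral_pushforward.
by apply: eq_measure_integral => A mA _; exact: lawV.
Qed.

Lemma integrable_same_law i (h : T -> \bar R) : measurable_fun setT h ->
  P.-integrable setT (h \o V0) -> P.-integrable setT (h \o V i).
Proof.
move=> mh /integrableP[_ ih]; apply/integrableP; split.
  exact: measurableT_comp.
rewrite (@ge0_integral_same_law i (abse \o h)) => [//||t]; last exact: abse_ge0.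
exact: measurableT_comp.
Qed.

Lemma integral_same_law i (h : T -> \bar R) : measurable_fun setT h ->
  P.-integrable setT (h \o V0) -> \int[P]_w h (V i w) = \int[P]_w h (V0 w).
Proof.
move=> mh ih.
transitivity (\int[pushV i]_t h t).
  by rewrite integral_pushforward//; exact: integrable_same_law.
transitivity (\int[pushV0]_t h t); last by rewrite integral_pushforward.
by apply: eq_measure_integral => A mA _; exact: lawV.
Qed.

(** Observation i is independent of the others and has the law of the test pair, so V0 at an
    independent point w' serves as its fresh draw. *)
Lemma ge0_integral_resample (i : 'I_N) (phi : 'rV[T]_N -> \bar R) :
  measurable_fun setT phi -> (forall u, 0 <= phi u) ->
  \int[P]_w phi (sample w) =
  \int[P]_w \int[P]_w' phi (upd_row i (sample w) (V0 w')).
Proof.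
move=> mphi phi0.
have mphi' : measurable_fun setT (fun z => phi (upd_row i z.1 z.2)).
  exact: measurableT_comp mphi (measurable_upd_row i).
pose t0 : T := point.
transitivity (\int[P]_w phi (upd_row i (upd_row i (sample w) t0) (V i w))).
  by apply: eq_integral => w _; rewrite upd_upd upd_sample.
transitivity (\int[P]_w \int[P]_w'
    phi (upd_row i (upd_row i (sample w) t0) (V i w'))).
  exact: (ge0_integral_indep_pair (mV i) (mupd i t0) (@indep_others i t0) mphi').
apply: eq_integral => w _; under eq_integral do rewrite upd_upd.
rewrite (@ge0_integral_same_law i (fun t => phi (upd_row i (sample w) t)))//.
exact: measurableT_comp mphi' (measurable_pair1 _).
Qed.

(** The signed counterpart, for integrands of mean 0 in observation i with the others fixed; it is
    the source of all orthogonality relations below. *)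
Lemma integral_resample0 (i : 'I_N) (phi : 'rV[T]_N -> \bar R) :
  measurable_fun setT phi -> P.-integrable setT (phi \o sample) ->
  (forall u, P.-integrable setT (fun w => phi (upd_row i u (V0 w)))) ->
  (forall u, \int[P]_w phi (upd_row i u (V0 w)) = 0) ->
  \int[P]_w phi (sample w) = 0.
Proof.
move=> mphi iphi iphi1 phi0.
have mphi' : measurable_fun setT (fun z => phi (upd_row i z.1 z.2)).
  exact: measurableT_comp mphi (measurable_upd_row i).
have mphi1 u : measurable_fun setT (fun t => phi (upd_row i u t)).
  exact: measurableT_comp mphi' (measurable_pair1 _).
pose t0 : T := point.
have updE w : phi (upd_row i (upd_row i (sample w) t0) (V i w)) = phi (sample w).
  by rewrite upd_upd upd_sample.
transitivity (\int[P]_w phi (upd_row i (upd_row i (sample w) t0) (V i w))).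
  by apply: eq_integral => w _; rewrite updE.
rewrite (integral_indep_pair (mV i) (mupd i t0) (@indep_others i t0) mphi')//=.
- rewrite integral0_eq// => w _.
  rewrite (@integral_same_law i (fun t => phi (upd_row i (upd_row i (sample w) t0) t)))//.
  exact: iphi1.
- by rewrite (_ : (fun w => _) = phi \o sample)//; apply/funext => w; rewrite updE.
- move=> u; apply: (@integrable_same_law i (fun t => phi (upd_row i u t))) => //.
  exact: iphi1.
Qed.

End resampling.

(** * Mean squared error at a fixed point *)

Section orthogonal_sum.
Context {dO : measure_display} {Om : measurableType dO} {R : realType}.
Variable mu : {measure set Om -> \bar R}.
Local Open Scope ereal_scope.

Lemma integrable_mul_sqr (a b : Om -> R) :
  measurable_fun setT a -> measurable_fun setT b ->
  mu.-integrable setT (fun w => (a w ^+ 2)%:E) ->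
  mu.-integrable setT (fun w => (b w ^+ 2)%:E) ->
  mu.-integrable setT (fun w => (a w * b w)%:E).
Proof.
move=> ma mb ia ib.
apply: le_integrable (integrableD measurableT ia ib) => //.
  by apply/measurable_EFinP; exact: measurable_funM.
move=> w _ /=; rewrite lee_fin.
rewrite [leRHS]ger0_norm ?addr_ge0 ?sqr_ge0//.
rewrite -[in leRHS](real_normK (num_real (a w))) -[in leRHS](real_normK (num_real (b w))).
rewrite normrM.
have := sqr_ge0 (`|a w| - `|b w|)%R; have := sqr_ge0 (`|a w|)%R.
have := sqr_ge0 (`|b w|)%R; rewrite !expr2; nra.
Qed.

Lemma integral_sum_sqr N (xi : 'I_N -> Om -> R) :
  (forall l, measurable_fun setT (xi l)) ->
  (forall l, mu.-integrable setT (fun w => (xi l w ^+ 2)%:E)) ->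
  (forall l l', l != l' -> \int[mu]_w (xi l w * xi l' w)%:E = 0) ->
  \int[mu]_w ((\sum_(l < N) xi l w) ^+ 2)%:E =
  \sum_(l < N) \int[mu]_w (xi l w ^+ 2)%:E.
Proof.
move=> mxi ixi xi0.
have ixi2 l l' : mu.-integrable setT (fun w => (xi l w * xi l' w)%:E).
  exact: integrable_mul_sqr.
transitivity (\int[mu]_w \sum_(l < N) \sum_(l' < N) (xi l w * xi l' w)%:E).
  apply: eq_integral => w _; rewrite expr2 mulr_suml -sumEFin.
  by apply: eq_bigr => l _; rewrite mulr_sumr -sumEFin.
rewrite integral_sum//; last by move=> l; exact: integrable_sum.
apply: eq_bigr => l _; rewrite integral_sum// (bigD1 l)//= big1 ?adde0//.
by move=> l' l'l; rewrite xi0// eq_sym.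
Qed.

End orthogonal_sum.

Section nearest_neighbours_at_a_point.
Context {dO : measure_display} {Om : measurableType dO} {R : realType}.
Variable P : probability Om R.
Variables (d : nat) (nm : 'rV[R]_d -> R).
Hypothesis nm_norm : is_norm nm.
Variables (X : {RV P >-> 'rV[R]_d}) (Y : {RV P >-> R}).
Variables (Xs : nat -> {RV P >-> 'rV[R]_d}) (Ys : nat -> {RV P >-> R}).

Local Notation T := ('rV[R]_d * R)%type.
Let V0 w : T := (X w, Y w).
Let V i w : T := (Xs i w, Ys i w).
Hypothesis lawV : forall i, same_law P (V i) V0.
Hypothesis indV : mutual_independence P (fun o => if o is Some i then V i else V0).

Let mV0 : measurable_fun [set: Om] V0.
Proof. exact: measurable_fun_pair. Qed.

Let mV i : measurable_fun [set: Om] (V i).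
Proof. exact: measurable_fun_pair. Qed.

Variables (x : 'rV[R]_d) (c : R) (C1 Cc : R).
Hypothesis Cc_ge0 : 0 <= Cc.
Hypothesis C1_ge0 : 0 <= C1.
Hypothesis iY2 : P.-integrable setT (fun w => ((Y w - c) ^+ 2)%:E).
Hypothesis weight_dev : forall h : 'rV[R]_d -> R, measurable_fun setT h ->
  (forall x, 0 <= h x) ->
  (\int[P]_w (h (X w) * (Y w - c) ^+ 2)%:E <= C1%:E * \int[P]_w (h (X w))%:E)%E.
Hypothesis ball_mean : forall b r, 0 <= r ->
  `|\int[P]_(w in X @^-1` xball nm x b r) (Y w - c)| <=
    Cc * r ^+ 2 * fine (P (X @^-1` xball nm x b r)).

Variable N : nat.
Local Notation smp := (sample (V : nat -> Om -> T) N).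
Implicit Types (u : 'rV[T]_N).

Let msmp : measurable_fun [set: Om] smp.
Proof. exact: measurable_sample. Qed.

Definition sdist u (i : 'I_N) : R := nm ((u ord0 i).1 - x).
Local Notation bef u l j := (before (sdist u l) (sdist u j) l j).

Lemma measurable_sdist i : measurable_fun [set: 'rV[T]_N] (sdist ^~ i).
Proof.
apply: (measurable_fun_dist nm_norm); last exact: measurable_cst.
by apply: (measurableT_comp measurable_fst); exact: measurable_coor.
Qed.

Definition sdev u (i : 'I_N) : R := (u ord0 i).2 - c.

Lemma measurable_sdev i : measurable_fun [set: 'rV[T]_N] (sdev ^~ i).
Proof.
apply: measurable_funB => //.
by apply: (measurableT_comp measurable_snd); exact: measurable_coor.
Qed.

Lemma sdist_upd u i v l : sdist (upd_row i u v) l =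
  if l == i then nm (v.1 - x) else sdist u l.
Proof. by rewrite /sdist mxE; case: ifP. Qed.

Lemma sdev_upd u i v l : sdev (upd_row i u v) l =
  if l == i then v.2 - c else sdev u l.
Proof. by rewrite /sdev mxE; case: ifP. Qed.

Let integrable_smp_sqr i : P.-integrable setT (fun w => (sdev (smp w) i ^+ 2)%:E).
Proof.
rewrite (_ : (fun w => _) = (fun v : T => ((v.2 - c) ^+ 2)%:E) \o V i).
  apply: (integrable_same_law mV0 mV lawV) => //.
  apply/measurable_EFinP; apply: measurable_funX; exact: measurable_funB.
by apply/funext => w /=; rewrite /sdev mxE.
Qed.

(** The last hypothesis says that h sees only the position of sample i, not its response. After
    redrawing sample i, the inner integral therefore has a weight in X alone, and [weight_dev]
    bounds it. *)
Lemma integral_weight_sdev (h : 'rV[T]_N -> R) i :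
  measurable_fun setT h -> (forall u, 0 <= h u) ->
  (forall u v v', v.1 = v'.1 -> h (upd_row i u v) = h (upd_row i u v')) ->
  (\int[P]_w (h (smp w) * sdev (smp w) i ^+ 2)%:E <=
   C1%:E * \int[P]_w (h (smp w))%:E)%E.
Proof.
move=> mh h0 hX.
have mh1 u : measurable_fun setT (fun v => h (upd_row i u v)).
  have := measurableT_comp mh (measurable_upd_row (T := T) i).
  by move=> mh'; exact: measurableT_comp mh' (measurable_pair1 u).
have mhs : measurable_fun setT (fun u => (h u * sdev u i ^+ 2)%:E).
  by apply/measurable_EFinP/measurable_funM => //; apply: measurable_funX; exact: measurable_sdev.
have mh2 : measurable_fun setT (fun z : 'rV[T]_N * T => (h (upd_row i z.1 z.2))%:E).
  apply/measurable_EFinP.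
  exact: measurableT_comp mh (measurable_upd_row (T := T) i).
have mh3 : measurable_fun setT (fun w => \int[P]_w' (h (upd_row i (smp w) (V0 w')))%:E)%E.
  pose g (z : Om * Om) := (h (upd_row i (smp z.1) (V0 z.2)))%:E.
  apply: (measurable_fun_fubini_tonelli_F (m2 := P) g) => [|z]; last by rewrite lee_fin.
  apply: (measurableT_comp mh2 (g := fun z : Om * Om => (smp z.1, V0 z.2))).
  by apply: measurable_fun_pair; [apply: (measurableT_comp msmp)|apply: (measurableT_comp mV0)].
rewrite (@ge0_integral_resample _ _ _ _ _ _ _ _ mV0 mV lawV indV _ i
  (fun u => (h u * sdev u i ^+ 2)%:E))//; last first.
  by move=> u; rewrite lee_fin mulr_ge0 ?sqr_ge0.
rewrite (@ge0_integral_resample _ _ _ _ _ _ _ _ mV0 mV lawV indV _ i (fun u => (h u)%:E))//;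
  last 1 first.
  exact/measurable_EFinP.
rewrite -ge0_integralZl//; last by move=> w _; apply: integral_ge0 => w' _; rewrite lee_fin.
apply: ge0_le_integral => //.
- by move=> w _; apply: integral_ge0 => w' _; rewrite lee_fin mulr_ge0 ?sqr_ge0.
- pose g (z : Om * Om) := (h (upd_row i (smp z.1) (V0 z.2)) *
    sdev (upd_row i (smp z.1) (V0 z.2)) i ^+ 2)%:E.
  apply: (measurable_fun_fubini_tonelli_F (m2 := P) g) => [|z];
    last by rewrite lee_fin mulr_ge0 ?sqr_ge0.
  apply: (measurableT_comp mhs (g := fun z : Om * Om => upd_row i (smp z.1) (V0 z.2))).
  apply: (measurableT_comp (measurable_upd_row (T := T) i) (g :=
    fun z : Om * Om => (smp z.1, V0 z.2))).
  by apply: measurable_fun_pair; [apply: (measurableT_comp msmp)|apply: (measurableT_comp mV0)].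
- exact: emeasurable_funM.
(* The response 0 is arbitrary, by [hX]. *)
move=> w _; pose h0X x' := h (upd_row i (smp w) (x', 0)).
have hE w' : h (upd_row i (smp w) (V0 w')) = h0X (X w') by exact: hX.
under eq_integral do rewrite hE sdev_upd eqxx.
under [in leRHS]eq_integral do rewrite hE.
apply: (weight_dev (h := h0X)) => [|x']; last exact: h0.
apply: (measurableT_comp (mh1 (smp w)) (g := fun x' : 'rV[R]_d => (x', 0 : R))).
by apply: measurable_fun_pair.
Qed.

Let integrable_dev : P.-integrable setT (fun w => (Y w - c)%:E).
Proof.
have i1 : P.-integrable setT (fun w : Om => ((1 : R) ^+ 2)%:E).
  exact: finite_measure_integrable_cst.
have mYc : measurable_fun setT (fun w => Y w - c) by apply: measurable_funB.
have := integrable_mul_sqr mYc (measurable_cst (1 : R)) iY2 i1.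
by under eq_fun do rewrite mulr1.
Qed.

(** With the other samples fixed, b is constant in sample l and a averages to 0 over it. *)
Lemma orthogonal_resample (a b : 'rV[T]_N -> R) (l : 'I_N) :
  measurable_fun setT a -> measurable_fun setT b ->
  P.-integrable setT (fun w => (a (smp w) ^+ 2)%:E) ->
  P.-integrable setT (fun w => (b (smp w) ^+ 2)%:E) ->
  (forall u v, b (upd_row l u v) = b u) ->
  (forall u, P.-integrable setT (fun w => (a (upd_row l u (V0 w)))%:E)) ->
  (forall u, \int[P]_w (a (upd_row l u (V0 w)))%:E = 0)%E ->
  (\int[P]_w (a (smp w) * b (smp w))%:E = 0)%E.
Proof.
move=> ma mb ia ib bE ia1 a0.
apply: (@integral_resample0 _ _ _ _ _ _ _ _ mV0 mV lawV indV _ l (fun u => (a u * b u)%:E)).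
- by apply/measurable_EFinP; exact: measurable_funM.
- by apply: integrable_mul_sqr => //; exact: measurableT_comp.
- move=> u; under eq_fun do rewrite bE mulrC EFinM.
  exact: integrableZl.
- move=> u; under eq_integral do rewrite bE mulrC EFinM.
  by rewrite integralZl// a0 mule0.
Qed.

(** * Variance of the number of samples in a ball *)

Section count.
Variable r : R.
Let p := fine (P (X @^-1` nball nm x r)).
Let E := X @^-1` nball nm x r.

Let mE : measurable E.
Proof.
rewrite -[Z in measurable Z]setTI; apply: measurable_funP => //.
exact: measurable_nball.
Qed.

Let indE w : (nm (X w - x) <= r)%R%:R = \1_E w :> R.
Proof.
rewrite /indic; case: (boolP (nm (X w - x) <= r)) => h.
  by rewrite mem_set.
by rewrite memNset//; exact/negP.
Qed.

Let p01 : 0 <= p <= 1.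
Proof.
rewrite fine_ge0//= -lee_fin fineK ?fin_num_measure//.
exact: probability_le1.
Qed.

Let iE : P.-integrable setT (fun w => (\1_E w)%:E).
Proof. by apply: integrable_indic; rewrite // -ge0_fin_numE// fin_num_measure. Qed.

Let ip : P.-integrable setT (fun w => p%:E : \bar R).
Proof. exact: finite_measure_integrable_cst. Qed.

Let int_indE : (\int[P]_w (\1_E w)%:E = p%:E)%E.
Proof. by rewrite integral_indic// setIT /p fineK// fin_num_measure. Qed.

Let int_p : (\int[P]_w p%:E = p%:E)%E.
Proof.
rewrite integral_cst//.
by rewrite -[RHS]mule1; congr (_ * _)%E; exact: probability_setT.
Qed.

(** The centred indicators are pairwise orthogonal, and each has second moment p (1 - p) <= p. *)
Lemma count_within_second_moment :
  (\int[P]_w (((count_within (sdist (smp w)) r)%:R - N%:R * p) ^+ 2)%:E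
     <= (N%:R * p)%:E)%E.
Proof.
pose a (l : 'I_N) (u : 'rV[T]_N) : R := (sdist u l <= r)%R%:R - p.
have ma l : measurable_fun setT (a l).
  apply: measurable_funB => //; apply: measurable_fun_natr_bool.
  by apply: measurable_fun_ler => //; exact: measurable_sdist.
have aV0 l w u : a l (upd_row l u (V0 w)) = \1_E w - p.
  by rewrite /a sdist_upd eqxx indE.
have ia l : P.-integrable setT (fun w => (a l (smp w) ^+ 2)%:E).
  apply: (@bounded_integrable _ _ _ P _ 1).
    by apply: measurable_funX; exact: measurableT_comp (ma l) msmp.
  move=> w; rewrite normrX expr_le1// /a ler_norml.
  by have := p01; case: (_ <= r) => /=; lra.
under eq_integral => w _.
  rewrite (_ : _ - _ = \sum_(l < N) a l (smp w)); last first.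
    by rewrite /a sumrB /count_within natr_sum sumr_const card_ord mulr_natl.
  over.
rewrite integral_sum_sqr//; first last.
- move=> l l' ll'; apply: (orthogonal_resample (l := l)) => //.
  + by move=> u v; rewrite /a sdist_upd eq_sym (negbTE ll').
  + move=> u; under eq_fun do rewrite aV0 EFinB.
    exact: integrableB.
  + move=> u; under eq_integral do rewrite aV0 EFinB.
    by rewrite integralB// int_indE int_p subee.
- by move=> l; exact: measurableT_comp (ma l) msmp.
rewrite -[leRHS](_ : (\sum_(l < N) p%:E)%E = _); last first.
  by rewrite sumEFin sumr_const card_ord mulr_natl.
apply: lee_sum => l _.
pose h (v : T) : \bar R := (((nm (v.1 - x) <= r)%R%:R - p) ^+ 2)%:E.
have mh : measurable_fun setT h.
  apply/measurable_EFinP/measurable_funX/measurable_funB => //.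
  apply: measurable_fun_natr_bool; apply: measurable_fun_ler => //.
  by apply: (measurable_fun_dist nm_norm); [exact: measurable_fst|exact: measurable_cst].
rewrite (_ : (fun w => _) = h \o V l); last first.
  by apply/funext => w; rewrite /h /a /sdist /= mxE.
rewrite (ge0_integral_same_law mV0 mV lawV l mh); last by move=> v; rewrite lee_fin sqr_ge0.
rewrite (_ : (fun w => _) = (fun w => (1 - 2 * p)%:E * (\1_E w)%:E + (p ^+ 2)%:E)%E); last first.
  apply/funext => w; rewrite /h /= indE -EFinM -EFinD; congr EFin.
  by rewrite /indic; case: (_ \in _) => /=; ring.
rewrite integralD//; [|exact: integrableZl|exact: finite_measure_integrable_cst].
rewrite integralZl// int_indE integral_cst//.
rewrite [X in (_ + _ * X)%E](_ : _ = 1%E); last exact: probability_setT.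
rewrite mule1 -EFinM -EFinD lee_fin.
by have := p01; nra.
Qed.

End count.

(** * Mean response over a ball as a function of its radius *)

Section ball_mean.

Let pball b r := X @^-1` xball nm x b r.

Let mpball b r : measurable (pball b r).
Proof. exact: measurable_pre_xball. Qed.

(** With c = eta(x) this is the bias over the ball. On a null ball the division by 0 gives 0, which
    is consistent with [bmeanM] and [bmean_le]. *)
Definition bmean (b : bool) (r : R) : R :=
  (\int[P]_(w in pball b r) (Y w - c)) / fine (P (pball b r)).

Let subset_pball b r r' : r <= r' -> pball b r `<=` pball b r'.
Proof.
move=> rr' w /=; rewrite /pball /xball /=; case: b => /= h.
  exact: le_trans rr'.
exact: lt_le_trans rr'.
Qed.

Let measurable_ball_integral b (G : Om -> R) : (forall w, 0 <= G w) ->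
  P.-integrable setT (EFin \o G) ->
  measurable_fun setT (fun r => \int[P]_(w in pball b r) G w).
Proof.
move=> G0 iG; apply: nondecreasing_measurable => // r r' rr'.
have iGb s : P.-integrable (pball b s) (EFin \o G) by apply: integrableS iG.
apply: fine_le; [exact: integrable_fin_num|exact: integrable_fin_num|].
apply: ge0_subset_integral => //.
- exact: measurable_int (iGb r').
- by move=> w _; rewrite lee_fin.
- exact: subset_pball.
Qed.

(** For a nonnegative integrand, the integral over a ball is monotone in the radius, hence
    measurable; Y - c is the difference of the nonnegative functions |Y - c| + (Y - c) and |Y -
    c|. *)
Lemma measurable_bmean b : measurable_fun [set: R] (bmean b).
Proof.
have idev := integrable_dev.
have iabs : P.-integrable setT (EFin \o (fun w => `|Y w - c|)).
  exact: integrable_norm.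
have isum : P.-integrable setT (EFin \o (fun w => `|Y w - c| + (Y w - c))).
  rewrite (_ : _ \o _ = (fun w => (`|Y w - c|)%:E + (Y w - c)%:E)%E)//.
  exact: integrableD.
apply: measurable_funM.
  rewrite (_ : (fun _ => _) = (fun r => \int[P]_(w in pball b r) (`|Y w - c| + (Y w - c))
      - \int[P]_(w in pball b r) `|Y w - c|)).
    apply: measurable_funB; apply: measurable_ball_integral => // w.
    by rewrite -lerBlDr sub0r -normrN ler_norm.
  apply/funext => r; rewrite -RintegralB//.
  - by apply: eq_Rintegral => w _; rewrite addrAC subrr add0r.
  - by apply: integrableS isum.
  - by apply: integrableS iabs.
rewrite (_ : (fun _ => _) = (fun r => fine (P (pball b r)) `^ (-1))); last first.
  by apply/funext => r; rewrite powR_inv1// fine_ge0.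
apply: (measurableT_comp (measurable_powR _)).
apply: nondecreasing_measurable => // r r' rr'.
apply: fine_le; rewrite ?fin_num_measure//.
by apply: le_measure; rewrite ?inE//; exact: subset_pball.
Qed.

Lemma bmeanM b r : 0 <= r ->
  \int[P]_(w in pball b r) (Y w - c) = bmean b r * fine (P (pball b r)).
Proof.
move=> r0; have [p0|p0] := eqVneq (fine (P (pball b r))) 0; last by rewrite divfK.
have := ball_mean b r0; rewrite -/(pball b r) p0 !mulr0 normr_le0 => /eqP ->.
by [].
Qed.

Lemma bmean_le b r : 0 <= r -> `|bmean b r| <= Cc * r ^+ 2.
Proof.
move=> r0; have [p0|p0] := eqVneq (fine (P (pball b r))) 0.
  by rewrite /bmean p0 invr0 mulr0 normr0 mulr_ge0// sqr_ge0.
have p0' : 0 < fine (P (pball b r)) by rewrite lt_neqAle eq_sym p0 fine_ge0.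
by rewrite /bmean normrM normfV (gtr0_norm p0') ler_pdivrMr//; exact: ball_mean.
Qed.

Let ind_pball b r w : (nm (X w - x) < r ?<= if b)%:R = \1_(pball b r) w :> R.
Proof.
rewrite /indic; case: (boolP (nm (X w - x) < r ?<= if b)) => h.
  by rewrite mem_set.
by rewrite memNset//; exact/negP.
Qed.

Lemma integrable_centered b r : P.-integrable setT
  (fun w => ((nm (X w - x) < r ?<= if b)%:R * (Y w - c - bmean b r))%:E).
Proof.
have iYm : P.-integrable setT (fun w => (Y w - c - bmean b r)%:E).
  under eq_fun do rewrite EFinB.
  by apply: integrableB => //; exact: finite_measure_integrable_cst.
apply: le_integrable iYm => //.
  apply/measurable_EFinP/measurable_funM; last by apply: measurable_funB => //;
    apply: measurable_funB.
  by under eq_fun do rewrite ind_pball; exact: measurable_indic.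
move=> w _; rewrite lee_fin normrM ler_piMl//.
by case: (_ < _ ?<= if _); rewrite ?normr1 ?normr0.
Qed.

Lemma integral_centered b r : 0 <= r -> (\int[P]_w
  ((nm (X w - x) < r ?<= if b)%:R * (Y w - c - bmean b r))%:E = 0)%E.
Proof.
move=> r0.
have iYm : P.-integrable (pball b r) (fun w => (Y w - c)%:E).
  by apply: integrableS integrable_dev.
transitivity (\int[P]_(w in pball b r) (Y w - c - bmean b r)%:E)%E.
  rewrite [RHS]integral_mkcond; apply: eq_integral => w _.
  rewrite ind_pball patchE /indic; case: ifP => _; first by rewrite mul1r.
  by rewrite mul0r.
under eq_integral do rewrite EFinB.
rewrite integralB//; last exact: finite_measure_integrable_cst.
rewrite integral_cst//.
have := bmeanM b r0; rewrite /Rintegral => h.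
rewrite -[X in (X - _)%E]fineK; last exact: integrable_fin_num.
rewrite h EFinM fineK ?fin_num_measure// subee//.
by rewrite fin_numM// fin_num_measure.
Qed.

End ball_mean.

(** * Bias and variance of the average over k neighbours *)

Section adaptive.
Variables (kf : nat -> nat) (A r0 : R).
Hypothesis kf_gt0 : forall n, (0 < kf n)%N.
Hypothesis kf_le : forall n, (n <= N)%N -> (kf n <= N)%N.
Hypothesis r0_ge0 : 0 <= r0.
Hypothesis r0A : r0 <= A.

Definition skn u : nat := kf (count_within (sdist u) A).

Definition knn_dev u : R :=
  (skn u)%:R^-1 * \sum_(l < N) (nrank (sdist u) l < skn u)%N%:R * sdev u l.

Let B := (Cc * r0 ^+ 2) ^+ 2.
Let B_ge0 : 0 <= B. Proof. exact: sqr_ge0. Qed.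

Let kn_gt0 u : 0 < (skn u)%:R :> R. Proof. by rewrite ltr0n; exact: kf_gt0. Qed.

Let kn_le u : (skn u <= N)%N. Proof. by apply: kf_le; exact: count_within_le. Qed.

Let invkn u : 0 <= ((skn u)%:R : R)^-1 <= 1.
Proof. by rewrite invr_ge0 ler0n/= invf_le1 ?ler1n //; exact: kf_gt0. Qed.

(** Marks j as the (k+1)-st neighbour. By injectivity of ranks at most one j is hit, so summing over
    j costs no factor N. *)
Let hit j u : R := (nrank (sdist u) j == skn u)%:R.

Let hit01 j u : 0 <= hit j u <= 1.
Proof. by rewrite /hit; case: eqP => _; rewrite ?lexx ?ler01. Qed.

Let hit2 j u : hit j u * hit j u = hit j u.
Proof. by rewrite /hit; case: eqP => _; rewrite ?mulr0 ?mulr1. Qed.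

Let bef01 u l j : 0 <= ((bef u l j)%:R : R) <= 1.
Proof. by case: (before _ _ _ _); rewrite ?lexx ?ler01. Qed.

Let meas_ranks (h : nat -> nat -> nat -> nat -> R) l j :
  measurable_fun [set: 'rV[T]_N] (fun u =>
    h (nrank (sdist u) l) (nrank (sdist u) j)
      (count_within (sdist u) A) (count_within (sdist u) r0)).
Proof.
exact: (measurable_ranks (delta := fun i u => sdist u i) measurable_sdist h l j A r0).
Qed.

Let measurable_bef l j : measurable_fun [set: 'rV[T]_N] (fun u => (bef u l j)%:R : R).
Proof.
apply: measurable_fun_natr_bool.
exact: (measurable_before (delta := fun i u => sdist u i) measurable_sdist).
Qed.

Let measurable_hit j : measurable_fun setT (hit j).
Proof. exact: (meas_ranks (fun _ rj wA _ => (rj == kf wA)%:R) j j). Qed.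

Let meas_count_within (h : nat -> nat -> R) : measurable_fun [set: 'rV[T]_N]
  (fun u => h (count_within (sdist u) A) (count_within (sdist u) r0)).
Proof.
exact: (measurable_count_within (delta := fun i u => sdist u i) measurable_sdist h A r0).
Qed.

Let measurable_invkn : measurable_fun setT (fun u => (skn u)%:R^-1 : R).
Proof. exact: (meas_count_within (fun wA _ => (kf wA)%:R^-1)). Qed.

(* Centred response of [l], on the event that [l] precedes [j]; when [j] is the
   (k+1)-st neighbour, [bmean] is the conditional mean of the response of [l]. *)
Let zeta (j l : 'I_N) u : R := (sdist u j <= r0)%R%:R * (bef u l j)%:R *
  (sdev u l - bmean (l < j)%N (sdist u j)).

Let xi (j l : 'I_N) u : R := hit j u / (skn u)%:R * zeta j l u.

Let measurable_zeta j l : measurable_fun setT (zeta j l).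
Proof.
apply: measurable_funM; first apply: measurable_funM => //.
- apply: measurable_fun_natr_bool; apply: measurable_fun_ler => //.
  exact: measurable_sdist.
- apply: measurable_funB; first exact: measurable_sdev.
  by apply: measurableT_comp; [exact: measurable_bmean|exact: measurable_sdist].
Qed.

Let measurable_xi j l : measurable_fun setT (xi j l).
Proof.
apply: measurable_funM => //; exact: measurable_funM.
Qed.

Let bmean_sqr_le (j : 'I_N) b u : sdist u j <= r0 -> bmean b (sdist u j) ^+ 2 <= B.
Proof.
move=> jr0; have s0 : 0 <= sdist u j by exact: is_norm_ge0.
rewrite -real_normK ?num_real// /B lerXn2r ?nnegrE ?mulr_ge0 ?sqr_ge0//.
apply: (le_trans (bmean_le _ s0)); rewrite ler_wpM2l//.
by rewrite lerXn2r ?nnegrE.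
Qed.

Let dom_ge0 u l : 0 <= 2 * sdev u l ^+ 2 + 2 * B.
Proof. by apply: addr_ge0; apply: mulr_ge0; rewrite ?ler0n ?sqr_ge0. Qed.

Let zeta_sqr_le j l u :
  zeta j l u ^+ 2 <= (bef u l j)%:R * (2 * sdev u l ^+ 2 + 2 * B).
Proof.
rewrite /zeta; case: (leP (sdist u j) r0) => jr0; last first.
  by rewrite !mul0r expr0n/= mulr_ge0 ?ler0n.
case: (before _ _ _ _); last by rewrite mulr0 !mul0r expr0n.
rewrite !mul1r; have := bmean_sqr_le (l < j)%N jr0.
set m := bmean _ _; set z := sdev u l => mB.
have : 0 <= (z + m) ^+ 2 by exact: sqr_ge0.
by move: mB; rewrite !expr2; nra.
Qed.

Let integrable_cst_P (C : R) : P.-integrable setT (fun w => C%:E : \bar R).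
Proof. exact: finite_measure_integrable_cst. Qed.

Let integrable_dom l : P.-integrable setT
  (fun w => (2 * sdev (smp w) l ^+ 2 + 2 * B)%:E).
Proof.
under eq_fun do rewrite EFinD EFinM.
by apply: integrableD => //; exact: integrableZl.
Qed.

Let integrable_zeta2 j l : P.-integrable setT (fun w => (zeta j l (smp w) ^+ 2)%:E).
Proof.
apply: le_integrable (integrable_dom l) => //.
  by apply/measurable_EFinP/measurable_funX; exact: measurableT_comp msmp.
move=> w _; rewrite lee_fin ger0_norm ?sqr_ge0//.
apply: (le_trans (zeta_sqr_le _ _ _)); apply: le_trans (ler_norm _).
apply: ler_piMl; last by case/andP: (bef01 (smp w) l j).
exact: dom_ge0.
Qed.

Let integrable_weight_zeta2 (h : 'rV[T]_N -> R) j l : measurable_fun setT h ->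
  (forall u, 0 <= h u <= 1) ->
  P.-integrable setT (fun w => ((h (smp w) * zeta j l (smp w)) ^+ 2)%:E).
Proof.
move=> mh h01; apply: le_integrable (integrable_zeta2 j l) => //.
  apply/measurable_EFinP/measurable_funX/measurable_funM; exact: measurableT_comp msmp.
move=> w _; rewrite lee_fin !ger0_norm ?sqr_ge0// exprMn ler_piMl ?sqr_ge0//.
by have /andP[? ?] := h01 (smp w); rewrite expr_le1.
Qed.

(* As long as [l] precedes [j], the position of the sample [l] influences neither
   the rank of [j] nor the number of samples in B(x, A), hence not k either: this
   makes the centred responses orthogonal in [xi_orth]. *)
Let resample_inv j l u v v' : l != j -> sdist u j <= A ->
  bef (upd_row l u v) l j -> bef (upd_row l u v') l j ->
  nrank (sdist (upd_row l u v)) j = nrank (sdist (upd_row l u v')) j /\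
  count_within (sdist (upd_row l u v)) A = count_within (sdist (upd_row l u v')) A.
Proof.
move=> lj jA bv bv'; have jE v1 : sdist (upd_row l u v1) j = sdist u j.
  by rewrite sdist_upd eq_sym (negbTE lj).
split.
  apply: eq_bigr => i _; have [->|il] := eqVneq i l; first by rewrite bv bv'.
  by rewrite !sdist_upd (negbTE il) [j == l]eq_sym (negbTE lj).
apply: eq_bigr => i _; have [->|il] := eqVneq i l; last by rewrite !sdist_upd (negbTE il).
have wA v1 : bef (upd_row l u v1) l j -> sdist (upd_row l u v1) l <= A.
  by move/before_le; rewrite jE => /le_trans; apply.
by rewrite (wA _ bv) (wA _ bv').
Qed.

Let a_coef j u : R := hit j u / (skn u)%:R.

Let a_coef01 j u : 0 <= a_coef j u <= 1.
Proof.
have /andP[h0 h1] := hit01 j u; have /andP[k0 k1] := invkn u.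
by rewrite /a_coef mulr_ge0//= mulr_ile1.
Qed.

Let measurable_a_coef j : measurable_fun setT (a_coef j).
Proof. exact: measurable_funM. Qed.

(** As the redrawn l varies, only its own centred response varies: while l precedes j,
    [resample_inv] freezes k and the rank of j, and elsewhere both sides vanish. *)
Let zeta_upd j l u : l != j -> exists g : R, forall v,
  a_coef j (upd_row l u v) / (skn (upd_row l u v))%:R * zeta j l (upd_row l u v) =
  g * ((nm (v.1 - x) < sdist u j ?<= if (l < j)%N)%:R *
       (v.2 - c - bmean (l < j)%N (sdist u j))).
Proof.
move=> lj; have jl : (j == l) = false by rewrite eq_sym (negbTE lj).
pose th v := a_coef j (upd_row l u v) / (skn (upd_row l u v))%:R.
have befE v : bef (upd_row l u v) l j = (nm (v.1 - x) < sdist u j ?<= if (l < j)%N).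
  by rewrite !sdist_upd eqxx jl beforeE.
(* The constant g is the weight at any admissible draw v0; without one, the left-hand side vanishes
   for every draw. *)
have [[v0 [jr0 b0]]|nv] := pselect (exists v0,
    sdist u j <= r0 /\ bef (upd_row l u v0) l j).
  exists (th v0) => v; rewrite -/(th v) /zeta befE sdist_upd jl jr0 mul1r.
  rewrite sdev_upd eqxx; case: (boolP (_ < _ ?<= if _)) => bv; last by rewrite !(mul0r, mulr0).
  rewrite -befE in bv; congr (_ * _).
  have [nE wE] := resample_inv lj (le_trans jr0 r0A) bv b0.
  by rewrite /th /a_coef /hit /skn nE wE.
exists 0 => v; rewrite mul0r /zeta.
case: (boolP (bef (upd_row l u v) l j)) => bv; last by rewrite !(mul0r, mulr0).
case: (leP (sdist (upd_row l u v) j) r0) => jr0; last by rewrite !(mul0r, mulr0).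
by exfalso; apply: nv; exists v; rewrite sdist_upd jl in jr0.
Qed.

Let xi_orth j l l' : l != l' ->
  (\int[P]_w (xi j l (smp w) * xi j l' (smp w))%:E = 0)%E.
Proof.
move=> ll'; have [->|lj] := eqVneq l j.
  rewrite integral0_eq// => w _; rewrite /xi /zeta before_irr.
  by rewrite !(mul0r, mulr0).
(* Since [hit] is idempotent, both weights can be attached to the factor of l; the other factor,
   [zeta j l'], does not see sample l. *)
pose a u := a_coef j u / (skn u)%:R * zeta j l u.
have ma : measurable_fun setT a.
  by apply: measurable_funM => //; exact: measurable_funM.
rewrite (_ : (fun w => _) = (fun w => (a (smp w) * zeta j l' (smp w))%:E)); last first.
  apply/funext => w; congr EFin; rewrite /a /xi /a_coef.
  rewrite -[in RHS](hit2 j (smp w)); ring.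
have aw u : 0 <= a_coef j u / (skn u)%:R <= 1.
  have /andP[h0 h1] := a_coef01 j u; have /andP[k0 k1] := invkn u.
  by rewrite mulr_ge0//= mulr_ile1.
apply: (orthogonal_resample (l := l)) => //.
- apply: (@integrable_weight_zeta2 (fun u => a_coef j u / (skn u)%:R) j l) => //.
  exact: measurable_funM.
- move=> u v; have l'l : (l' == l) = false by rewrite eq_sym (negbTE ll').
  have jl : (j == l) = false by rewrite eq_sym (negbTE lj).
  by rewrite /zeta !sdist_upd sdev_upd l'l jl.
- move=> u; have [g gE] := zeta_upd u lj.
  under eq_fun do rewrite /a gE EFinM.
  apply: integrableZl => //; exact: integrable_centered.
- move=> u; have [g gE] := zeta_upd u lj.
  under eq_integral do rewrite /a gE EFinM.
  rewrite integralZl//; last exact: integrable_centered.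
  by rewrite integral_centered ?mule0//; exact: is_norm_ge0.
Qed.

(** Jensen's inequality for the uniform weights on the k neighbours, obtained by expanding the
    nonnegative weighted variance of their deviations. *)
Lemma knn_dev_sqr_le u : knn_dev u ^+ 2 <=
  \sum_(l < N) ((nrank (sdist u) l < skn u)%N%:R / (skn u)%:R) * sdev u l ^+ 2.
Proof.
set wt := fun l => (nrank (sdist u) l < skn u)%N%:R / (skn u)%:R : R.
have wt0 l : 0 <= wt l by rewrite divr_ge0 ?ler0n.
have wt1 : \sum_(l < N) wt l = 1.
  by rewrite -mulr_suml card_nrank_lt// divff// gt_eqF.
have devE : knn_dev u = \sum_(l < N) wt l * sdev u l.
  rewrite /knn_dev mulr_sumr; apply: eq_bigr => l _.
  by rewrite /wt mulrA [_^-1 * _]mulrC.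
set m := knn_dev u in devE *.
have : 0 <= \sum_(l < N) wt l * (sdev u l - m) ^+ 2.
  by apply: sumr_ge0 => l _; rewrite mulr_ge0// sqr_ge0.
rewrite (_ : \sum_(l < N) _ = \sum_(l < N) wt l * sdev u l ^+ 2
    - 2 * m * (\sum_(l < N) wt l * sdev u l) + m ^+ 2 * \sum_(l < N) wt l).
  by rewrite -devE wt1 mulr1 -mulrA -expr2; lra.
rewrite !mulr_sumr -sumrB -big_split/=; apply: eq_bigr => l _; ring.
Qed.

Lemma measurable_knn_dev : measurable_fun setT knn_dev.
Proof.
apply: measurable_funM => //.
apply: measurable_sum => l; apply: measurable_funM; last exact: measurable_sdev.
exact: (meas_ranks (fun rl _ wA _ => (rl < kf wA)%N%:R) l l).
Qed.

Let upd_fst u i v v' : v.1 = v'.1 ->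
  sdist (upd_row i u v) = sdist (upd_row i u v').
Proof. by move=> vv'; apply/funext => l; rewrite !sdist_upd vv'. Qed.

(** After Jensen's inequality each weight depends on positions only, so a squared response costs C1,
    and the weights of the k neighbours sum to 1. It controls the event of too few samples near x
    and, with b always true, gives the bound O(1). *)
Lemma knn_dev_second_moment (b : nat -> nat -> bool) :
  (\int[P]_w ((b (count_within (sdist (smp w)) A) (count_within (sdist (smp w)) r0))%:R
       * knn_dev (smp w) ^+ 2)%:E <=
   C1%:E * \int[P]_w
     (b (count_within (sdist (smp w)) A) (count_within (sdist (smp w)) r0))%:R%:E)%E.
Proof.
pose bb u : R := (b (count_within (sdist u) A) (count_within (sdist u) r0))%:R.
pose wt l u := bb u * ((nrank (sdist u) l < skn u)%N%:R / (skn u)%:R).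
have mwt l : measurable_fun setT (wt l).
  exact: (meas_ranks (fun rl _ wA wr => (b wA wr)%:R * ((rl < kf wA)%N%:R / (kf wA)%:R)) l l).
have wt0 l u : 0 <= wt l u by rewrite mulr_ge0 ?ler0n// divr_ge0 ?ler0n.
have mwtd l : measurable_fun setT (fun w => (wt l (smp w) * sdev (smp w) l ^+ 2)%:E).
  apply/measurable_EFinP/(measurableT_comp _ msmp (f := fun u => wt l u * sdev u l ^+ 2)).
  by apply: measurable_funM => //; apply: measurable_funX; exact: measurable_sdev.
have mwts l : measurable_fun setT (fun w => (wt l (smp w))%:E).
  by apply/measurable_EFinP/measurableT_comp.
have mbb : measurable_fun setT bb.
  exact: (meas_count_within (fun wA wr => (b wA wr)%:R)).
apply: (@le_trans _ _ (\int[P]_w \sum_(l < N) (wt l (smp w) * sdev (smp w) l ^+ 2)%:E)%E).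
  apply: ge0_le_integral => //.
  - by move=> w _; rewrite lee_fin mulr_ge0 ?ler0n ?sqr_ge0.
  - apply/measurable_EFinP/(measurableT_comp _ msmp (f := fun u => bb u * knn_dev u ^+ 2)).
    by apply: measurable_funM; [|apply: measurable_funX; exact: measurable_knn_dev].
  - exact: emeasurable_sum.
  - move=> w _; rewrite sumEFin lee_fin /wt.
    under eq_bigr do rewrite -mulrA.
    by rewrite -mulr_sumr ler_wpM2l ?ler0n// knn_dev_sqr_le.
rewrite ge0_integral_sum//; last by move=> l w _; rewrite lee_fin mulr_ge0 ?sqr_ge0.
apply: (@le_trans _ _ (\sum_(l < N) (C1%:E * \int[P]_w (wt l (smp w))%:E))%E).
  apply: lee_sum => l _; apply: integral_weight_sdev => // u v v' vv'.
  by rewrite /wt /bb /skn (upd_fst _ _ vv').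
rewrite -ge0_sume_distrr; last by move=> l _; apply: integral_ge0 => w _; rewrite lee_fin.
rewrite -ge0_integral_sum//; last by move=> l w _; rewrite lee_fin.
apply: lee_wpmul2l; first by rewrite lee_fin.
apply: ge0_le_integral => //.
- by move=> w _; apply: sume_ge0 => l _; rewrite lee_fin.
- exact: emeasurable_sum.
- by apply/measurable_EFinP; exact: measurableT_comp mbb msmp.
move=> w _; rewrite sumEFin lee_fin -mulr_sumr -mulr_suml card_nrank_lt//.
by rewrite divff ?mulr1// gt_eqF.
Qed.

(* [S] is the fluctuation and [E] the bias of the average of the neighbours. *)
Let hit_dev_le j u : nrank (sdist u) j = skn u -> sdist u j <= r0 ->
  knn_dev u ^+ 2 <= 2 * (\sum_(l < N) xi j l u) ^+ 2 + 2 * B.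
Proof.
move=> jk jr0; have kn0 : (skn u)%:R != 0 :> R by rewrite gt_eqF.
set S := \sum_(l < N) _.
pose E := (skn u)%:R^-1 * \sum_(l < N) (bef u l j)%:R * bmean (l < j)%N (sdist u j).
have -> : knn_dev u = S + E.
  rewrite /knn_dev /S /E !mulr_sumr -big_split/=; apply: eq_bigr => l _.
  rewrite /xi /zeta /hit jk eqxx jr0 !mul1r -[in X in X%:R * sdev _ _]jk nrank_lt.
  by rewrite -!mulrDr subrK.
have EB : `|E| <= Cc * r0 ^+ 2.
  rewrite /E normrM ger0_norm ?invr_ge0// mulrC ler_pdivrMr//.
  apply: (le_trans (ler_norm_sum _ _ _)).
  rewrite -jk -sum_before mulr_sumr; apply: ler_sum => l _.
  rewrite normrM ger0_norm ?ler0n// mulrC ler_wpM2r ?ler0n//.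
  apply: (le_trans (bmean_le _ (is_norm_ge0 nm_norm _))); rewrite ler_wpM2l//.
  by rewrite lerXn2r ?nnegrE// is_norm_ge0.
have : E ^+ 2 <= B.
  by rewrite -real_normK ?num_real// /B lerXn2r ?nnegrE ?mulr_ge0 ?sqr_ge0.
have := sqr_ge0 (S - E); rewrite !expr2; nra.
Qed.

(** Either at most k samples lie within r0, or the (k+1)-st neighbour is some j within r0, and the
    term of this j alone dominates by [hit_dev_le]. *)
Let knn_dev_split u : knn_dev u ^+ 2 <=
  (count_within (sdist u) r0 <= skn u)%N%:R * knn_dev u ^+ 2 +
  \sum_(j < N) (2 * (\sum_(l < N) xi j l u) ^+ 2 + 2 * B * hit j u).
Proof.
have t0 j : 0 <= 2 * (\sum_(l < N) xi j l u) ^+ 2 + 2 * B * hit j u.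
  by have /andP[h0 _] := hit01 j u; rewrite addr_ge0// mulr_ge0// ?sqr_ge0// mulr_ge0.
case: leqP => [_|kr]; first by rewrite mul1r lerDl sumr_ge0.
rewrite mul0r add0r; have [j jk jr0] := nrank_count_within kr.
rewrite (bigD1 j)//= (le_trans (hit_dev_le jk jr0))//.
by rewrite /hit jk eqxx mulr1 lerDl sumr_ge0.
Qed.

Let sum_hit_le1 u : \sum_(j < N) hit j u <= 1.
Proof.
have [/existsP[j /eqP jk]|/existsPn nj] := boolP [exists j, nrank (sdist u) j == skn u].
  rewrite (bigD1 j)//= big1 ?addr0; first by case/andP: (hit01 j u).
  move=> i ij; rewrite /hit -jk; case: eqP => // /nrank_inj e.
  by rewrite e eqxx in ij.
by rewrite big1// => j _; rewrite /hit (negbTE (nj j)).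
Qed.

Let mfin (h : 'rV[T]_N -> R) : measurable_fun setT h ->
  measurable_fun setT (fun w => (h (smp w))%:E).
Proof. by move=> mh; apply/measurable_EFinP; exact: measurableT_comp mh msmp. Qed.

Let xi_second_moment j l :
  (\int[P]_w (xi j l (smp w) ^+ 2)%:E <=
   \int[P]_w ((2 * C1 + 2 * B) *
     (a_coef j (smp w) / (skn (smp w))%:R * (bef (smp w) l j)%:R))%:E)%E.
Proof.
pose wt u := a_coef j u / (skn u)%:R * (bef u l j)%:R.
have wt0 u : 0 <= wt u.
  have /andP[h0 _] := a_coef01 j u; have /andP[k0 _] := invkn u.
  by rewrite mulr_ge0 ?ler0n// mulr_ge0.
have mwt : measurable_fun setT wt.
  by apply: measurable_funM => //; exact: measurable_funM.
have ms2 : measurable_fun setT (fun u => wt u * sdev u l ^+ 2).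
  by apply: measurable_funM => //; apply: measurable_funX; exact: measurable_sdev.
have b2 : 0 <= 2 * B by rewrite mulr_ge0.
have mws2 := mfin ms2; have mwt' := mfin mwt.
apply: (@le_trans _ _ (\int[P]_w (2%:E * (wt (smp w) * sdev (smp w) l ^+ 2)%:E
    + (2 * B)%:E * (wt (smp w))%:E))%E).
  apply: ge0_le_integral => //.
  - by move=> w _; rewrite lee_fin sqr_ge0.
  - by apply: (mfin (h := fun u => xi j l u ^+ 2)); exact: measurable_funX.
  - by apply: emeasurable_funD; exact: emeasurable_funM.
  - move=> w _; rewrite -!EFinM -EFinD lee_fin.
    have xiE : xi j l (smp w) ^+ 2 = a_coef j (smp w) / (skn (smp w))%:R * zeta j l (smp w) ^+ 2.
      rewrite /xi /a_coef -[in RHS](hit2 j (smp w)); ring.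
    have /andP[h0 _] := a_coef01 j (smp w); have /andP[k0 _] := invkn (smp w).
    rewrite xiE (le_trans (ler_wpM2l _ (zeta_sqr_le _ _ _))) ?mulr_ge0// /wt.
    by rewrite le_eqVlt; apply/orP; left; apply/eqP; ring.
have wts w : (0 <= (wt (smp w) * sdev (smp w) l ^+ 2)%:E)%E.
  by rewrite lee_fin mulr_ge0 ?sqr_ge0.
rewrite ge0_integralD//; first last.
- exact: emeasurable_funM.
- by move=> w _; rewrite mule_ge0// lee_fin.
- exact: emeasurable_funM.
- by move=> w _; rewrite mule_ge0.
rewrite ge0_integralZl//.
rewrite ge0_integralZl//; last by move=> w _; rewrite lee_fin.
under [leRHS]eq_integral do rewrite EFinM.
rewrite [leRHS]ge0_integralZl//; first last.
- by rewrite lee_fin addr_ge0// mulr_ge0.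
- by move=> w _; rewrite lee_fin; exact: wt0.
rewrite (EFinD (2 * C1)) [leRHS]ge0_muleDl ?lee_fin ?mulr_ge0//.
apply: leeD => //; rewrite EFinM -muleA lee_wpmul2l//.
apply: integral_weight_sdev => // u v v' vv'.
by rewrite /wt /a_coef /hit /skn !(upd_fst _ _ vv').
Qed.

Lemma knn_dev_bias_variance :
  (\int[P]_w (knn_dev (smp w) ^+ 2)%:E <=
   \int[P]_w (C1 * (count_within (sdist (smp w)) r0 <= skn (smp w))%N%:R
     + 4 * C1 / (skn (smp w))%:R + 6 * B)%:E)%E.
Proof.
pose bad u : R := (count_within (sdist u) r0 <= skn u)%N%:R.
have mbad : measurable_fun setT bad.
  exact: (meas_count_within (fun wA wr => (wr <= kf wA)%N%:R)).
have mdev2 : measurable_fun setT (fun u => knn_dev u ^+ 2).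
  by apply: measurable_funX; exact: measurable_knn_dev.
pose t j u := 2 * (\sum_(l < N) xi j l u) ^+ 2 + 2 * B * hit j u.
have mS j : measurable_fun setT (fun u => \sum_(l < N) xi j l u).
  exact: measurable_sum.
have mt j : measurable_fun setT (t j).
  by apply: measurable_funD; apply: measurable_funM => //; exact: measurable_funX.
have B2 : 0 <= 2 * B by rewrite mulr_ge0.
have t0 j u : 0 <= t j u.
  by have /andP[h0 _] := hit01 j u; rewrite addr_ge0// mulr_ge0// sqr_ge0.
have bd0 w : (0 <= (bad (smp w) * knn_dev (smp w) ^+ 2)%:E)%E.
  by rewrite lee_fin mulr_ge0 ?ler0n ?sqr_ge0.
apply: (@le_trans _ _ (\int[P]_w ((bad (smp w) * knn_dev (smp w) ^+ 2)%:E
    + \sum_(j < N) (t j (smp w))%:E))%E).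
  apply: ge0_le_integral => //.
  - by move=> w _; rewrite lee_fin sqr_ge0.
  - exact: (mfin mdev2).
  - apply: emeasurable_funD; last by apply: emeasurable_sum => j; exact: mfin.
    by apply: (mfin (h := fun u => bad u * knn_dev u ^+ 2)); exact: measurable_funM.
  - by move=> w _; rewrite sumEFin -EFinD lee_fin; exact: knn_dev_split.
rewrite ge0_integralD//; first last.
- by apply: emeasurable_sum => j; exact: mfin.
- by move=> w _; apply: sume_ge0 => j _; rewrite lee_fin.
- by apply: (mfin (h := fun u => bad u * knn_dev u ^+ 2)); exact: measurable_funM.
rewrite ge0_integral_sum//; first last.
- by move=> j w _; rewrite lee_fin.
- by move=> j; exact: mfin.
(* From 2 (2 C1 + 2 B) [a_coef] + 2 B [hit], using [a_coef] <= [hit] for the terms in B. *)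
pose s j u := 4 * C1 * a_coef j u + 6 * B * hit j u.
have ms j : measurable_fun setT (s j).
  by apply: measurable_funD; exact: measurable_funM.
have C4 : 0 <= 4 * C1 by rewrite mulr_ge0.
have B6 : 0 <= 6 * B by rewrite mulr_ge0.
have s0 j u : 0 <= s j u.
  have /andP[h0 _] := hit01 j u; have /andP[a0 _] := a_coef01 j u.
  by rewrite addr_ge0// mulr_ge0.
have ts j : (\int[P]_w (t j (smp w))%:E <= \int[P]_w (s j (smp w))%:E)%E.
  have -> : (\int[P]_w (t j (smp w))%:E =
      2%:E * \sum_(l < N) \int[P]_w (xi j l (smp w) ^+ 2)%:E
      + \int[P]_w (2 * B * hit j (smp w))%:E)%E.
    rewrite -integral_sum_sqr.
    - rewrite -ge0_integralZl//.
      + rewrite -ge0_integralD//.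
        * by move=> w _; rewrite mule_ge0// lee_fin sqr_ge0.
        * apply: emeasurable_funM => //; apply: (mfin (h :=
          fun u => (\sum_(l < N) xi j l u) ^+ 2)).
          exact: measurable_funX.
        * by move=> w _; have /andP[h0 _] := hit01 j (smp w); rewrite lee_fin mulr_ge0.
        * by apply: (mfin (h := fun u => 2 * B * hit j u)); exact: measurable_funM.
      + by apply: (mfin (h := fun u => (\sum_(l < N) xi j l u) ^+ 2)); exact: measurable_funX.
      + by move=> w _; rewrite lee_fin sqr_ge0.
    - by move=> l; exact: measurableT_comp (measurable_xi j l) msmp.
    - by move=> l; exact: (integrable_weight_zeta2 j l (measurable_a_coef j) (a_coef01 j)).
    - by move=> l l' ll'; exact: xi_orth.
  have sum_xi : (\sum_(l < N) \int[P]_w (xi j l (smp w) ^+ 2)%:E <=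
      \int[P]_w ((2 * C1 + 2 * B) * a_coef j (smp w))%:E)%E.
    pose v l u := (2 * C1 + 2 * B) * (a_coef j u / (skn u)%:R * (bef u l j)%:R).
    have mv l : measurable_fun setT (v l).
      by apply: measurable_funM => //; apply: measurable_funM => //; exact: measurable_funM.
    apply: (@le_trans _ _ (\sum_(l < N) \int[P]_w (v l (smp w))%:E)%E).
      by apply: lee_sum => l _; exact: xi_second_moment.
    have C20 : 0 <= 2 * C1 + 2 * B by rewrite addr_ge0// mulr_ge0.
    rewrite -ge0_integral_sum//; first last.
    - move=> l w _; have /andP[a0 _] := a_coef01 j (smp w); have /andP[k0 _] := invkn (smp w).
      by rewrite lee_fin mulr_ge0// mulr_ge0 ?ler0n// mulr_ge0.
    - by move=> l; exact: mfin.
    rewrite le_eqVlt; apply/orP; left; apply/eqP; apply: eq_integral => w _.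
    (* When j is hit it has exactly k predecessors l, which cancel one of the two factors 1/k; what
       remains is the variance of order 1/k. *)
    rewrite sumEFin -!mulr_sumr sum_before; congr ((_ * _)%:E).
    rewrite /a_coef /hit; case: eqP => [->|_]; last by rewrite !mul0r.
    by rewrite divfK// gt_eqF.
  apply: (le_trans (leeD (lee_wpmul2l _ sum_xi) (lexx _))) => //.
  rewrite -ge0_integralZl//; first last.
  - by move=> w _; have /andP[a0 _] := a_coef01 j (smp w);
      rewrite lee_fin mulr_ge0// addr_ge0// mulr_ge0.
  - by apply: (mfin (h := fun u => (2 * C1 + 2 * B) * a_coef j u)); exact: measurable_funM.
  rewrite -ge0_integralD//; first last.
  - by apply: (mfin (h := fun u => 2 * B * hit j u)); exact: measurable_funM.
  - by move=> w _; have /andP[h0 _] := hit01 j (smp w); rewrite lee_fin mulr_ge0.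
  - by apply: emeasurable_funM => //; apply: (mfin (h :=
      fun u => (2 * C1 + 2 * B) * a_coef j u)); exact: measurable_funM.
  - by move=> w _; have /andP[a0 _] := a_coef01 j (smp w);
      rewrite mule_ge0// lee_fin mulr_ge0// addr_ge0// mulr_ge0.
  apply: ge0_le_integral => //.
  - move=> w _; have /andP[a0 _] := a_coef01 j (smp w); have /andP[h0 _] := hit01 j (smp w).
    by rewrite adde_ge0// ?mule_ge0// lee_fin mulr_ge0// addr_ge0// mulr_ge0.
  - apply: emeasurable_funD; last by apply: (mfin (h := fun u => 2 * B * hit j u));
      exact: measurable_funM.
    by apply: emeasurable_funM => //; apply: (mfin (h :=
      fun u => (2 * C1 + 2 * B) * a_coef j u)); exact: measurable_funM.
  - exact: mfin.
  move=> w _; rewrite -EFinM -EFinD lee_fin /s.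
  have ah : a_coef j (smp w) <= hit j (smp w).
    have /andP[h0 _] := hit01 j (smp w); have /andP[_ k1] := invkn (smp w).
    by rewrite /a_coef ler_piMr.
  have := ler_wpM2l B_ge0 ah; lra.
apply: (@le_trans _ _ (C1%:E * \int[P]_w (bad (smp w))%:E
    + \sum_(j < N) \int[P]_w (s j (smp w))%:E)%E).
  by apply: leeD; [exact: (knn_dev_second_moment (fun wA wr => (wr <= kf wA)%N))|exact: lee_sum].
rewrite -ge0_integral_sum//; first last.
- by move=> j w _; rewrite lee_fin.
- by move=> j; exact: mfin.
rewrite -ge0_integralZl//; first last.
- by move=> w _; rewrite lee_fin.
- exact: mfin.
rewrite -ge0_integralD//; first last.
- by apply: emeasurable_sum => j; exact: mfin.
- by move=> w _; apply: sume_ge0 => j _; rewrite lee_fin.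
- by apply: emeasurable_funM => //; exact: mfin.
- by move=> w _; rewrite mule_ge0 ?lee_fin// ler0n.
apply: ge0_le_integral => //.
- move=> w _; rewrite adde_ge0//; first by rewrite mule_ge0 ?lee_fin// ler0n.
  by apply: sume_ge0 => j _; rewrite lee_fin.
- apply: emeasurable_funD; first by apply: emeasurable_funM => //; exact: mfin.
  by apply: emeasurable_sum => j; exact: mfin.
- apply: (mfin (h := fun u => C1 * bad u + 4 * C1 / (skn u)%:R + 6 * B)).
  by apply: measurable_funD => //; apply: measurable_funD; exact: measurable_funM.
move=> w _; rewrite sumEFin -EFinM -EFinD lee_fin -addrA lerD2l.
rewrite /s big_split/= -!mulr_sumr; apply: lerD.
  by rewrite /a_coef -mulr_suml ler_wpM2l// ler_piMl.
exact: ler_piMr.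
Qed.

End adaptive.

End nearest_neighbours_at_a_point.

(** * Pointwise rate *)

Section count_bounds.
Context {R : realType}.
Variables (K q : R).
Hypothesis K_gt0 : 0 < K.
Hypothesis q01 : 0 < q < 1.

Definition knn_number (n : nat) : nat := (Num.truncn (K * n%:R `^ q)).+1.

Lemma knn_number_gt n : K * n%:R `^ q < (knn_number n)%:R.
Proof. exact: truncnS_gt. Qed.

Lemma knn_number_le n : (knn_number n)%:R <= K * n%:R `^ q + 1.
Proof.
rewrite /knn_number -natr1 lerD2r truncn_le.
by rewrite mulr_ge0 ?powR_ge0 ?ltW.
Qed.

Let two_powR_le : 2 `^ q <= 2 :> R.
Proof.
by have /andP[_ q1] := q01; rewrite -[leRHS]powRr1// ler_powR ?ler1n// ltW.
Qed.

Let q_ge0 : 0 <= q. Proof. by have /andP[/ltW] := q01. Qed.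

Variables (a b : R) (n m : nat).
Hypothesis a_ge1 : 1 <= a.
Hypothesis ab : 2 * (2 * K + 1) * a `^ q <= b.

Let a_gt0 : 0 < a. Proof. exact: lt_le_trans a_ge1. Qed.

Let aq_ge1 : 1 <= a `^ q.
Proof. by rewrite -(powRr0 a) ler_powR. Qed.

Let b_gt0 : 0 < b.
Proof.
by apply: lt_le_trans ab; rewrite !mulr_gt0 ?addr_gt0 ?mulr_gt0 ?powR_gt0.
Qed.

(* Chebyshev's inequality in pointwise form: here [a] and [b] are the means of
   the numbers [n] and [m] of samples in B(x, A) and B(x, r0). *)
Lemma too_few_le : (m <= knn_number n)%N%:R <=
  (n%:R - a) ^+ 2 / a ^+ 2 + 4 * ((m%:R - b) ^+ 2 / b ^+ 2).
Proof.
have s1 : 0 <= (n%:R - a) ^+ 2 / a ^+ 2 by rewrite divr_ge0 ?sqr_ge0.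
have s2 : 0 <= (m%:R - b) ^+ 2 / b ^+ 2 by rewrite divr_ge0 ?sqr_ge0.
case: leqP => [mk|_]; last by rewrite addr_ge0// mulr_ge0.
rewrite -[leLHS]/(1 : R); have [na|an] := leP n%:R (2 * a).
  (* For n <= 2a, k <= K (2a)^q + 1, where 2^q <= 2 and 1 <= a^q. By [ab] this is at most b / 2, so
     m misses its mean by at least half of it. *)
  have kle : (knn_number n)%:R <= (2 * K + 1) * a `^ q.
    apply: (le_trans (knn_number_le n)).
    have : n%:R `^ q <= 2 * a `^ q.
      apply: (@le_trans _ _ ((2 * a) `^ q)).
        by apply: ge0_ler_powR; rewrite ?nnegrE ?mulr_ge0// ltW.
      by rewrite powRM ?(ltW a_gt0)// ler_wpM2r ?powR_ge0.
    move=> /(ler_wpM2l (ltW K_gt0)); move: aq_ge1; lra.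
  have mb : m%:R <= b / 2.
    have : (m%:R : R) <= (knn_number n)%:R by rewrite ler_nat.
    by move: kle ab; lra.
  have : 1 <= 4 * ((m%:R - b) ^+ 2 / b ^+ 2); last by move: s1; lra.
  rewrite mulrA ler_pdivlMr ?exprn_gt0// mul1r !expr2; move: mb b_gt0; nra.
have : 1 <= (n%:R - a) ^+ 2 / a ^+ 2; last by move: s2; lra.
by rewrite ler_pdivlMr ?exprn_gt0// mul1r !expr2; move: an a_gt0; nra.
Qed.

(** If n >= a / 2, then k >= K a^q / 2. Otherwise n misses its mean by more than half of it, so the
    second summand exceeds 1, a bound for 1/k. *)
Lemma inv_knn_number_le : (knn_number n)%:R^-1 <=
  2 / K * a `^ (- q) + 4 * ((n%:R - a) ^+ 2 / a ^+ 2).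
Proof.
have s1 : 0 <= (n%:R - a) ^+ 2 / a ^+ 2 by rewrite divr_ge0 ?sqr_ge0.
have s2 : 0 <= 2 / K * a `^ (- q) by rewrite mulr_ge0 ?powR_ge0// divr_ge0 ?ltW.
have [na|an] := ltP n%:R (a / 2).
  have k1 : (knn_number n)%:R^-1 <= 1 :> R by rewrite invf_le1 ?ler1n ?ltr0n.
  apply: (le_trans k1).
  have : 1 <= 4 * ((n%:R - a) ^+ 2 / a ^+ 2); last by move: s2; lra.
  by rewrite mulrA ler_pdivlMr ?exprn_gt0// mul1r !expr2; move: na a_gt0; nra.
have aq0 : 0 < a `^ q by rewrite powR_gt0.
have h : K * a `^ q / 2 <= (knn_number n)%:R.
  apply: le_trans (ltW (knn_number_gt n)); rewrite -mulrA ler_pM2l//.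
  apply: (@le_trans _ _ ((a / 2) `^ q)); last first.
    by apply: ge0_ler_powR; rewrite ?nnegrE ?divr_ge0// ltW.
  rewrite powRM ?invr_ge0 ?(ltW a_gt0)// ler_pM2l//.
  have -> : 2^-1 `^ q = (2 `^ q)^-1 :> R by rewrite -[2^-1]powR_inv1// -powRrM mulN1r powRN.
  by rewrite lef_pV2 ?posrE ?powR_gt0.
have h0 : 0 < K * a `^ q / 2 by rewrite divr_gt0// mulr_gt0.
have : (knn_number n)%:R^-1 <= (K * a `^ q / 2)^-1 by rewrite lef_pV2 ?posrE ?ltr0n.
rewrite !invfM invrK powRN mulrC mulrA; move: s1; lra.
Qed.

End count_bounds.

Section risk_at_a_point.
Context {dO : measure_display} {Om : measurableType dO} {R : realType}.
Variable P : probability Om R.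
Variables (d : nat) (nm : 'rV[R]_d -> R).
Hypothesis nm_norm : is_norm nm.
Variables (X : {RV P >-> 'rV[R]_d}) (Y : {RV P >-> R}).
Variables (Xs : nat -> {RV P >-> 'rV[R]_d}) (Ys : nat -> {RV P >-> R}).
Let V0 w := (X w, Y w).
Let V i w := (Xs i w, Ys i w).
Hypothesis lawV : forall i, same_law P (V i) V0.
Hypothesis indV : mutual_independence P (fun o => if o is Some i then V i else V0).
Variables (x : 'rV[R]_d) (c : R) (C1 Cc : R).
Hypothesis Cc_ge0 : 0 <= Cc.
Hypothesis C1_ge0 : 0 <= C1.
Hypothesis iY2 : P.-integrable setT (fun w => ((Y w - c) ^+ 2)%:E).
Hypothesis weight_dev : forall h : 'rV[R]_d -> R, measurable_fun setT h ->
  (forall x, 0 <= h x) ->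
  (\int[P]_w (h (X w) * (Y w - c) ^+ 2)%:E <= C1%:E * \int[P]_w (h (X w))%:E)%E.
Hypothesis ball_mean : forall b r, 0 <= r ->
  `|\int[P]_(w in X @^-1` xball nm x b r) (Y w - c)| <=
    Cc * r ^+ 2 * fine (P (X @^-1` xball nm x b r)).
Variables (K q A r0 : R) (N : nat).
Hypothesis K_gt0 : 0 < K.
Hypothesis q01 : 0 < q < 1.
Hypothesis kN : forall n, (n <= N)%N -> (knn_number K q n <= N)%N.
Hypothesis r0_ge0 : 0 <= r0.
Hypothesis r0A : r0 <= A.
Let a := N%:R * fine (P (X @^-1` nball nm x A)).
Let b := N%:R * fine (P (X @^-1` nball nm x r0)).
Hypothesis a_ge1 : 1 <= a.
Hypothesis ab : 2 * (2 * K + 1) * a `^ q <= b.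

Local Notation smp := (sample V N).

Let msd i : measurable_fun setT (fun w => sdist nm x (smp w) i).
Proof.
have mV j : measurable_fun setT (V j) by exact: measurable_fun_pair.
have ms : measurable_fun setT smp by exact: measurable_sample.
exact: measurableT_comp (measurable_sdist nm_norm x (N := N) i) ms.
Qed.

Let n w := count_within (sdist nm x (smp w)) A.
Let m w := count_within (sdist nm x (smp w)) r0.

Let mcount_within (h : nat -> nat -> R) : measurable_fun setT (fun w => (h (n w) (m w))%:E).
Proof.
apply/measurable_EFinP.
exact: (measurable_count_within (delta := fun i w => sdist nm x (smp w) i) msd h A r0).
Qed.

Lemma knn_risk_at_point_le :
  (\int[P]_w (knn_dev nm x c (knn_number K q) A (smp w) ^+ 2)%:E <=
   (C1 * (19 + 8 / K) * a `^ (- q) + 6 * (Cc * r0 ^+ 2) ^+ 2)%:E)%E.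
Proof.
have a_gt0 : 0 < a by exact: lt_le_trans a_ge1.
have b_gt0 : 0 < b.
  by apply: lt_le_trans ab; rewrite !mulr_gt0 ?addr_gt0 ?mulr_gt0 ?powR_gt0.
have kf0 i : (0 < knn_number K q i)%N by [].
apply: (le_trans (knn_dev_bias_variance nm_norm lawV indV Cc_ge0 C1_ge0 iY2
  weight_dev ball_mean kf0 kN r0_ge0 r0A)).
set B := (Cc * r0 ^+ 2) ^+ 2.
(* 17 = 1 + 4 * 4 collects the deviations of n in [too_few_le] and [inv_knn_number_le]; the
   deviation of m adds 2 through 4/b <= 2 a^(-q), which makes 19 in the statement. *)
pose al := 17 * C1 / a ^+ 2; pose be := 4 * C1 / b ^+ 2.
pose ga := 8 * C1 / K * a `^ (- q) + 6 * B.
have al0 : 0 <= al by apply: divr_ge0; [exact: mulr_ge0|exact: sqr_ge0].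
have be0 : 0 <= be by apply: divr_ge0; [exact: mulr_ge0|exact: sqr_ge0].
have ga0 : 0 <= ga.
  apply: addr_ge0; last by apply: mulr_ge0 => //; exact: sqr_ge0.
  by rewrite mulr_ge0 ?powR_ge0// divr_ge0 ?(ltW K_gt0)// mulr_ge0.
have ma : measurable_fun setT (fun w => (((n w)%:R - a) ^+ 2)%:E).
  exact: (mcount_within (fun n _ => (n%:R - a) ^+ 2)).
have mb : measurable_fun setT (fun w => (((m w)%:R - b) ^+ 2)%:E).
  exact: (mcount_within (fun _ m => (m%:R - b) ^+ 2)).
have sq0 (t : R) : (0 <= (t ^+ 2)%:E)%E by rewrite lee_fin sqr_ge0.
apply: (@le_trans _ _ (\int[P]_w (al%:E * (((n w)%:R - a) ^+ 2)%:E
    + be%:E * (((m w)%:R - b) ^+ 2)%:E + ga%:E))%E).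
  apply: ge0_le_integral => //.
  - move=> w _; rewrite lee_fin !addr_ge0 ?mulr_ge0 ?invr_ge0 ?ler0n ?sqr_ge0//.
  - exact: (mcount_within (fun n m => C1 * (m <= knn_number K q n)%N%:R
      + 4 * C1 / (knn_number K q n)%:R + 6 * B)).
  - by apply: emeasurable_funD => //; apply: emeasurable_funD; exact: emeasurable_funM.
  move=> w _; rewrite -!EFinM -!EFinD lee_fin.
  have h1 := ler_wpM2l C1_ge0 (too_few_le K_gt0 q01 (n w) (m w) a_ge1 ab).
  have C4 : 0 <= 4 * C1 by rewrite mulr_ge0.
  have h2 := ler_wpM2l C4 (inv_knn_number_le K_gt0 q01 (n w) a_ge1).
  apply: (le_trans (lerD (lerD h1 h2) (lexx _))).
  by rewrite le_eqVlt /al /be /ga; apply/orP; left; apply/eqP; ring.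
rewrite ge0_integralD//; first last.
- by apply: emeasurable_funD; exact: emeasurable_funM.
- by move=> w _; rewrite adde_ge0// mule_ge0.
rewrite ge0_integralD//; first last.
- exact: emeasurable_funM.
- by move=> w _; rewrite mule_ge0.
- exact: emeasurable_funM.
- by move=> w _; rewrite mule_ge0.
rewrite !ge0_integralZl// integral_cst//.
rewrite [X in (_ + _ * X)%E](_ : _ = 1%E); last exact: probability_setT.
rewrite mule1.
have va := count_within_second_moment nm_norm lawV indV x N A.
have vb := count_within_second_moment nm_norm lawV indV x N r0.
apply: (le_trans (leeD (leeD (lee_wpmul2l _ va) (lee_wpmul2l _ vb)) (lexx _))) => //.
rewrite -!EFinM -!EFinD lee_fin -/a -/b.
have aq : 0 < a `^ q by rewrite powR_gt0.
have a1 : a^-1 <= a `^ (- q).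
  rewrite -powR_inv1 ?(ltW a_gt0)// ler_powR// lerN2.
  by have /andP[_ /ltW] := q01.
have b1 : 4 * b^-1 <= 2 * a `^ (- q).
  rewrite powRN ler_pdivrMr// mulrAC ler_pdivlMr//.
  by move: ab (mulr_gt0 K_gt0 aq); lra.
have divsqr (C t : R) : 0 < t -> C / t ^+ 2 * t = C / t.
  by move=> t0; rewrite expr2 invfM -!mulrA mulVf ?mulr1// gt_eqF.
have alE : al * a = 17 * C1 * a^-1.
  exact: divsqr.
have beE : be * b = C1 * (4 * b^-1).
  by rewrite divsqr//; ring.
rewrite alE beE /ga.
have h1 := ler_wpM2l C1_ge0 a1; have h2 := ler_wpM2l C1_ge0 b1.
rewrite [leRHS](_ : _ = 17 * (C1 * a `^ (- q)) + C1 * (2 * a `^ (- q))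
  + (8 * C1 / K * a `^ (- q) + 6 * B)); last by ring.
rewrite lerD2r; apply: lerD => //.
by rewrite -mulrA ler_wpM2l.
Qed.

End risk_at_a_point.

Section pointwise_rate.
Context {dO : measure_display} {Om : measurableType dO} {R : realType}.
Variable P : probability Om R.
Variables (d : nat) (nm : 'rV[R]_d -> R).
Hypothesis d_gt0 : (0 < d)%N.
Hypothesis nm_norm : is_norm nm.
Variables (X : {RV P >-> 'rV[R]_d}) (Y eps : {RV P >-> R}).
Variables (Xs : nat -> {RV P >-> 'rV[R]_d}) (Ys : nat -> {RV P >-> R}).
Let V0 w := (X w, Y w).
Let V i w := (Xs i w, Ys i w).
Hypothesis lawV : forall i, same_law P (V i) V0.
Hypothesis indV : mutual_independence P (fun o => if o is Some i then V i else V0).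
Variables (f eta : 'rV[R]_d -> R).
Hypothesis eta_meas : measurable_fun [set: 'rV[R]_d] eta.
Hypothesis Y_model : forall w, Y w = eta (X w) + eps w.
Hypothesis eps_centered : is_condexp P X eps (cst 0).
Variables (M Ca Cc : R).
Hypothesis eta_bounded : forall x, `|eta x| <= M.
Hypothesis Ca_ge0 : 0 <= Ca.
Hypothesis ieps2 : P.-integrable setT (fun w => (eps w ^+ 2)%:E).
Hypothesis eps2_le : forall A, measurable A ->
  (\int[P]_(w in X @^-1` A) (eps w ^+ 2)%:E <= Ca%:E * P (X @^-1` A))%E.
Hypothesis Cc_ge0 : 0 <= Cc.
Hypothesis condc : forall (r : R) x, 0 < r -> f x != 0 ->
  `|event_condexp P Y (X @^-1` nball nm x r) - eta x| <= Cc * r ^+ 2.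
Variables (Cd D : R).
Hypothesis Cd_gt0 : 0 < Cd.
Hypothesis D_gt0 : 0 < D.
Hypothesis condd : forall x (r : R), 0 < r < D ->
  ((Cd * f x)%:E * lebesgue_rV d (nball nm x r) <= P (X @^-1` nball nm x r))%E.
Variables (K q A : R).
Hypothesis K_gt0 : 0 < K.
Hypothesis q01 : 0 < q < 1.
Hypothesis A_gt0 : 0 < A.

Local Notation C1 := (dev_const M Ca).

Definition knn_pointwise_risk N x : \bar R :=
  (\int[P]_w (knn_dev nm x (eta x) (knn_number K q) A (sample V N w) ^+ 2)%:E)%E.

Let C1_ge0 : 0 <= C1. Proof. exact: dev_const_ge0. Qed.

Let iY2 x : P.-integrable setT (fun w => ((Y w - eta x) ^+ 2)%:E).
Proof. exact: (integrable_sqr_dev Y_model eta_bounded ieps2). Qed.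

Let weight_dev x (h : 'rV[R]_d -> R) : measurable_fun setT h ->
  (forall x, 0 <= h x) ->
  (\int[P]_w (h (X w) * (Y w - eta x) ^+ 2)%:E <= C1%:E * \int[P]_w (h (X w))%:E)%E.
Proof. exact: (integral_weight_sqr_dev Y_model eta_bounded Ca_ge0 ieps2 eps2_le). Qed.

Let iY : P.-integrable setT (EFin \o Y).
Proof. exact: (integrable_Y eta_meas Y_model eps_centered eta_bounded). Qed.

Let ball_mean x : f x != 0 -> forall b r, 0 <= r ->
  `|\int[P]_(w in X @^-1` xball nm x b r) (Y w - eta x)| <=
    Cc * r ^+ 2 * fine (P (X @^-1` xball nm x b r)).
Proof.
by move=> fx b r r0; apply: (xball_mean nm_norm _ iY) => // s s0; exact: condc.
Qed.

Lemma knn_pointwise_risk_le N x :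
  (forall n, (n <= N)%N -> (knn_number K q n <= N)%N) ->
  (knn_pointwise_risk N x <= C1%:E)%E.
Proof.
move=> kN; have kf0 i : (0 < knn_number K q i)%N by [].
have := knn_dev_second_moment nm_norm lawV indV x C1_ge0 (weight_dev x) A A kf0 kN
  (fun _ _ => true).
rewrite [leRHS](_ : _ = C1%:E).
  by under eq_integral do rewrite mul1r.
rewrite integral_cst// [X in (_ * (_ * X))%E](_ : _ = 1%E); last exact: probability_setT.
by rewrite !mule1.
Qed.

Definition mass_const : R := Cd * (2 / norm_box_const nm) ^+ d.

Lemma mass_const_gt0 : 0 < mass_const.
Proof.
by rewrite mulr_gt0// exprn_gt0// divr_gt0// norm_box_const_gt0.
Qed.

Lemma mass_ge x r : 0 <= f x -> 0 < r < D ->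
  mass_const * f x * r ^+ d <= fine (P (X @^-1` nball nm x r)).
Proof.
move=> fx0 /[dup] rD /andP[r0 _].
have mB : measurable (X @^-1` nball nm x r).
  by apply: RV_preimage_measurable; exact: measurable_nball.
rewrite -lee_fin fineK ?fin_num_measure//; apply: le_trans (condd x rD).
apply: (@le_trans _ _ ((Cd * f x)%:E * ((2 * (r / norm_box_const nm)) ^+ d)%:E)%E).
  rewrite -EFinM lee_fin le_eqVlt; apply/orP; left; apply/eqP.
  rewrite /mass_const (_ : 2 * (r / _) = 2 / norm_box_const nm * r) ?exprMn; ring.
by apply: lee_wpmul2l; [rewrite lee_fin mulr_ge0// ltW|exact: lebesgue_nball_ge].
Qed.

Let pA x : R := fine (P (X @^-1` nball nm x A)).

(** The bias-variance bound needs Np >= 1 and a radius r0 at most A and below D. If N f(x) is too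
    small, or the desired r0 too large, the corresponding term of the claim is bounded below and the
    bound C1 of [knn_pointwise_risk_le] suffices. *)
Lemma knn_pointwise_rate : exists2 C : R, 0 <= C & forall N x,
  (forall n, (n <= N)%N -> (knn_number K q n <= N)%N) -> (0 < N)%N -> 0 < f x ->
  (knn_pointwise_risk N x <=
    (C * (N%:R * f x) `^ (- q) +
     C * (N%:R `^ (1 - q) * (f x / pA x `^ q)) `^ (- (4 / d%:R)))%:E)%E.
Proof.
have /andP[q0 q1] := q01.
have cd0 := mass_const_gt0; set cd := mass_const in cd0.
(* Condition (d) requires a radius strictly below D, hence D / 2. *)
pose r1 := Num.min A (D / 2).
have r10 : 0 < r1 by rewrite lt_min A_gt0 divr_gt0.
have r1D : r1 < D.
  rewrite gt_min; apply/orP; right; rewrite ltr_pdivrMr//.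
  by move: D_gt0; lra.
have r1A : r1 <= A by rewrite ge_min lexx.
pose c2 := cd * r1 ^+ d; have c20 : 0 < c2 by rewrite mulr_gt0// exprn_gt0.
pose B0 := 2 * (2 * K + 1) / cd.
have B00 : 0 < B0 by rewrite divr_gt0// mulr_gt0// addr_gt0// mulr_gt0.
pose e := 4 / d%:R : R.
have dR : 0 < d%:R :> R by rewrite ltr0n.
have e0 : 0 < e by rewrite divr_gt0.
pose h0 := B0 / r1 ^+ d; have h00 : 0 < h0 by rewrite divr_gt0// exprn_gt0.
(* t1 and t3 are the variance and the squared bias in the generic case; t2 and t4 compensate for the
   crude bound when N f(x) is small and when r0 exceeds r1. *)
pose t1 := C1 * (19 + 8 / K) * c2 `^ (- q).
pose t2 := C1 * c2 `^ (- q).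
pose t3 := 6 * Cc ^+ 2 * B0 `^ e.
pose t4 := C1 * h0 `^ e.
have t10 : 0 <= t1.
  rewrite /t1 mulr_ge0 ?powR_ge0// mulr_ge0// addr_ge0// divr_ge0// ltW//.
have t20 : 0 <= t2 by rewrite mulr_ge0 ?powR_ge0.
have t30 : 0 <= t3 by rewrite mulr_ge0 ?powR_ge0// mulr_ge0// sqr_ge0.
have t40 : 0 <= t4 by rewrite mulr_ge0 ?powR_ge0.
exists (t1 + t2 + t3 + t4); first by rewrite !addr_ge0.
move=> N x kN N0 fx0; set C := t1 + t2 + t3 + t4.
have NR : 0 < N%:R :> R by rewrite ltr0n.
set F := N%:R * f x; have F0 : 0 < F by rewrite mulr_gt0.
set H := _ * (f x / _).
have pge : c2 * f x <= pA x.
  apply: (@le_trans _ _ (fine (P (X @^-1` nball nm x r1)))).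
    by rewrite /c2 mulrAC; apply: mass_ge; [exact: ltW|rewrite r10 r1D].
  have mB r : measurable (X @^-1` nball nm x r).
    by apply: RV_preimage_measurable; exact: measurable_nball.
  apply: fine_le; rewrite ?fin_num_measure//.
  apply: le_measure; rewrite ?inE// => w /=; rewrite /nball/= => h.
  exact: le_trans r1A.
have p0 : 0 < pA x by apply: lt_le_trans pge; rewrite mulr_gt0.
have H0 : 0 < H by rewrite mulr_gt0 ?powR_gt0// divr_gt0// powR_gt0.
have Fq0 : 0 <= F `^ (- q) by exact: powR_ge0.
have He0 : 0 <= H `^ (- e) by exact: powR_ge0.
have CF t : t <= C -> t * F `^ (- q) <= C * F `^ (- q) by move=> tC; rewrite ler_wpM2r.
have CH t : t <= C -> t * H `^ (- e) <= C * H `^ (- e) by move=> tC; rewrite ler_wpM2r.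
have C0 : 0 <= C by rewrite !addr_ge0.
have t1C : t1 <= C by rewrite /C; lra.
have t2C : t2 <= C by rewrite /C; lra.
have t3C : t3 <= C by rewrite /C; lra.
have t4C : t4 <= C by rewrite /C; lra.
have powMV (s t z : R) : 0 < s -> 0 < t -> s <= t -> 0 <= z -> 1 <= s `^ (- z) * t `^ z.
  move=> s0 t0 st z0; rewrite powRN mulrC ler_pdivlMr ?powR_gt0// mul1r.
  by apply: ge0_ler_powR; rewrite ?nnegrE// ltW.
have [F1|F1] := ltP (c2 * F) 1.
  apply: (le_trans (knn_pointwise_risk_le x kN)); rewrite lee_fin.
  apply: (@le_trans _ _ (t2 * F `^ (- q))); last first.
    by apply: (le_trans (CF _ t2C)); rewrite lerDl mulr_ge0.
  rewrite /t2 -mulrA -[leLHS]mulr1 ler_wpM2l// -powRM ?(ltW c20) ?(ltW F0)//.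
  have := powMV _ 1 q (mulr_gt0 c20 F0) ltr01 (ltW F1) (ltW q0).
  by rewrite powR1 mulr1.
(* [r0] makes the lower bound [N * mass_const * f x * r0 ^+ d] of the mean number
   of samples in B(x, r0) equal to twice the typical size of k. *)
pose r0 := (B0 / H) `^ (d%:R^-1).
have BH : 0 < B0 / H by rewrite divr_gt0.
have r00 : 0 < r0 by rewrite powR_gt0.
have r0d : r0 ^+ d = B0 / H.
  by rewrite -powR_mulrn ?ltW// -powRrM mulVf ?gt_eqF// powRr1// ltW.
have [r0r1|r1r0] := leP r0 r1; last first.
  apply: (le_trans (knn_pointwise_risk_le x kN)); rewrite lee_fin.
  apply: (@le_trans _ _ (t4 * H `^ (- e))); last first.
    by apply: (le_trans (CH _ t4C)); rewrite lerDr mulr_ge0.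
  rewrite /t4 -mulrA -[leLHS]mulr1 ler_wpM2l// mulrC.
  apply: powMV => //; last exact: ltW.
  rewrite /h0 ler_pdivlMr ?exprn_gt0// mulrC -ler_pdivlMr// -r0d.
  by rewrite lerXn2r ?nnegrE ?ltW.
have a_ge1 : 1 <= N%:R * pA x.
  apply: (le_trans F1); rewrite /F mulrCA ler_wpM2l// ltW//.
have ab : 2 * (2 * K + 1) * (N%:R * pA x) `^ q <= N%:R * fine (P (X @^-1` nball nm x r0)).
  have := mass_ge (ltW fx0) (r := r0); rewrite r00 (le_lt_trans r0r1 r1D) => /(_ isT).
  move=> /(ler_wpM2l (ltW NR)); apply: le_trans.
  rewrite r0d /B0 -/cd le_eqVlt; apply/orP; left; apply/eqP.
  rewrite /H powRM ?ltW// powRD ?powRr1 ?ltW//; last first.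
    by rewrite (gt_eqF NR)/= implybT.
  rewrite powRN; field.
  by rewrite !gt_eqF ?powR_gt0.
have kf0 i : (0 < knn_number K q i)%N by [].
have fx1 : f x != 0 by rewrite gt_eqF.
apply: (le_trans (knn_risk_at_point_le nm_norm lawV indV Cc_ge0 C1_ge0 (iY2 x)
  (weight_dev x) (ball_mean fx1) K_gt0 q01 kN (ltW r00) (le_trans r0r1 r1A) a_ge1 ab)).
rewrite lee_fin; apply: lerD.
  apply: le_trans (CF _ t1C); rewrite /t1.
  have h : 0 <= C1 * (19 + 8 / K) by rewrite mulr_ge0// addr_ge0// divr_ge0// ltW.
  rewrite -[leRHS]mulrA ler_wpM2l// -powRM ?(ltW c20) ?(ltW F0)// !powRN lef_pV2 ?posrE
    ?powR_gt0//; last first.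
  - by rewrite mulr_gt0.
  - exact: lt_le_trans a_ge1.
  apply: ge0_ler_powR; rewrite ?nnegrE ?(ltW q0) ?(ltW (mulr_gt0 c20 F0))//.
    exact: le_trans a_ge1.
  by rewrite /F mulrCA ler_wpM2l ?(ltW NR).
apply: le_trans (CH _ t3C); rewrite /t3 le_eqVlt; apply/orP; left; apply/eqP.
have r04 : (r0 ^+ 2) ^+ 2 = B0 `^ e * H `^ (- e).
  rewrite -exprM -powR_mulrn ?ltW// -powRrM [_^-1 * _]mulrC powRM ?invr_ge0 ?ltW//.
  by rewrite -/e -[H^-1]powR_inv1 ?ltW// -powRrM mulN1r.
by rewrite exprMn r04; ring.
Qed.

End pointwise_rate.

(** * Excess risk *)

Section adaptive_estimator.
Context {R : realType} {d : nat}.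
Variable nm : 'rV[R]_d -> R.

(** The hypothesis keeps k at most N, so the default of [nth] is never reached; the weights of the k
    neighbours sum to 1, so c can be moved under the average. *)
Lemma adaptive_knn_dev (K A q : R) (xs : nat -> 'rV[R]_d) (ys : nat -> R) N x c :
  (forall n, (n <= N)%N -> (knn_number K q n <= N)%N) ->
  adaptive_knn nm K A q xs ys N x - c =
  knn_dev nm x c (knn_number K q) A (\row_(l < N) (xs l, ys l)).
Proof.
move=> kN; set u := \row_l _.
have sdistE : sdist nm x u = (fun i : 'I_N => nm (xs i - x)).
  by apply/funext => i; rewrite /sdist mxE.
have nE : ball_count nm xs N x A = count_within (sdist nm x u) A.
  rewrite /ball_count /count_within; apply: eq_bigr => i _.
  rewrite sdistE; congr nat_of_bool; apply/idP/idP; first by rewrite inE.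
  by move=> h; rewrite inE.
have kE : adaptive_k nm K A q xs N x = skn nm x (knn_number K q) A u.
  by rewrite /adaptive_k nE.
rewrite /adaptive_knn kE /knn_dev; set k := skn _ _ _ _ _.
have kNk : (k <= N)%N by apply: kN; exact: count_within_le.
rewrite (sum_nearest (fun i => nm (xs i - x)) ys kNk) -sdistE.
have -> : c = k%:R^-1 * \sum_(l < N) (nrank (sdist nm x u) l < k)%N%:R * c.
  by rewrite -mulr_suml card_nrank_lt// mulrA mulVf ?mul1r// pnatr_eq0.
rewrite -mulrBr -sumrB; congr (_ * _); apply: eq_bigr => l _.
rewrite -mulrBr; congr (_ * _); rewrite /sdev mxE /=; congr (_ - _).
by rewrite -mulr_suml card_nrank_lt// mulrA mulVf ?mul1r// pnatr_eq0.
Qed.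

(** k <= K n^q + 1 <= (K + 1) N^q, which is at most N once N^(1-q) >= K + 1; this determines t. *)
Lemma knn_number_le_sample (K q : R) : 0 < K -> 0 < q < 1 ->
  exists N0 : nat, forall N, (N0 <= N)%N ->
    forall n, (n <= N)%N -> (knn_number K q n <= N)%N.
Proof.
move=> K0 /andP[q0 q1].
pose t := (K + 1) `^ ((1 - q)^-1).
have q1' : 0 < 1 - q by rewrite subr_gt0.
exists (Num.truncn t).+1 => N tN n nN.
have tN' : t <= N%:R.
  by apply: (le_trans (ltW (truncnS_gt t))); rewrite ler_nat.
have N1 : 1 <= N%:R :> R by rewrite ler1n (leq_trans _ tN).
have N0 : 0 < N%:R :> R by exact: lt_le_trans N1.
rewrite -(ler_nat R); apply: (le_trans (knn_number_le q K0 n)).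
have nNq : n%:R `^ q <= N%:R `^ q.
  by apply: ge0_ler_powR; rewrite ?nnegrE ?(ltW q0)// ler_nat.
have Nq1 : 1 <= N%:R `^ q by have := ler_powR N1 (ltW q0); rewrite powRr0.
have KN : (K + 1) <= N%:R `^ (1 - q).
  have -> : K + 1 = t `^ (1 - q).
    by rewrite /t -powRrM mulVf ?gt_eqF// powRr1// addr_ge0// ltW.
  by apply: ge0_ler_powR; rewrite ?nnegrE ?powR_ge0 ?(ltW q1').
have NE : N%:R = N%:R `^ (1 - q) * N%:R `^ q.
  by rewrite -powRD ?subrK ?powRr1 ?(gt_eqF N0)//= implybT.
rewrite NE; apply: (@le_trans _ _ ((K + 1) * N%:R `^ q)).
  have := ler_wpM2l (ltW K0) nNq; lra.
by rewrite ler_wpM2r// powR_ge0.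
Qed.

End adaptive_estimator.

Lemma indep_pair_sym (dO d1 d2 : measure_display) (Om : measurableType dO)
    (R : realType) (P : probability Om R) (T1 : measurableType d1)
    (T2 : measurableType d2) (V : Om -> T1) (U : Om -> T2) :
  indep_pair P V U -> indep_pair P U V.
Proof. by move=> VU A C mA mC; rewrite setIC muleC; exact: VU. Qed.

Section excess_risk_decomposition.
Context {dO : measure_display} {Om : measurableType dO} {R : realType}.
Variable P : probability Om R.
Variables (d : nat) (nm : 'rV[R]_d -> R).
Hypothesis nm_norm : is_norm nm.
Variables (X : {RV P >-> 'rV[R]_d}) (Y eps : {RV P >-> R}).
Variables (Xs : nat -> {RV P >-> 'rV[R]_d}) (Ys : nat -> {RV P >-> R}).
Local Notation T := ('rV[R]_d * R)%type.
Let V0 w : T := (X w, Y w).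
Let V i w : T := (Xs i w, Ys i w).
Hypothesis lawV : forall i, same_law P (V i) V0.
Hypothesis indV : mutual_independence P (fun o => if o is Some i then V i else V0).
Variables (eta : 'rV[R]_d -> R).
Hypothesis eta_meas : measurable_fun [set: 'rV[R]_d] eta.
Hypothesis Y_model : forall w, Y w = eta (X w) + eps w.
Hypothesis eps_centered : is_condexp P X eps (cst 0).
Variables (M Ca : R).
Hypothesis eta_bounded : forall x, `|eta x| <= M.
Hypothesis Ca_ge0 : 0 <= Ca.
Hypothesis ieps2 : P.-integrable setT (fun w => (eps w ^+ 2)%:E).
Hypothesis eps2_le : forall A, measurable A ->
  (\int[P]_(w in X @^-1` A) (eps w ^+ 2)%:E <= Ca%:E * P (X @^-1` A))%E.
Variables (K q A : R) (N : nat).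
Hypothesis kN : forall n, (n <= N)%N -> (knn_number K q n <= N)%N.

Local Notation smp := (sample (V : nat -> Om -> T) N).
Let dev (x : 'rV[R]_d) (u : 'rV[T]_N) : R := knn_dev nm x (eta x) (knn_number K q) A u.

Let mV0 : measurable_fun [set: Om] V0. Proof. exact: measurable_fun_pair. Qed.
Let mV i : measurable_fun [set: Om] (V i). Proof. exact: measurable_fun_pair. Qed.
Let msmp : measurable_fun [set: Om] smp. Proof. exact: measurable_sample. Qed.

Let mdev : measurable_fun [set: 'rV[R]_d * 'rV[T]_N] (fun z => dev z.1 z.2).
Proof.
have mcoor i : measurable_fun setT (fun z : 'rV[R]_d * 'rV[T]_N => z.2 ord0 i).
  by apply: (measurableT_comp (measurable_coor i)); exact: measurable_snd.
have mdist i : measurable_fun setT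
    (fun z : 'rV[R]_d * 'rV[T]_N => sdist nm z.1 z.2 i).
  apply: (measurable_fun_dist nm_norm); last exact: measurable_fst.
  exact: measurableT_comp measurable_fst (mcoor i).
apply: measurable_funM.
  exact: (measurable_count_within (delta := fun i (z : 'rV[R]_d * 'rV[T]_N) => sdist nm z.1 z.2 i)
    mdist (fun wA _ => (knn_number K q wA)%:R^-1 : R) A A).
apply: measurable_sum => l; apply: measurable_funM.
  exact: (measurable_ranks (delta := fun i (z : 'rV[R]_d * 'rV[T]_N) => sdist nm z.1 z.2 i)
    mdist (fun rl _ wA _ => (rl < knn_number K q wA)%N%:R : R) l l A A).
apply: measurable_funB; first exact: measurableT_comp measurable_snd (mcoor l).
by apply: (measurableT_comp eta_meas); exact: measurable_fst.
Qed.

Let mdevw : measurable_fun setT (fun w => dev (X w) (smp w)).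
Proof.
apply: (measurableT_comp mdev (g := fun w => (X w, smp w))).
exact: measurable_fun_pair.
Qed.

Let dev_second_moment : (\int[P]_w (dev (X w) (smp w) ^+ 2)%:E =
  \int[P]_w knn_pointwise_risk nm Xs Ys eta K q A N (X w))%E.
Proof.
pose phi (z : T * 'rV[T]_N) : \bar R := (dev z.1.1 z.2 ^+ 2)%:E.
have mphi : measurable_fun setT phi.
  apply/measurable_EFinP/measurable_funX.
  apply: (measurableT_comp mdev (g := fun z : T * 'rV[T]_N => (z.1.1, z.2))).
  apply: measurable_fun_pair; last exact: measurable_snd.
  exact: measurableT_comp measurable_fst measurable_fst.
have ind := indep_pair_sym (indep_test_sample (N := N) mV0 mV indV).
have phi0 z : (0 <= phi z)%E by rewrite lee_fin sqr_ge0.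
exact: (ge0_integral_indep_pair msmp mV0 ind mphi phi0).
Qed.

Lemma measurable_knn_pointwise_risk : measurable_fun setT
  (fun w => knn_pointwise_risk nm Xs Ys eta K q A N (X w)).
Proof.
pose g (z : Om * Om) : \bar R := (dev (X z.1) (smp z.2) ^+ 2)%:E.
apply: (measurable_fun_fubini_tonelli_F (m2 := P) g) => [|z]; last by rewrite lee_fin sqr_ge0.
apply/measurable_EFinP/measurable_funX.
apply: (measurableT_comp mdev (g := fun z : Om * Om => (X z.1, smp z.2))).
by apply: measurable_fun_pair; [apply: measurableT_comp|apply: (measurableT_comp msmp)].
Qed.

Let dev_second_moment_le : (\int[P]_w (dev (X w) (smp w) ^+ 2)%:E <= (dev_const M Ca)%:E)%E.
Proof.
rewrite dev_second_moment.
have C1_ge0 := dev_const_ge0 M Ca_ge0.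
apply: (@le_trans _ _ (\int[P]_w (dev_const M Ca)%:E)%E).
  apply: ge0_le_integral => //.
  - by move=> w _; apply: integral_ge0 => w' _; rewrite lee_fin sqr_ge0.
  - exact: measurable_knn_pointwise_risk.
  - move=> w _; exact: (knn_pointwise_risk_le nm_norm lawV indV Y_model eta_bounded).
rewrite integral_cst// [X in (_ * X)%E](_ : _ = 1%E); last exact: probability_setT.
by rewrite mule1.
Qed.

Let idev2 : P.-integrable setT (fun w => (dev (X w) (smp w) ^+ 2)%:E).
Proof.
apply/integrableP; split; first by apply/measurable_EFinP/measurable_funX.
under eq_integral do rewrite gee0_abs ?lee_fin ?sqr_ge0//.
by apply: (le_lt_trans dev_second_moment_le); rewrite ltry.
Qed.

(** For a fixed sample the deviation is bounded uniformly in the test point, as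
    [integral_weight_eps] demands of its weight. *)
Let dev_bounded u x : `|dev x u| <= \sum_(l < N) (`|(u ord0 l).2| + M).
Proof.
rewrite /dev /knn_dev normrM ger0_norm ?invr_ge0//.
rewrite -[leRHS]mul1r; apply: ler_pM => //; first by rewrite invf_le1 ?ler1n.
apply: (le_trans (ler_norm_sum _ _ _)); apply: ler_sum => l _.
rewrite normrM -[leRHS]mul1r; apply: ler_pM => //.
  by case: (_ < _)%N; rewrite ?normr1 ?normr0.
by rewrite /sdev (le_trans (ler_normB _ _))// lerD2l.
Qed.

Let dev_eps0 : (\int[P]_w (dev (X w) (smp w) * eps w)%:E = 0)%E.
Proof.
have M0 : 0 <= M by exact: le_trans (eta_bounded 0).
(* The test noise is written as y - eta(x), so that phi is a function of the sample and the test
   pair, which are independent. *)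
pose phi (z : 'rV[T]_N * T) : \bar R := (dev z.2.1 z.1 * (z.2.2 - eta z.2.1))%:E.
have mz1 : measurable_fun setT (fun z : 'rV[T]_N * T => z.2.1).
  exact: measurableT_comp measurable_fst measurable_snd.
have mphi : measurable_fun setT phi.
  apply/measurable_EFinP/measurable_funM.
    apply: (measurableT_comp mdev (g := fun z : 'rV[T]_N * T => (z.2.1, z.1))).
    by apply: measurable_fun_pair => //; exact: measurable_fst.
  apply: measurable_funB; first exact: measurableT_comp measurable_snd measurable_snd.
  exact: measurableT_comp eta_meas mz1.
have phiE u w : phi (u, V0 w) = (dev (X w) u * eps w)%:E.
  by rewrite /phi /= Y_model addrAC subrr add0r.
have mdevu u : measurable_fun setT (dev ^~ u).
  exact: measurableT_comp mdev (measurable_pair2 u).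
have ie := integrable_eps eps_centered.
have h := integral_indep_pair mV0 msmp (indep_test_sample (N := N) mV0 mV indV) mphi.
transitivity (\int[P]_w phi (smp w, V0 w))%E.
  by apply: eq_integral => w _; rewrite phiE.
rewrite h.
- rewrite integral0_eq// => w _; under eq_integral do rewrite phiE.
  exact: (integral_weight_eps eps_centered (mdevu _) (dev_bounded (smp w))).
- under eq_fun do rewrite phiE.
  by apply: integrable_mul_sqr.
- move=> u; under eq_fun do rewrite phiE.
  set C := \sum_(l < N) (`|(u ord0 l).2| + M).
  have iC := integrableZl measurableT C ie.
  apply: le_integrable iC => //.
    apply/measurable_EFinP/measurable_funM => //.
    exact: measurableT_comp (mdevu u) (measurable_funP X).
  move=> w _ /=; rewrite lee_fin (normrM (dev (X w) u)) (normrM C) ler_wpM2r//.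
  by rewrite (le_trans (dev_bounded u _))// ler_norm.
Qed.

(** In the expansion of (dev - eps)^2 the cross term has mean 0 by [dev_eps0], and the mean of eps^2
    cancels the Bayes risk because it is finite. *)
Lemma excess_risk_pointwise :
  excess_risk P nm K A q X Y eps Xs Ys N =
  (\int[P]_w knn_pointwise_risk nm Xs Ys eta K q A N (X w))%E /\
  (\int[P]_w knn_pointwise_risk nm Xs Ys eta K q A N (X w))%E \is a fin_num.
Proof.
have fin : (\int[P]_w (dev (X w) (smp w) ^+ 2)%:E)%E \is a fin_num.
  exact: integrable_fin_num.
rewrite -dev_second_moment; split => //.
have idd := integrable_mul_sqr mdevw (measurable_funP eps) idev2 ieps2.
rewrite /excess_risk /knn_risk /bayes_risk !unlock.
rewrite (_ : (\int[P]_w _)%E = (\int[P]_w ((dev (X w) (smp w) ^+ 2)%:E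
    + (eps w ^+ 2)%:E + (-2)%:E * (dev (X w) (smp w) * eps w)%:E))%E); last first.
  apply: eq_integral => w _; rewrite -EFinM -!EFinD; congr EFin.
  rewrite -[adaptive_knn _ _ _ _ _ _ _ _](subrK (eta (X w))) adaptive_knn_dev//.
  by rewrite Y_model -/(dev (X w) (smp w)); ring.
rewrite integralD//; [|exact: integrableD|exact: integrableZl].
rewrite integralD// integralZl// dev_eps0 mule0 adde0 addeK//.
exact: integrable_fin_num.
Qed.

End excess_risk_decomposition.

(** * Integration over the test point *)

Section dyadic_expectation.
Context {dO : measure_display} {Om : measurableType dO} {R : realType}.
Variable P : probability Om R.

(** Termwise integration; the exponent j + 1 in the threshold, against j in the weight, is the
    factor 2^beta. *)
Lemma dyadic_expectation_le (E : nat -> set Om) (a beta C : R) N :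
  (0 < N)%N -> 0 <= C -> (forall j, measurable (E j)) ->
  (forall j, (P (E j) <= (C * (2 ^+ j.+1 / N%:R) `^ beta)%:E)%E) ->
  (\int[P]_w (\sum_(j < trunc_log 2 N) (2 `^ (- a)) ^+ j * \1_(E j) w
     + (2 `^ (- a)) ^+ trunc_log 2 N)%:E
   <= ((C * 2 `^ beta + 1) * dyadic_rate a beta N)%:E)%E.
Proof.
move=> N0 C0 mE PE; set t := 2 `^ (- a); set J := trunc_log 2 N.
have t0 : 0 <= t by exact: powR_ge0.
have tj0 j : 0 <= t ^+ j by exact: exprn_ge0.
have m1 j : measurable_fun setT (fun w => (\1_(E j) w)%:E : \bar R).
  by apply/measurable_EFinP; exact: measurable_indic.
under eq_integral do rewrite EFinD -sumEFin.
have s0 w : (0 <= \sum_(j < J) (t ^+ j * \1_(E j) w)%:E)%E.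
  by apply: sume_ge0 => j _; rewrite lee_fin mulr_ge0.
have ms (j : 'I_J) : measurable_fun setT (fun w => (t ^+ j * \1_(E j) w)%:E).
  by apply/measurable_EFinP/measurable_funM => //; exact: measurable_indic.
rewrite ge0_integralD//; first last.
- by move=> w _; rewrite lee_fin.
- exact: emeasurable_sum.
rewrite ge0_integral_sum//; last by move=> j w _; rewrite lee_fin mulr_ge0.
rewrite integral_cst// [X in (_ + _ * X)%E](_ : _ = 1%E); last exact: probability_setT.
rewrite mule1.
apply: (@le_trans _ _ (\sum_(j < J) (t ^+ j * (C * (2 ^+ j.+1 / N%:R) `^ beta))%:E
    + (t ^+ J)%:E)%E).
  apply: leeD => //; apply: lee_sum => j _.
  under eq_integral do rewrite EFinM.
  have tj0' : (0 <= (t ^+ j)%:E)%E by rewrite lee_fin.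
  rewrite ge0_integralZl//.
  rewrite integral_indic// setIT EFinM; apply: lee_wpmul2l => //; exact: PE.
rewrite sumEFin -EFinD lee_fin /dyadic_rate -/t -/J.
have jE (j : 'I_J) : t ^+ j * (C * (2 ^+ j.+1 / N%:R) `^ beta) =
    C * 2 `^ beta * (N%:R `^ (- beta) * (2 `^ beta * t) ^+ j).
  rewrite powRM ?exprn_ge0 ?invr_ge0// -powR_inv1// -powRrM mulN1r.
  rewrite exprS powRM ?exprn_ge0// exprMn.
  by rewrite two_powR; ring.
under eq_bigr do rewrite jE.
rewrite -!mulr_sumr mulrDl mul1r mulrDr -!addrA lerD2l.
set S := N%:R `^ _ * _.
have S0 : 0 <= S.
  rewrite mulr_ge0 ?powR_ge0//; apply: sumr_ge0 => j _.
  by rewrite exprn_ge0// mulr_ge0 ?powR_ge0.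
rewrite addrA lerDr addr_ge0// mulr_ge0//.
by rewrite mulr_ge0 ?powR_ge0.
Qed.

End dyadic_expectation.

Section integrated_rate.
Context {dO : measure_display} {Om : measurableType dO} {R : realType}.
Variable P : probability Om R.
Variables (d : nat) (nm : 'rV[R]_d -> R).
Hypothesis d_gt0 : (0 < d)%N.
Hypothesis nm_norm : is_norm nm.
Variable X : {RV P >-> 'rV[R]_d}.
Variables (f : 'rV[R]_d -> R) (beta A q : R).
Hypothesis f_meas : measurable_fun [set: 'rV[R]_d] f.
Hypothesis f_ge0 : forall x, 0 <= f x.
Hypothesis beta_gt0 : 0 < beta.
Hypothesis q01 : 0 < q < 1.
Hypothesis condb : cond_tail P X f beta.
Hypothesis condT : cond_ratio_tail P nm X f beta A q.

Let pA x : R := fine (P (X @^-1` nball nm x A)).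

Let measurable_pA : measurable_fun setT pA.
Proof.
apply: (measurableT_comp (f := fine) (g := fun x => P (X @^-1` nball nm x A))) => //.
pose g (z : 'rV[R]_d * Om) : \bar R := (nm (X z.2 - z.1) <= A)%R%:R%:E.
rewrite (_ : (fun x => _) = fubini_F P g).
  apply: measurable_fun_fubini_tonelli_F => [|z]; last by rewrite lee_fin ler0n.
  apply/measurable_EFinP/measurable_fun_natr_bool/measurable_fun_ler => //.
  apply: (measurable_fun_dist nm_norm); last exact: measurable_fst.
  exact: measurableT_comp (measurable_funP X) measurable_snd.
apply/funext => x; rewrite /fubini_F /g.
have mB : measurable (X @^-1` nball nm x A).
  by apply: RV_preimage_measurable; exact: measurable_nball.
rewrite -[LHS](_ : (\int[P]_w (\1_(X @^-1` nball nm x A) w)%:E)%E = _); last first.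
  by rewrite integral_indic// setIT.
apply: eq_integral => w _; congr EFin; rewrite /indic.
case: (boolP (nm (X w - x) <= A)) => h; first by rewrite mem_set.
by rewrite memNset//; exact/negP.
Qed.

(** Each error term is truncated at 1 and expanded by [dyadic_ge]: the first with z = N f(x), whose
    events are those of (b), the second with a power of its argument chosen so that its events are
    those of (T). *)
Lemma integrated_rate (risk : nat -> 'rV[R]_d -> \bar R) (C C1 : R) (N0 : nat) :
  0 <= C -> 0 <= C1 ->
  (forall N, measurable_fun setT (fun w => risk N (X w))) ->
  (forall N x, (0 <= risk N x)%E) ->
  (forall N x, (N0 <= N)%N -> (risk N x <= C1%:E)%E) ->
  (forall N x, (N0 <= N)%N -> 0 < f x ->
    (risk N x <= (C * (N%:R * f x) `^ (- q) +
      C * (N%:R `^ (1 - q) * (f x / pA x `^ q)) `^ (- (4 / d%:R)))%:E)%E) ->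
  exists (C' : R) (N1 : nat), forall N, (N1 <= N)%N ->
    (\int[P]_w risk N (X w) <= (C' * knn_rate d beta q N)%:E)%E.
Proof.
move=> C0 C10 mrisk risk0 riskC1 riskC; have /andP[q0 q1] := q01.
have [Cb hb] := condb; have [Ct ht] := condT.
have q1' : 0 < 1 - q by rewrite subr_gt0.
have dR : 0 < d%:R :> R by rewrite ltr0n.
(* Exponent of the squared bias in the variable z below; 2 lambda is the minimum of q and [ga]. *)
pose ga := 4 / d%:R * (1 - q) : R.
have ga0 : 0 < ga by rewrite mulr_gt0// divr_gt0.
pose la := 2 * knn_lambda d q : R.
have la0 : 0 < la by rewrite mulr_gt0// knn_lambda_gt0.
have laq : la <= q.
  have : knn_lambda d q <= 2^-1 * q by rewrite /knn_lambda ge_min lexx.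
  by rewrite /la; lra.
have lag : la <= ga.
  have : knn_lambda d q <= 2 / d%:R * (1 - q) by rewrite /knn_lambda ge_min lexx orbT.
  move=> /(ler_wpM2l (ler0n R 2)) /le_trans; apply.
  by rewrite /ga le_eqVlt; apply/orP; left; apply/eqP; ring.
have [C2 C20 rateC2] := dyadic_rate_bound la0 beta_gt0.
pose mx (c : R) := Num.max c 0.
have mx0 c : 0 <= mx c by rewrite le_max lexx orbT.
pose kb := mx Cb * 2 `^ beta + 1; pose kt := mx Ct * 2 `^ beta + 1.
have kb0 : 0 <= kb by rewrite addr_ge0// mulr_ge0 ?powR_ge0.
have kt0 : 0 <= kt by rewrite addr_ge0// mulr_ge0 ?powR_ge0.
pose C' := C + C1; have C'0 : 0 <= C' by rewrite addr_ge0.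
exists (C' * (kb + kt) * C2), (maxn N0 3) => N; rewrite geq_max => /andP[N0N N3].
have N1 : (0 < N)%N by exact: leq_trans N3.
have NR : 0 < N%:R :> R by rewrite ltr0n.
set J := trunc_log 2 N.
have J0 : (0 < J)%N.
  have NJ : (N < 2 ^ J.+1)%N by exact: trunc_log_ltn.
  by rewrite lt0n; apply/eqP => JE; move: NJ; rewrite JE ltnNge (leq_trans _ N3).
pose E j := [set w | f (X w) <= 2 ^+ j.+1 / N%:R].
pose E' j := [set w | f (X w) / pA (X w) `^ q < (2 ^+ j.+1 / N%:R) `^ (1 - q)].
have fX : measurable_fun setT (fun w => f (X w)) by exact: measurableT_comp.
have mE j : measurable (E j).
  rewrite -[Z in measurable Z]setTI.
  exact: (measurable_fun_le measurableT fX (measurable_cst _)).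
have mrat : measurable_fun setT (fun w => f (X w) / pA (X w) `^ q).
  apply: measurable_funM => //.
  rewrite (_ : (fun w => _) = (fun w => pA (X w) `^ (- q))); last first.
    by apply/funext => w; rewrite powRN.
  apply: (measurableT_comp (measurable_powR _)).
  exact: measurableT_comp measurable_pA (measurable_funP X).
have mE' j : measurable (E' j).
  rewrite -[Z in measurable Z]setTI.
  exact: (measurable_fun_ltr mrat (measurable_cst _) measurableT (Y := [set true])).
have s0 j : 0 < 2 ^+ j.+1 / N%:R :> R by rewrite divr_gt0// exprn_gt0.
have le_mx c j : c * (2 ^+ j.+1 / N%:R) `^ beta <= mx c * (2 ^+ j.+1 / N%:R) `^ beta.
  by rewrite ler_wpM2r ?powR_ge0// le_max lexx.
have PE j : (P (E j) <= (mx Cb * (2 ^+ j.+1 / N%:R) `^ beta)%:E)%E.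
  by apply: (le_trans (hb _ (s0 j))); rewrite lee_fin.
have PE' j : (P (E' j) <= (mx Ct * (2 ^+ j.+1 / N%:R) `^ beta)%:E)%E.
  by apply: (le_trans (ht _ (s0 j))); rewrite lee_fin.
pose u1 w : R := \sum_(j < J) (2 `^ (- q)) ^+ j * \1_(E j) w + (2 `^ (- q)) ^+ J.
pose u2 w : R := \sum_(j < J) (2 `^ (- ga)) ^+ j * \1_(E' j) w + (2 `^ (- ga)) ^+ J.
have u10 w : 0 <= u1 w.
  rewrite addr_ge0 ?exprn_ge0 ?powR_ge0//; apply: sumr_ge0 => j _.
  by rewrite mulr_ge0// exprn_ge0// powR_ge0.
have u20 w : 0 <= u2 w.
  rewrite addr_ge0 ?exprn_ge0 ?powR_ge0//; apply: sumr_ge0 => j _.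
  by rewrite mulr_ge0// exprn_ge0// powR_ge0.
have mu1 : measurable_fun setT (fun w => (u1 w)%:E).
  apply/measurable_EFinP/measurable_funD => //; apply: measurable_sum => j.
  by apply: measurable_funM => //; exact: measurable_indic.
have mu2 : measurable_fun setT (fun w => (u2 w)%:E).
  apply/measurable_EFinP/measurable_funD => //; apply: measurable_sum => j.
  by apply: measurable_funM => //; exact: measurable_indic.
have pointwise w : (risk N (X w) <= (C' * (u1 w + u2 w))%:E)%E.
  have [fx|fx] := ltP 0 (f (X w)); last first.
    (* Where f vanishes, only the crude bound is available; it is paid for by the term j = 0 of
       [u1], which equals 1 there. That term is present since J > 0. *)
    apply: (le_trans (riskC1 _ _ N0N)); rewrite lee_fin.
    rewrite -[leLHS]mulr1; apply: ler_pM => //; first by rewrite /C' lerDr.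
    apply: (@le_trans _ _ (u1 w)); last by rewrite lerDl.
    rewrite /u1 (bigD1 (Ordinal J0))//= expr0 mul1r [\1_(E 0%N) w]indicE mem_set.
      rewrite -addrA lerDl addr_ge0 ?exprn_ge0 ?powR_ge0//; apply: sumr_ge0 => j _.
      by rewrite mulr_ge0// exprn_ge0// powR_ge0.
    by rewrite /E /= (le_trans fx)// ltW.
  set F := N%:R * f (X w); set H := N%:R `^ (1 - q) * (f (X w) / pA (X w) `^ q).
  have F0 : 0 < F by rewrite mulr_gt0.
  have r1 := riskC1 N (X w) N0N; have r2 := riskC N (X w) N0N fx.
  have rE : (risk N (X w))%E = (fine (risk N (X w)))%:E.
    by rewrite fineK// ge0_fin_numE// (le_lt_trans r1)// ltry.
  rewrite rE lee_fin; rewrite rE lee_fin in r1; rewrite rE lee_fin -/F -/H in r2.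
  set r := fine _ in r1 r2 *.
  have m1 : Num.min 1 (F `^ (- q)) <= u1 w.
    apply: (le_trans (dyadic_ge J (ltW q0) F0)); rewrite /u1 lerD2r.
    apply: ler_sum => j _; rewrite ler_wpM2l ?exprn_ge0 ?powR_ge0//.
    case: (boolP (F < _)) => // Fj; rewrite indicE mem_set//.
    by rewrite /E /= ler_pdivlMr// mulrC ltW.
  have m2 : Num.min 1 (H `^ (- (4 / d%:R))) <= u2 w.
    have [H0|H0] := ltP 0 H; last first.
      (* If B(x, A) were null, the division by 0 would give H = 0; a nonzero power of 0 is 0, so the
         claim would be trivial. *)
      have H00 : H = 0.
        by apply/eqP; rewrite eq_le H0 mulr_ge0 ?powR_ge0// divr_ge0 ?f_ge0 ?powR_ge0.
      apply: (@le_trans _ _ 0) => //; rewrite ge_min H00 powR0 ?lexx ?orbT//.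
      by rewrite oppr_eq0 gt_eqF// divr_gt0.
    (* With this power, z < 2^(j+1) becomes the event of (T) at t = 2^(j+1) / N. *)
    pose z := H `^ ((1 - q)^-1).
    have z0 : 0 < z by rewrite powR_gt0.
    have -> : H `^ (- (4 / d%:R)) = z `^ (- ga).
      rewrite -powRrM /ga mulrN mulrCA mulVf ?mulr1// gt_eqF//.
    apply: (le_trans (dyadic_ge J (ltW ga0) z0)); rewrite /u2 lerD2r.
    apply: ler_sum => j _; rewrite ler_wpM2l ?exprn_ge0 ?powR_ge0//.
    case: (boolP (z < _)) => // zj; rewrite indicE mem_set//.
    rewrite /E' /= powRM ?exprn_ge0 ?invr_ge0//.
    have -> : N%:R^-1 `^ (1 - q) = (N%:R `^ (1 - q))^-1.
      by rewrite -powR_inv1// -powRrM mulN1r powRN.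
    rewrite ltr_pdivlMr ?powR_gt0// mulrC -/H.
    have -> : H = z `^ (1 - q).
      by rewrite /z -powRrM mulVf ?powRr1 ?(ltW H0)// gt_eqF.
    by apply: gt0_ltr_powR; rewrite ?nnegrE ?exprn_ge0 ?(ltW z0).
  have h1 : r <= C' * (Num.min 1 (F `^ (- q)) + Num.min 1 (H `^ (- (4 / d%:R)))).
    have FQ : 0 <= F `^ (- q) by exact: powR_ge0.
    have HQ : 0 <= H `^ (- (4 / d%:R)) by exact: powR_ge0.
    have C1F := mulr_ge0 C10 FQ; have C1H := mulr_ge0 C10 HQ.
    have CF := mulr_ge0 C0 FQ; have CH := mulr_ge0 C0 HQ.
    rewrite /C' !minEle; case: ifP => F1; case: ifP => H1; lra.
  by apply: (le_trans h1); rewrite ler_wpM2l// lerD.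
apply: (@le_trans _ _ (\int[P]_w (C'%:E * ((u1 w)%:E + (u2 w)%:E)))%E).
  apply: ge0_le_integral => //.
  apply: emeasurable_funM => //; exact: emeasurable_funD.
rewrite ge0_integralZl//; first last.
- by move=> w _; rewrite adde_ge0// lee_fin.
- exact: emeasurable_funD.
rewrite ge0_integralD//; [|by move=> w _; rewrite lee_fin|by move=> w _; rewrite lee_fin].
have i1 := dyadic_expectation_le q N1 (mx0 Cb) mE PE.
have i2 := dyadic_expectation_le ga N1 (mx0 Ct) mE' PE'.
apply: (le_trans (lee_wpmul2l _ (leeD i1 i2))) => //.
rewrite -EFinD -EFinM lee_fin -!mulrA ler_wpM2l// [leRHS]mulrDl.
have N3' : (2 < N)%N by [].
have rate_la a : la <= a -> dyadic_rate a beta N <= C2 * knn_rate d beta q N.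
  by move=> laa; apply: le_trans (rateC2 N N3'); exact: ler_dyadic_rate.
by apply: lerD; rewrite ler_wpM2l// rate_la.
Qed.

End integrated_rate.

Theorem theorem6 (R : realType) (d : nat) (d_gt0 : (0 < d)%N)
  (nm : 'rV[R]_d -> R) (nm_norm : is_norm nm)
  (dO : measure_display) (Om : measurableType dO) (P : probability Om R)
  (X : {RV P >-> 'rV[R]_d}) (Y eps : {RV P >-> R})
  (Xs : nat -> {RV P >-> 'rV[R]_d}) (Ys : nat -> {RV P >-> R})
  (f eta : 'rV[R]_d -> R)
  (X_density : is_density P X f)
  (eta_meas : measurable_fun [set: 'rV[R]_d] eta)
  (Y_model : forall w, Y w = eta (X w) + eps w)
  (eps_centered : is_condexp P X eps (cst 0))
  (samples_law : forall i,
     same_law P (fun w => (Xs i w, Ys i w)) (fun w => (X w, Y w)))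
  (samples_indep : mutual_independence P (fun (o : option nat) w =>
     if o is Some i then (Xs i w, Ys i w) else (X w, Y w)))
  (beta : R) (beta_gt0 : 0 < beta)
  (K A : R) (K_gt0 : 0 < K) (A_gt0 : 0 < A)
  (conda : cond_variance P X Y)
  (condb : cond_tail P X f beta)
  (condc : cond_smooth P nm X Y f eta)
  (condd : cond_mass P nm X f)
  (condM : cond_bounded eta) :
  [/\ forall q : R, 0 < q < 1 -> cond_ratio_tail P nm X f beta A q ->
        eventually_bigO (excess_risk P nm K A q X Y eps Xs Ys)
                        (knn_rate d beta q),
      [/\ 0 < (optimal_q d : R) < 1,
          forall q : R, 0 < q < 1 ->
            (knn_rate d beta (optimal_q d) : nat -> R^o)
              =O_\oo (knn_rate d beta q : nat -> R^o),
          forall q : R, 0 < q < 1 ->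
            knn_lambda d q <= knn_lambda d (optimal_q d)
              ?= iff (q == optimal_q d) &
          knn_lambda d (optimal_q d) = 2 / (d%:R + 4) :> R] &
      beta != 4 / (d%:R + 4) ->
        cond_ratio_tail P nm X f beta A (optimal_q d) ->
        eventually_bigO (excess_risk P nm K A (optimal_q d) X Y eps Xs Ys)
          (fun N => N%:R `^ (- Num.min beta (4 / (d%:R + 4))))].
Proof.
have indV : mutual_independence P (fun o => if o is Some i
    then (fun w => (Xs i w, Ys i w)) else (fun w => (X w, Y w))).
  rewrite (_ : (fun _ => _) = (fun (o : option nat) w =>
    if o is Some i then (Xs i w, Ys i w) else (X w, Y w)))//.
  by apply/funext => -[].
have [M etaM] := condM.
have [Ca Ca0 [ieps2 eps2_le]] := eps_second_moment eta_meas Y_model eps_centered etaM conda.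
(* The maximum with 0 makes the constant nonnegative, so that the bias bound can be squared. *)
have [Cc0 condc0] := condc; pose Cc := Num.max Cc0 0.
have Cc_ge0 : 0 <= Cc by rewrite le_max lexx orbT.
have condc' (r : R) x : 0 < r -> f x != 0 ->
    `|event_condexp P Y (X @^-1` nball nm x r) - eta x| <= Cc * r ^+ 2.
  move=> r0 fx; apply: (le_trans (condc0 _ _ r0 fx)).
  by rewrite ler_wpM2r ?sqr_ge0// le_max lexx.
have [Cd Cd0 [D D0 massD]] := condd.
have [f_meas f_ge0 _] := X_density.
have main q : 0 < q < 1 -> cond_ratio_tail P nm X f beta A q ->
    eventually_bigO (excess_risk P nm K A q X Y eps Xs Ys) (knn_rate d beta q).
  move=> q01 condT.
  have [N0 kN] := knn_number_le_sample K_gt0 q01.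
  have [C C0 rateC] := knn_pointwise_rate d_gt0 nm_norm samples_law indV eta_meas
    Y_model eps_centered etaM Ca0 ieps2 eps2_le Cc_ge0 condc' Cd0 D0 massD K_gt0 q01 A_gt0.
  have C1_ge0 := dev_const_ge0 M Ca0.
  pose risk := knn_pointwise_risk nm Xs Ys eta K q A.
  have risk_ge0 N x : (0 <= risk N x)%E.
    by apply: integral_ge0 => w _; rewrite lee_fin sqr_ge0.
  have risk_C1 N x : (maxn N0 1 <= N)%N -> (risk N x <= (dev_const M Ca)%:E)%E.
    rewrite geq_max => /andP[N0N _].
    exact: (knn_pointwise_risk_le nm_norm samples_law indV Y_model etaM Ca0 ieps2 eps2_le _ _
      (kN _ N0N)).
  have mrisk N : measurable_fun setT (fun w => risk N (X w)).
    exact: measurable_knn_pointwise_risk.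
  have rate N x : (maxn N0 1 <= N)%N -> 0 < f x -> (risk N x <=
      (C * (N%:R * f x) `^ (- q) + C * (N%:R `^ (1 - q) *
        (f x / fine (P (X @^-1` nball nm x A)) `^ q)) `^ (- (4 / d%:R)))%:E)%E.
    by rewrite geq_max => /andP[N0N N1] fx; apply: rateC => //; exact: kN.
  have [C' [N1 hC']] := integrated_rate d_gt0 nm_norm f_meas f_ge0 beta_gt0 q01
    condb condT C0 C1_ge0 mrisk risk_ge0 risk_C1 rate.
  pose r N := fine (\int[P]_w risk N (X w))%E.
  have excessE N : (maxn N0 N1 <= N)%N ->
      excess_risk P nm K A q X Y eps Xs Ys N = (r N)%:E.
    rewrite geq_max => /andP[N0N _].
    have [-> fin] := excess_risk_pointwise nm_norm samples_law indV eta_meas Y_model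
      eps_centered etaM Ca0 ieps2 eps2_le A (kN _ N0N).
    by rewrite /r fineK.
  apply: (eventually_bigO_of_le excessE (C := C')) => N.
  move=> /[dup] /excessE rE; rewrite geq_max => /andP[N0N N1N].
  rewrite fine_ge0 /=; last by apply: integral_ge0.
  have [_ fin] := excess_risk_pointwise nm_norm samples_law indV eta_meas Y_model
    eps_centered etaM Ca0 ieps2 eps2_le A (kN _ N0N).
  by rewrite -lee_fin fineK//; exact: hC'.
split => //.
- split.
  + exact: optimal_q_bounds.
  + by move=> q q01; exact: knn_rate_optimal.
  + by move=> q q01; exact: knn_lambda_leif.
  + exact: knn_lambda_optimal.
- move=> b4 condT; have := main _ (optimal_q_bounds d_gt0) condT.
  have l4 : 2 * knn_lambda d (optimal_q d) = 4 / (d%:R + 4) :> R.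
    by rewrite knn_lambda_optimal// mulrA -natrM.
  rewrite (_ : knn_rate d beta (optimal_q d) =
    (fun N => N%:R `^ (- Num.min beta (4 / (d%:R + 4)))))//.
  by apply/funext => N; rewrite /knn_rate l4 (negbTE b4).
Qed.
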